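(* Let $B$ be a unital Banach algebra, let $(\mathcal{A},E,\varepsilon)$ be a Banach $B$-$B$-non-commutative probability space, let $X\in\mathcal{A}_\ell$ and $Y\in\mathcal{A}_r$. Then $$M^\ell_X(b)\,M_{X,Y}(b,c,d)+M_{X,Y}(b,c,d)\,M^r_Y(d)=M^\ell_X(b)\,c\,M^r_Y(d)+C_{X,Y}\big(M^\ell_X(b)b,\ M_{X,Y}(b,c,d),\ dM^r_Y(d)\big)$$ for all $c$ in any given bounded subset of $B$ and all $b,d\in B$ sufficiently small (i.e. for every $\rho>0$ there is $\delta>0$ such that the identity holds, with all series absolutely convergent, whenever $\|c\|\le\rho$, $\|b\|<\delta$, $\|d\|<\delta$).
   Context: All algebras are unital over $\mathbb{C}$. A $B$-$B$-non-commutative probability space is a triple $(\mathcal{A},E,\varepsilon)$ where $\mathcal{A}$ is a unital algebra, $\varepsilon:B\otimes B^{\mathrm{op}}\to\mathcal{A}$ is a unital homomorphism injective on $B\otimes 1_B$ and on $1_B\otimes B^{\mathrm{op}}$, and $E:\mathcal{A}\to B$ is linear with $E(1_{\mathcal A})=1_B$, $E(\varepsilon(b_1\otimes b_2)Z)=b_1E(Z)b_2$ and $E(Z\varepsilon(b\otimes1_B))=E(Z\varepsilon(1_B\otimes b))$ for all $b,b_1,b_2\in B$, $Z\in\mathcal{A}$. Write $L_b=\varepsilon(b\otimes1_B)$, $R_b=\varepsilon(1_B\otimes b)$ (so $L_{bb'}=L_bL_{b'}$, $R_{bb'}=R_{b'}R_b$), $\mathcal{A}_\ell=\{Z: ZR_b=R_bZ\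 \forall b\in B\}$, $\mathcal{A}_r=\{Z: ZL_b=L_bZ\ \forall b\in B\}$. It is a Banach $B$-$B$-non-commutative probability space if $B$ and $\mathcal{A}$ are Banach algebras and $E$, $\varepsilon|_{B\otimes1_B}$, $\varepsilon|_{1_B\otimes B^{\mathrm{op}}}$ are bounded. Bi-non-crossing partitions. For $\chi:\{1,\ldots,n\}\to\{\ell,r\}$ with $\chi^{-1}(\ell)=\{k_1<\cdots<k_p\}$, $\chi^{-1}(r)=\{k_{p+1}>\cdots>k_n\}$, put $s_\chi(q)=k_q$ and let $a\prec_\chi a'$ iff $s_\chi^{-1}(a)<s_\chi^{-1}(a')$. $BNC(\chi)$ is the set of partitions of $\{1,\ldots,n\}$ that are non-crossing for the total order $\prec_\chi$, ordered by refinement; $1_\chi$ is the one-block partition and $\mu_{BNC}$ is the Möbius function of this lattice. A $\chi$-interval is an interval for $\prec_\chi$. $\chi_{n,m}:\{1,\ldots,n+m\}\to\{\ell,r\}$ is $\ell$ on $k\le n$ and $r$ on $k>n$. Moments and cumulants. For $Z_k\in\mathcal{A}_{\chi(k)}$ and $\pi\in BNC(\chi)$, $E^B_\pi(Z_1,\ldots,Z_n)\in B$ is defined recursively (independently of choices): $E^B_{1_\chi}(Z_1,\ldots,Z_n)=E(Z_1\cdots Z_n)$; if $V$ is a proper non-empty $\chi$-interval that is a union of blocks of $\pi$, $W$ is its complement, and $\beta=E^B_{\pi|_V}((Z_k)_{k\in V})$, then $E^B_\pi=\beta\,E^B_{\pi|_W}((Z_k)_{k\in W})$ if $V$ is initial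 for $\prec_\chi$, $E^B_\pi=E^B_{\pi|_W}((Z_k)_{k\in W})\,\beta$ if $V$ is terminal, and otherwise $E^B_\pi=E^B_{\pi|_W}((Z'_k)_{k\in W})$, where $Z'_k=Z_k$ except that for the immediate $\prec_\chi$-predecessor $p$ of $V$, $Z'_p=Z_pL_\beta$ if $\chi(p)=\ell$ and $Z_p'=R_\beta Z_p$ if $\chi(p)=r$. The cumulants are $\kappa^B_\pi=\sum_{\sigma\le\pi}E^B_\sigma\,\mu_{BNC}(\sigma,\pi)$ and $\kappa^B_\chi:=\kappa^B_{1_\chi}$. Series (for $b,c,d\in B$): $M^\ell_X(b)=1+\sum_{n\ge1}E((L_bX)^n)$, $\ M^r_Y(d)=1+\sum_{n\ge1}E((R_dY)^n)$, $\ M_{X,Y}(b,c,d)=\sum_{n,m\ge0}E((L_bX)^n(R_dY)^mR_c)$, $$C_{X,Y}(b,c,d)=c+\sum_{n\ge1}\kappa^B_{\chi_{n,0}}(\underbrace{L_bX,\ldots,L_bX}_{n-1},L_bXL_c)+\sum_{m\ge1,\,n\ge0}\kappa^B_{\chi_{n,m}}(\underbrace{L_bX,\ldots,L_bX}_{n},\underbrace{R_dY,\ldots,R_dY}_{m-1},R_dYR_c).$$ For $c$ in a bounded set these converge absolutely when $b,d$ are sufficiently small. *)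

(* Defs.v *)
From HB Require Import structures.
From mathcomp Require Import all_boot all_order all_algebra.

Set Implicit Arguments.
Unset Strict Implicit.
Unset Printing Implicit Defensive.

Import Order.TTheory GRing.Theory Num.Theory.
Local Open Scope ring_scope.

(* A linear map eps~ : B (x) B^op -> A is given by the bilinear map
   eps b1 b2 = eps~ (b1 (x) b2); eps~ is a unital homomorphism iff eps 1 1 = 1
   and eps~ is multiplicative on elementary tensors, whose product in
   B (x) B^op is (b1 (x) b2) (b1' (x) b2') = (b1 b1') (x) (b2' b2). *)
Record bb_ncps (K : comNzRingType) (A B : algType K)
    (E : A -> B) (eps : B -> B -> A) : Prop := BBNcps {
  eps_linl : forall b2, linear (fun b1 => eps b1 b2);
  eps_linr : forall b1, linear (eps b1);
  eps_one : eps 1 1 = 1;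
  eps_mul : forall b1 b2 b1' b2',
    eps b1 b2 * eps b1' b2' = eps (b1 * b1') (b2' * b2);
  eps_injl : injective (fun b => eps b 1);
  eps_injr : injective (eps 1);
  E_lin : linear E;
  E_one : E 1 = 1;
  E_bimod : forall b1 b2 Z, E (eps b1 b2 * Z) = b1 * E Z * b2;
  E_balanced : forall b Z, E (Z * eps b 1) = E (Z * eps 1 b)
}.

Definition Lop (A B : nzRingType) (eps : B -> B -> A) (b : B) : A := eps b 1.
Definition Rop (A B : nzRingType) (eps : B -> B -> A) (b : B) : A := eps 1 b.

Definition left_face (A B : nzRingType) (eps : B -> B -> A) (Z : A) : Prop :=
  forall b, Z * Rop eps b = Rop eps b * Z.
Definition right_face (A B : nzRingType) (eps : B -> B -> A) (Z : A) : Prop :=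
  forall b, Z * Lop eps b = Lop eps b * Z.

Variant side := lft | rgt.
Definition is_left (s : side) : bool := if s is lft then true else false.

(* The sequence s_chi(1), ..., s_chi(n). *)
Definition s_chi (n : nat) (chi : 'I_n -> side) : seq 'I_n :=
  [seq i <- enum 'I_n | is_left (chi i)]
    ++ rev [seq i <- enum 'I_n | ~~ is_left (chi i)].

Definition prec (n : nat) (chi : 'I_n -> side) (a a' : 'I_n) : bool :=
  (index a (s_chi chi) < index a' (s_chi chi))%N.

Definition noncrossing (n : nat) (chi : 'I_n -> side)
    (pi : {set {set 'I_n}}) : bool :=
  [forall U in pi, forall V in pi, (U != V) ==>
    ~~ [exists a in U, exists b in V, exists c in U, exists d in V,
          [&& prec chi a b, prec chi b c & prec chi c d]]].

Definition BNC (n : nat) (chi : 'I_n -> side) : {set {set {set 'I_n}}} :=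
  [set pi : {set {set 'I_n}} | partition pi [set: 'I_n] && noncrossing chi pi].

Definition finer (n : nat) (sigma pi : {set {set 'I_n}}) : bool :=
  [forall U in sigma, exists V in pi, U \subset V].

(* mu(x, x) = 1 and mu(x, y) = - sum_(x <= z < y) mu(x, z) in the poset (P, le);
   the recursion depth is bounded by the length of a chain. *)
Fixpoint mobius_rec (T : finType) (P : {set T}) (le : rel T) (k : nat)
    (x y : T) : int :=
  if x == y then 1 else
  if k is k'.+1 then
    - \sum_(z in P | [&& le x z, le z y & z != y]) mobius_rec P le k' x z
  else 0.

Definition mobius (T : finType) (P : {set T}) (le : rel T) (x y : T) : int :=
  mobius_rec P le #|T| x y.

Definition mu_BNC (n : nat) (chi : 'I_n -> side)
    (sigma pi : {set {set 'I_n}}) : int :=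
  mobius (BNC chi) (@finer n) sigma pi.

(* Intervals of S for the restriction of the order prec chi to S. *)
Definition chi_interval (n : nat) (chi : 'I_n -> side) (S V : {set 'I_n}) :=
  [forall a in V, forall b in V, forall k in S,
     (prec chi a k && prec chi k b) ==> (k \in V)].

Definition chi_initial (n : nat) (chi : 'I_n -> side) (S V : {set 'I_n}) :=
  [forall a in V, forall k in S :\: V, prec chi a k].

Definition chi_terminal (n : nat) (chi : 'I_n -> side) (S V : {set 'I_n}) :=
  [forall a in V, forall k in S :\: V, prec chi k a].

(* p is the greatest element of S lying before all of V. *)
Definition chi_pred (n : nat) (chi : 'I_n -> side) (S V : {set 'I_n})
    (p : 'I_n) :=
  [&& p \in S :\: V, [forall a in V, prec chi p a] &
      [forall k in S :\: V, [forall a in V, prec chi k a] ==>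
         ~~ prec chi p k]].

(* V is a proper nonempty interval of S and a union of blocks of pi. *)
Definition splits (n : nat) (chi : 'I_n -> side) (pi : {set {set 'I_n}})
    (S V : {set 'I_n}) : bool :=
  [&& V != set0, V \proper S, chi_interval chi S V
    & cover (pi ::&: V) == V].

Definition insert_at (A B : nzRingType) (eps : B -> B -> A) (n : nat)
    (chi : 'I_n -> side) (S V : {set 'I_n}) (beta : B) (Z : 'I_n -> A) :
    'I_n -> A :=
  fun k => if chi_pred chi S V k then
             (if is_left (chi k) then Z k * Lop eps beta
              else Rop eps beta * Z k)
           else Z k.

(* For S a union of blocks of pi, moment_rec chi pi k S Z is the moment
   E^B_{pi|S}((Z_i)_{i in S}).  If no V splits S, then pi|S has one block and the
   product is taken in the natural order of the indices.  The value does not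
   depend on the V that is picked.  The fuel k only has to be at least #|S|. *)
Fixpoint moment_rec (A B : nzRingType) (E : A -> B) (eps : B -> B -> A)
    (n : nat) (chi : 'I_n -> side) (pi : {set {set 'I_n}}) (k : nat)
    (S : {set 'I_n}) (Z : 'I_n -> A) : B :=
  match k, [pick V : {set 'I_n} | splits chi pi S V] with
  | k'.+1, Some V =>
    let W := S :\: V in
    let beta := moment_rec E eps chi pi k' V Z in
    if chi_initial chi S V then beta * moment_rec E eps chi pi k' W Z
    else if chi_terminal chi S V then moment_rec E eps chi pi k' W Z * beta
    else moment_rec E eps chi pi k' W (insert_at eps chi S V beta Z)
  | _, _ => E (\prod_(i < n | i \in S) Z i)
  end.

Definition moment (A B : nzRingType) (E : A -> B) (eps : B -> B -> A)
    (n : nat) (chi : 'I_n -> side) (pi : {set {set 'I_n}}) (Z : 'I_n -> A) : B :=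
  moment_rec E eps chi pi n [set: 'I_n] Z.

Definition cumulant (A B : nzRingType) (E : A -> B) (eps : B -> B -> A)
    (n : nat) (chi : 'I_n -> side) (pi : {set {set 'I_n}}) (Z : 'I_n -> A) : B :=
  \sum_(sigma in BNC chi | finer sigma pi)
    moment E eps chi sigma Z *~ mu_BNC chi sigma pi.

Definition kappa (A B : nzRingType) (E : A -> B) (eps : B -> B -> A)
    (n : nat) (chi : 'I_n -> side) (Z : 'I_n -> A) : B :=
  cumulant E eps chi [set [set: 'I_n]] Z.

Definition chi_nm (n m : nat) : 'I_(n + m) -> side :=
  fun k => if (k < n)%N then lft else rgt.

(* L_b X at the first n places, R_d Y at the other m places, and the last entry
   (of index n + m - 1) multiplied on the right by L_c if it is an L_b X and by
   R_c if it is an R_d Y. *)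
Definition C_args (A B : nzRingType) (eps : B -> B -> A) (X Y : A) (b c d : B)
    (n m : nat) : 'I_(n + m) -> A :=
  fun k =>
    let last := (k.+1 == n + m)%N in
    if (k < n)%N then
      (if last then Lop eps b * X * Lop eps c else Lop eps b * X)
    else
      (if last then Rop eps d * Y * Rop eps c else Rop eps d * Y).

Definition Ml_term (A B : nzRingType) (E : A -> B) (eps : B -> B -> A) (X : A)
    (b : B) (n : nat) : B :=
  E ((Lop eps b * X) ^+ n.+1).

Definition Mr_term (A B : nzRingType) (E : A -> B) (eps : B -> B -> A) (Y : A)
    (d : B) (n : nat) : B :=
  E ((Rop eps d * Y) ^+ n.+1).

Definition M_term (A B : nzRingType) (E : A -> B) (eps : B -> B -> A) (X Y : A)
    (b c d : B) (nm : nat * nat) : B :=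
  E ((Lop eps b * X) ^+ nm.1 * (Rop eps d * Y) ^+ nm.2 * Rop eps c).

(* The two series of C_{X,Y}: (n, m) = (n'+1, 0) and (n, m) = (n, m'+1). *)
Definition Cl_term (A B : nzRingType) (E : A -> B) (eps : B -> B -> A) (X Y : A)
    (b c d : B) (n : nat) : B :=
  kappa E eps (@chi_nm n.+1 0) (@C_args A B eps X Y b c d n.+1 0).

Definition Clr_term (A B : nzRingType) (E : A -> B) (eps : B -> B -> A)
    (X Y : A) (b c d : B) (nm : nat * nat) : B :=
  kappa E eps (@chi_nm nm.1 nm.2.+1) (@C_args A B eps X Y b c d nm.1 nm.2.+1).

(* Only from here on, because all_classical shadows finset's cover, partition,
   set0 and set1. *)
From mathcomp Require Import finmap.
From mathcomp Require Import complex.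
From mathcomp Require Import all_classical all_reals all_analysis.
From mathcomp Require Import summability.
Import numFieldNormedType.Exports.

(* A unital Banach algebra over K, with norm valued in the scalar field K; for
   K = R[i] the values of the norm are nonnegative reals.  The normalization
   `|1| = 1 is not imposed.  This is a record and not an HB structure because HB
   has no join of the ring structures with the normed modules: the canonical
   algType and completeNormedModType instances are put on banach_sort below. *)
Record banachAlgType (K : numFieldType) := BanachAlgebra {
  ba_space : completeNormedModType K;
  ba_one : ba_space;
  ba_mul : ba_space -> ba_space -> ba_space;
  ba_mulA : associative ba_mul;
  ba_mul1r : left_id ba_one ba_mul;
  ba_mulr1 : right_id ba_one ba_mul;
  ba_mulDl : left_distributive ba_mul +%R;
  ba_mulDr : right_distributive ba_mul +%R;
  ba_one_neq0 : ba_one != 0;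
  ba_scaleAl : forall (a : K) (u v : ba_space),
    a *: ba_mul u v = ba_mul (a *: u) v;
  ba_scaleAr : forall (a : K) (u v : ba_space),
    a *: ba_mul u v = ba_mul u (a *: v);
  ba_normM : forall u v : ba_space, `|ba_mul u v| <= `|u| * `|v|
}.

Definition banach_sort (K : numFieldType) (A : banachAlgType K) : Type :=
  ba_space A.
Coercion banach_sort : banachAlgType >-> Sortclass.

HB.instance Definition _ (K : numFieldType) (A : banachAlgType K) :=
  CompleteNormedModule.copy (banach_sort A) (ba_space A).
HB.instance Definition _ (K : numFieldType) (A : banachAlgType K) :=
  GRing.Zmodule_isNzRing.Build (banach_sort A) (@ba_mulA K A) (@ba_mul1r K A)
    (@ba_mulr1 K A) (@ba_mulDl K A) (@ba_mulDr K A) (@ba_one_neq0 K A).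
HB.instance Definition _ (K : numFieldType) (A : banachAlgType K) :=
  GRing.Lmodule_isLalgebra.Build K (banach_sort A) (@ba_scaleAl K A).
HB.instance Definition _ (K : numFieldType) (A : banachAlgType K) :=
  GRing.Lalgebra_isAlgebra.Build K (banach_sort A) (@ba_scaleAr K A).

Definition bounded_map (K : numFieldType) (V W : normedModType K)
    (f : V -> W) : Prop :=
  exists M : K, forall x, `|f x| <= M * `|x|.

Record banach_bb_ncps (K : numFieldType) (A B : banachAlgType K)
    (E : A -> B) (eps : B -> B -> A) : Prop := BanachBBNcps {
  banach_ncps : bb_ncps E eps;
  E_bounded : bounded_map E;
  epsl_bounded : bounded_map (fun b => eps b 1);
  epsr_bounded : bounded_map (eps 1)
}.

Definition abs_summable (I : choiceType) (K : numFieldType)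
    (V : normedModType K) (x : I -> V) : Prop :=
  exists M : K, forall J : {fset I}, partial_sum (fun i => `|x i|) J <= M.

(* [sum] is the limit of the finite partial sums along the directed set of
   finite sets of indices. *)
Definition Ml (K : numFieldType) (A B : banachAlgType K)
    (E : A -> B) (eps : B -> B -> A) (X : A) (b : B) : B :=
  1 + sum (Ml_term E eps X b).

Definition Mr (K : numFieldType) (A B : banachAlgType K)
    (E : A -> B) (eps : B -> B -> A) (Y : A) (d : B) : B :=
  1 + sum (Mr_term E eps Y d).

Definition Mxy (K : numFieldType) (A B : banachAlgType K)
    (E : A -> B) (eps : B -> B -> A) (X Y : A) (b c d : B) : B :=
  sum (M_term E eps X Y b c d).

Definition Cxy (K : numFieldType) (A B : banachAlgType K)
    (E : A -> B) (eps : B -> B -> A) (X Y : A) (b c d : B) : B :=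
  c + sum (Cl_term E eps X Y b c d) + sum (Clr_term E eps X Y b c d).

(* Main.v *)
(* Order the letters of a product by the order of chi and let b in B act on a
   letter Z by Z L_b or R_b Z.  Sorting the partitions in BNC(chi) by the block of
   the first letter turns the moment-cumulant relation into a recursion on words:
   the moment is the sum, over the blocks containing the first letter, of the
   cumulant of the block, in which every letter is acted on by the moment of the
   gap behind it.  This recursion has a unique solution, and Moebius inversion
   identifies it with kappa.  Coefficients L_b X or R_d Y R_c in front of a letter
   are absorbed by the letter before.

   Cumulants, like moments, grow at most geometrically, so for small b and d the
   recursion can be summed over all words x^n y^m, with x = L_b X and y = R_d Y.
   Write ml, mr, mxy for M^l_X(b), M^r_Y(d), M_{X,Y}(b,c,d).  Summing over the
   lengths of the gaps replaces every gap inside x^n by ml, every gap inside y^m by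
   mr, and the gap at the change of faces by mxy.  For powers of x this gives
   ml k = ml - 1, where k is the sum over n of the cumulants of x ml, .., x ml, x,
   and likewise for y; for mixed words it gives mxy = ml c mr + ml S mr, where S is
   the sum of the cumulants of x ml, .., x mxy, y mr, .., y over blocks that have
   letters of both faces.  The cumulant series C_{X,Y}(ml b, mxy, d mr) splits into
   mxy, the left part (ml - 1) mxy, the right part mxy (mr - 1), and ml S mr. *)
Require Import Defs.
From HB Require Import structures.
From mathcomp Require Import all_boot all_order all_algebra.
From mathcomp Require Import ring lra.

Set Implicit Arguments.
Unset Strict Implicit.
Unset Printing Implicit Defensive.

Import Order.TTheory GRing.Theory Num.Theory.
Local Open Scope ring_scope.

(** * Substitution of functions on words *)

(** Summation over words needs cumulants that are additive in every coefficient, right linear in the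
    last letter and geometrically bounded, so they are built in closed form. Write [f<g>] for
    [subst f g] and [f * g] for convolution. By the law [(f<g>)<h> = f<h * g<h>>], the functional
    [K = f<P>] solves [K<f> = f] as soon as [f * P<f>] is the unit, and this holds for the solution
    [P] of [P = N<P>], where [N] is the convolution inverse of [f]. Inversion, fixed point and
    substitution all keep the algebraic properties and cost only a constant factor in the growth
    rate. The recursion that defines moments picks an arbitrary interval at each step. Partitions
    are therefore evaluated by a stack that reads the line once and makes no choices; the initial,
    terminal and inner rules of the definition are identities for this evaluation, whichever
    interval is picked. Since [B] is not commutative, summing the recursion puts the cumulant series
    of one letter on the left of the moment series, while the identity also needs the opposite
    order; the two agree because the cumulant series has norm less than 1. *)

Section Words.
Variables (B : nzRingType) (T : Type) (act : T -> B -> T).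

(** These properties of moments survive substitution and inversion. They stand in for multilinearity
    over [B], since letters form a mere type with a right action. *)
Record admissible (f : seq T -> B) : Prop := Admissible {
  adm_nil : f [::] = 1;
  adm_rcons : forall w t b, f (rcons w (act t b)) = f (rcons w t) * b;
  adm_add : forall w t b b' v,
    f (w ++ act t (b + b') :: v) = f (w ++ act t b :: v) + f (w ++ act t b' :: v)
}.

(** Convolution over the splittings of [v], with [u] already given to the first factor. *)
Fixpoint conv (f g : seq T -> B) (u v : seq T) : B :=
  f u * g v + (if v is q :: v' then conv f g (rcons u q) v' else 0).

(* Letters are read from left to right.  The block of the first letter consists so
   far of [w], whose letters already carry the values of the gaps behind them, and
   of the letter [t]; [G] is the gap behind [t] so far and [r] is still unread. *)
Fixpoint psi_gen (k : seq T -> T -> seq T -> B) (g : seq T -> B)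
    (w : seq T) (t : T) (G r : seq T) : B :=
  if r is q :: r' then
    psi_gen k g w t (rcons G q) r'
    + psi_gen k g (rcons w (act t (g G))) q [::] r'
  else k w t G.

(** The last gap multiplies from the right, which for an admissible [f] amounts to acting on the
    last letter. [psi_gen] leaves the final evaluation open so that one substitution can be nested
    in another. *)
Definition psi (f g : seq T -> B) : seq T -> T -> seq T -> seq T -> B :=
  psi_gen (fun w t G => f (rcons w t) * g G) g.

Definition subst (f g : seq T -> B) (w : seq T) : B :=
  if w is t :: r then psi f g [::] t [::] r else 1.

Hypothesis actM : forall t b b', act (act t b) b' = act t (b * b').
Hypothesis act1 : forall t, act t 1 = t.

Lemma psi_gen_add k1 k2 g w t G r :
  psi_gen (fun w t G => k1 w t G + k2 w t G) g w t G r
  = psi_gen k1 g w t G r + psi_gen k2 g w t G r.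
Proof.
elim: r w t G => //= q r IH w t G.
by rewrite !IH addrACA.
Qed.

Lemma eq_psi_gen k1 k2 g w t G r : (forall w t G, k1 w t G = k2 w t G) ->
  psi_gen k1 g w t G r = psi_gen k2 g w t G r.
Proof. by move=> e; elim: r w t G => //= q r IH w t G; rewrite !IH. Qed.

Lemma psi_gen_raddf (h : B -> B) k g w t G r : {morph h : x y / x + y} ->
  h (psi_gen k g w t G r) = psi_gen (fun w t G => h (k w t G)) g w t G r.
Proof. by move=> hD; elim: r w t G => //= q r IH w t G; rewrite hD !IH. Qed.

Lemma psi_gen_rcons k g w t G r q :
  psi_gen k g w t G (rcons r q)
  = psi_gen (fun w t G => k w t (rcons G q) + k (rcons w (act t (g G))) q [::])
      g w t G r.
Proof. by elim: r w t G => //= p r IH w t G; rewrite !IH. Qed.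

Lemma psi_gen_cat k g u w t G r :
  psi_gen k g (u ++ w) t G r = psi_gen (fun w => k (u ++ w)) g w t G r.
Proof. by elim: r w t G => //= q r IH w t G; rewrite rcons_cat !IH. Qed.

Section Additive.
Variables (f g : seq T -> B) (fA : admissible f) (gA : admissible g).

Lemma adm_rcons_add w t b b' :
  f (rcons w (act t (b + b'))) = f (rcons w (act t b)) + f (rcons w (act t b')).
Proof. by rewrite !adm_rcons // mulrDr. Qed.

Lemma psi_add_block u x b b' w t G r :
  psi f g (u ++ act x (b + b') :: w) t G r
  = psi f g (u ++ act x b :: w) t G r + psi f g (u ++ act x b' :: w) t G r.
Proof.
elim: r w t G => [|q r IH] w t G; rewrite /psi /=.
  by rewrite !rcons_cat !rcons_cons (adm_add fA) mulrDl.
by rewrite !rcons_cat !rcons_cons -!/(psi f g _ _ _ _) !IH addrACA.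
Qed.

Lemma psi_block0 u x w t G r : psi f g (u ++ act x 0 :: w) t G r = 0.
Proof.
have := psi_add_block u x 0 0 w t G r; rewrite addr0 => /eqP.
by rewrite -subr_eq0 opprD addNKr oppr_eq0 => /eqP.
Qed.

Lemma psi_add_last x b b' w G r :
  psi f g w (act x (b + b')) G r
  = psi f g w (act x b) G r + psi f g w (act x b') G r.
Proof.
elim: r G => [|q r IH] G; rewrite /psi /=.
  by rewrite adm_rcons_add mulrDl.
rewrite -!/(psi f g _ _ _ _) !IH !actM mulrDl -!cats1 psi_add_block.
by rewrite addrACA.
Qed.

Lemma psi_add_gap x b b' w t G1 G2 r :
  psi f g w t (G1 ++ act x (b + b') :: G2) r
  = psi f g w t (G1 ++ act x b :: G2) r + psi f g w t (G1 ++ act x b' :: G2) r.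
Proof.
elim: r G2 => [|q r IH] G2; rewrite /psi /=.
  by rewrite (adm_add gA) mulrDr.
rewrite -!/(psi f g _ _ _ _) !rcons_cat !rcons_cons !IH (adm_add gA).
by rewrite -!cats1 psi_add_block addrACA.
Qed.

Lemma psi_add_rest x b b' w t G r1 r2 :
  psi f g w t G (r1 ++ act x (b + b') :: r2)
  = psi f g w t G (r1 ++ act x b :: r2) + psi f g w t G (r1 ++ act x b' :: r2).
Proof.
elim: r1 w t G => [|q r IH] w t G; rewrite /psi /= -!/(psi f g _ _ _ _).
  rewrite -!cats1 psi_add_gap.
  by rewrite psi_add_last addrACA.
by rewrite !IH addrACA.
Qed.

Lemma psi_last_act w t b : psi f g w (act t b) [::] [::] = psi f g w t [::] [::] * b.
Proof. by rewrite /psi /= adm_rcons // -!mulrA (adm_nil gA) !mul1r mulr1. Qed.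

Lemma psi_rcons_act w t G r x b :
  psi f g w t G (rcons r (act x b)) = psi f g w t G (rcons r x) * b.
Proof.
elim: r w t G => [|q r IH] w t G; rewrite /psi /= -!/(psi f g _ _ _ _).
  rewrite (adm_rcons gA) (adm_nil gA) (adm_rcons fA).
  by rewrite mulrDl !mulr1 !mulrA.
by rewrite !IH mulrDl.
Qed.

Lemma subst_adm : admissible (subst f g).
Proof.
split=> //.
- case=> [|t w] x b; first exact: psi_last_act.
  exact: psi_rcons_act.
- case=> [|t w] x b b' v; first exact: psi_add_last.
  exact: psi_add_rest.
Qed.

End Additive.

Lemma eq_psi_size f g g' w t G r :
    (forall v, size v <= size G + size r -> g v = g' v)%N ->
  psi f g w t G r = psi f g' w t G r.
Proof.
rewrite /psi; elim: r w t G => [|q r IH] w t G e /=.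
  by rewrite e // addn0.
rewrite !IH ?e ?leq_addr // => v Hv; apply: e; move: Hv.
  by rewrite /= add0n => Hv; apply: leq_trans Hv _; rewrite addnS leqW ?leq_addl.
by rewrite size_rcons addSnnS.
Qed.

(** A gap never contains the first letter, so it is shorter than the word. The recursions on words
    below rest on this. *)
Lemma eq_subst_size f g g' w :
  (forall v, size v < size w -> g v = g' v)%N -> subst f g w = subst f g' w.
Proof. by case: w => //= t r e; apply: eq_psi_size => v; rewrite add0n; apply: e. Qed.

Lemma eq_substr f g g' : g =1 g' -> subst f g =1 subst f g'.
Proof. by move=> e w; apply: eq_subst_size. Qed.

Definition delta (w : seq T) : B := if w is [::] then 1 else 0.

(** A non-empty gap acts on a letter by zero, and by additivity the whole term vanishes; only the
    block of all letters survives. *)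
Lemma subst_delta f : admissible f -> subst f delta =1 f.
Proof.
move=> fA [|t r]; first by rewrite /= (adm_nil fA).
have gap0 w t' G q r' : psi f delta w t' (rcons G q) r' = 0.
  elim: r' w t' G q => [|p r' IH] w t' G q; rewrite /psi /=.
    by case: G => [|? ?] /=; rewrite mulr0.
  rewrite -!/(psi f delta _ _ _ _) IH add0r.
  have -> : delta (rcons G q) = 0 by case: (G).
  by rewrite -cats1 psi_block0.
rewrite /=; suff H w t' : psi f delta w t' [::] r = f (w ++ t' :: r) by rewrite H.
elim: r w t' => [|q r IH] w t'; rewrite /psi /=.
  by rewrite mulr1 cats1.
by rewrite -!/(psi f delta _ _ _ _) (gap0 _ _ [::]) add0r act1 IH cat_rcons.
Qed.

(** The part of a convolution in which the second factor is non-empty, with the first letter of that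
    factor singled out. *)
Fixpoint spl (k : seq T -> T -> seq T -> B) (u v : seq T) : B :=
  if v is s :: v' then k u s v' + spl k (rcons u s) v' else 0.

Lemma spl_rcons k u v q :
  spl k u (rcons v q) = spl (fun h s v' => k h s (rcons v' q)) u v + k (u ++ v) q [::].
Proof.
elim: v u => [|s v IH] u /=; first by rewrite cats0 addr0 add0r.
by rewrite IH -addrA cat_rcons.
Qed.

Lemma spl_add k1 k2 u v :
  spl (fun h s v' => k1 h s v' + k2 h s v') u v = spl k1 u v + spl k2 u v.
Proof. by elim: v u => [|s v IH] u /=; rewrite ?addr0 // IH addrACA. Qed.

Lemma eq_spl k1 k2 u v : (forall h s v', k1 h s v' = k2 h s v') ->
  spl k1 u v = spl k2 u v.
Proof. by move=> e; elim: v u => //= s v IH u; rewrite e IH. Qed.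

Lemma spl_raddf (h : B -> B) k u v : {morph h : x y / x + y} ->
  h (spl k u v) = spl (fun u s v => h (k u s v)) u v.
Proof.
move=> hD; have h0 : h 0 = 0.
  have := hD 0 0; rewrite addr0 => /eqP.
  by rewrite -subr_eq0 opprD addNKr oppr_eq0 => /eqP.
by elim: v u => //= s v IH u; rewrite hD IH.
Qed.

Lemma conv_spl f g u v : g [::] = 1 ->
  conv f g u v = f (u ++ v) + spl (fun u s v => f u * g (s :: v)) u v.
Proof.
move=> g1; elim: v u => [|q v IH] u /=; first by rewrite cats0 g1 mulr1.
by rewrite IH cat_rcons addrCA.
Qed.

(* Both sides follow the letters of the word one by one: the left one first chooses
   the letters kept by the outer substitution, and [comp_block], [comp_gap]
   record whether the current one is a letter of the block of [f] or lies in
   a gap of the inner substitution. *)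
Section Composition.
Variables (f g h : seq T -> B).
Hypotheses (fA : admissible f) (gA : admissible g) (hA : admissible h).

Let comp_block W t H r :=
  psi_gen (fun w t H =>
    (if rcons w t is x :: v then psi f g W x [::] v else 0) * h H) h [::] t H r.
Let comp_gap W t G s H r :=
  psi_gen (fun w s H =>
    (if rcons w s is x :: v then psi f g W t (rcons G x) v else 0) * h H) h
    [::] s H r.

Lemma comp_block_cons W t H q r :
  comp_block W t H (q :: r)
  = comp_block W t (rcons H q) r + comp_block (rcons W (act t (h H))) q [::] r
    + comp_gap W (act t (h H)) [::] q [::] r.
Proof.
rewrite /comp_block /comp_gap /= -addrA; congr (_ + _).
rewrite -(cats0 [:: act t (h H)]) psi_gen_cat -psi_gen_add.
apply: eq_psi_gen => w s H' /=.
rewrite -mulrDl; congr (_ * _).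
case: w => [|x w] /=.
  by rewrite /psi /= (adm_nil gA) act1 addrC.
by rewrite /psi /= (adm_nil gA) act1 addrC.
Qed.

(** The next letter extends the gap of [h] or is kept; a kept letter continues the gap of [g] or
    ends it and joins the block of [f]. In the last case right linearity of [g] merges both values
    into one coefficient. *)
Lemma comp_gap_cons W t G s H q r :
  comp_gap W t G s H (q :: r)
  = comp_gap W t G s (rcons H q) r + comp_gap W t (rcons G (act s (h H))) q [::] r
    + comp_block (rcons W (act t (g (rcons G s) * h H))) q [::] r.
Proof.
rewrite /comp_block /comp_gap /= -addrA; congr (_ + _).
rewrite -(cats0 [:: act s (h H)]) psi_gen_cat -psi_gen_add.
apply: eq_psi_gen => w p H' /=.
rewrite -mulrDl; congr (_ * _).
by case: w => [|x w] /=; rewrite /psi /= (adm_rcons gA).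
Qed.

Let M := fun w => conv h (subst g h) [::] w.

Lemma comp_block_add W t b b' q r :
  comp_block (rcons W (act t (b + b'))) q [::] r
  = comp_block (rcons W (act t b)) q [::] r
    + comp_block (rcons W (act t b')) q [::] r.
Proof.
rewrite /comp_block -psi_gen_add; apply: eq_psi_gen => w s H.
rewrite -mulrDl; congr (_ * _).
by case: (rcons w s) => [|x v]; rewrite ?addr0 // -!cats1 psi_add_block.
Qed.

(** While a gap [G] of [M] is being read, it is still open where its [h]-part ends. The invariant
    adds up the case that it has not ended and all positions [s] at which the second part may have
    begun. *)
Lemma subst_comp_aux W t G r :
  psi f M W t G r
  = comp_block W t G r
    + spl (fun H0 s G1 =>
        psi_gen (fun Q p H => comp_gap W (act t (h H0)) Q p H r) h [::] s [::] G1)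
      [::] G.
Proof.
elim: r W t G => [|q r IH] W t G; rewrite /psi /=.
  rewrite /comp_block /= {1}/M conv_spl //= mulrDr; congr (_ + _).
    by rewrite /psi /= (adm_nil gA) mulr1.
  rewrite (@spl_raddf ( *%R (f (rcons W t)))); last by move=> x y; rewrite mulrDr.
  apply: eq_spl => H0 s G1.
  rewrite mulrA /= (@psi_gen_raddf ( *%R (f (rcons W t) * h H0))); last first.
    by move=> x y; rewrite mulrDr.
  apply: eq_psi_gen => Q p H.
  by rewrite /comp_gap /= /psi /= (adm_rcons fA) !mulrA.
rewrite -!/(psi f M _ _ _ _) !IH /= addr0 comp_block_cons spl_rcons /=.
set L := fun b => comp_block (rcons W (act t b)) q [::] r.
have LD : {morph L : x y / x + y} by move=> x y; apply: comp_block_add.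
have -> : comp_block (rcons W (act t (M G))) q [::] r
    = L (h G) + spl (fun H0 s G1 => L (h H0 * subst g h (s :: G1))) [::] G.
  by rewrite -/(L (M G)) /M conv_spl // LD spl_raddf.
set S1 := spl _ _ _; set S2 := spl _ _ _; set S3 := spl _ _ _.
have -> : S3 = S1 + S2.
  rewrite -spl_add; apply: eq_spl => H0 s G1.
  rewrite psi_gen_rcons (@psi_gen_raddf (fun b => L (h H0 * b))); last first.
    by move=> x y; rewrite mulrDr LD.
  rewrite -psi_gen_add; apply: eq_psi_gen => Q p H.
  by rewrite comp_gap_cons /L actM.
by rewrite -!addrA; congr (_ + _); rewrite addrCA [in RHS]addrCA; congr (_ + _);
  rewrite addrCA.
Qed.

(** Behind a letter of the block of [f], the left side first has a gap of [h] and then a word that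
    is substituted by [h] and evaluated by [g]; together they form a gap read by [h * g<h>]. *)
Lemma subst_comp w : subst (subst f g) h w = subst f M w.
Proof.
case: w => //= t r; rewrite subst_comp_aux /= addr0.
by apply: eq_psi_gen => w s H; case: (rcons w s) (size_rcons w s).
Qed.

End Composition.

(** The inverse for convolution is the sum, over all ways to cut the word into non-empty pieces, of
    the product of the values [- f] of the pieces; [u] is the piece being read. *)
Fixpoint rinv_acc (f : seq T -> B) (u v : seq T) : B :=
  if v is q :: v' then - f u * rinv_acc f [:: q] v' + rinv_acc f (rcons u q) v'
  else - f u.

Definition rinv (f : seq T -> B) (w : seq T) : B :=
  if w is t :: r then rinv_acc f [:: t] r else 1.

Section RightInverse.
Variables (f : seq T -> B) (fA : admissible f).

Lemma conv_rinv_acc u v : conv f (rinv f) u v = - rinv_acc f u v.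
Proof.
elim: v u => [|q v IH] u /=; first by rewrite mulr1 addr0 opprK.
by rewrite IH opprD mulNr opprK.
Qed.

Lemma conv_rinv w : conv f (rinv f) [::] w = delta w.
Proof.
case: w => [|t r] /=; first by rewrite (adm_nil fA) mulr1 addr0.
by rewrite (adm_nil fA) mul1r conv_rinv_acc subrr.
Qed.

Lemma rinv_acc_add_left u1 x b b' u2 v :
  rinv_acc f (u1 ++ act x (b + b') :: u2) v
  = rinv_acc f (u1 ++ act x b :: u2) v + rinv_acc f (u1 ++ act x b' :: u2) v.
Proof.
elim: v u2 => [|q v IH] u2 /=; first by rewrite (adm_add fA) opprD.
by rewrite !rcons_cat !rcons_cons IH (adm_add fA) opprD mulrDl addrACA.
Qed.

Lemma rinv_acc_add_right u v1 x b b' v2 :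
  rinv_acc f u (v1 ++ act x (b + b') :: v2)
  = rinv_acc f u (v1 ++ act x b :: v2) + rinv_acc f u (v1 ++ act x b' :: v2).
Proof.
elim: v1 u => [|q v1 IH] u /=.
  rewrite (rinv_acc_add_left [::]) -!cats1 rinv_acc_add_left mulrDr.
  by rewrite addrACA.
by rewrite !IH mulrDr addrACA.
Qed.

Lemma rinv_acc_rcons u v t b :
  rinv_acc f u (rcons v (act t b)) = rinv_acc f u (rcons v t) * b.
Proof.
elim: v u => [|q v IH] u /=.
  rewrite (adm_rcons fA) (adm_rcons fA [::]).
  by rewrite mulrDl !mulNr !mulrN !mulNr !opprK mulrA.
by rewrite !IH mulrDl mulrA.
Qed.

Lemma rinv_adm : admissible (rinv f).
Proof.
split=> //.
- case=> [|t w] x b /=; last exact: rinv_acc_rcons.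
  by rewrite (adm_rcons fA [::]) mulNr.
- case=> [|t w] x b b' v; first exact: (rinv_acc_add_left [::]).
  exact: rinv_acc_add_right.
Qed.

End RightInverse.

(** Approximations to the solution of [P = f<P>]. As gaps are shorter than the word, the value is
    final once the fuel reaches the length. *)
Fixpoint subst_fix_rec (f : seq T -> B) (n : nat) : seq T -> B :=
  if n is n'.+1 then subst f (subst_fix_rec f n') else delta.

Definition subst_fix (f : seq T -> B) (w : seq T) : B :=
  subst_fix_rec f (size w) w.

Lemma subst_fix_rec_stable f n w : (size w <= n)%N ->
  subst_fix_rec f n w = subst_fix f w.
Proof.
rewrite /subst_fix; have [k] := ubnP (size w); elim: k n w => // k IH n w.
case: w => [|t r]; first by case: n.
case: n => // n Hk Hn.
change (subst f (subst_fix_rec f n) (t :: r)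
  = subst f (subst_fix_rec f (size r)) (t :: r)).
apply: eq_subst_size => v Hv; have Hvk := leq_trans Hv Hk.
transitivity (subst_fix_rec f (size v) v); [|symmetry]; apply: IH => //.
exact: leq_trans Hv Hn.
Qed.

Lemma subst_fixE f w : subst_fix f w = subst f (subst_fix f) w.
Proof.
case: w => [//|t r].
change (subst f (subst_fix_rec f (size r)) (t :: r)
  = subst f (subst_fix f) (t :: r)).
apply: eq_subst_size => v Hv.
by rewrite subst_fix_rec_stable.
Qed.

Lemma delta_adm : admissible delta.
Proof. by split=> [//|[|? ?] ? ?|[|? ?] *] /=; rewrite ?mul0r ?addr0. Qed.

Lemma subst_fix_adm f : admissible f -> admissible (subst_fix f).
Proof.
move=> fA; have recA n : admissible (subst_fix_rec f n).
  by elim: n => [|n IH] /=; [exact: delta_adm | exact: subst_adm].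
split=> // [w t b|w t b b' v].
- rewrite -!(@subst_fix_rec_stable f (size w).+1) ?size_rcons //.
  exact: adm_rcons.
- rewrite -!(@subst_fix_rec_stable f (size w + (size v).+1)) ?size_cat //.
  exact: adm_add.
Qed.

Lemma eq_conv f g g' u v :
  (forall w, (size w <= size v)%N -> g w = g' w) -> conv f g u v = conv f g' u v.
Proof.
elim: v u => [|q v IH] u e /=; first by rewrite e.
by rewrite e // IH // => w Hw; rewrite e // ltnW.
Qed.

Definition cumul (f : seq T -> B) : seq T -> B :=
  subst f (subst_fix (rinv f)).

Section Cumulant.
Variables (f : seq T -> B) (fA : admissible f).

Lemma cumul_adm : admissible (cumul f).
Proof. by apply: subst_adm => //; apply: subst_fix_adm; apply: rinv_adm. Qed.

(* With N the convolution inverse of f, P = N<P> and Q = f * P<f>, associativity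
   gives P<f> = N<Q>, hence Q = f * N<Q>, which forces Q = delta. *)
Lemma subst_cumul w : subst (cumul f) f w = f w.
Proof.
set P := subst_fix (rinv f).
have NA := rinv_adm fA; have PA : admissible P by apply: subst_fix_adm.
rewrite /cumul subst_comp //.
pose Q := fun w => conv f (subst P f) [::] w.
suff QE v : Q v = delta v by rewrite -[RHS](subst_delta fA); apply: eq_substr.
have [n] := ubnP (size v); elim: n v => // n IH v Hv.
rewrite -(conv_rinv fA); apply: eq_conv => u Hu.
transitivity (subst (rinv f) Q u).
  rewrite -(@subst_comp _ _ _ NA PA).
  by case: u Hu => // t r _; rewrite /subst; apply: eq_psi_gen => x y z;
     rewrite {1}/P subst_fixE.
rewrite -[RHS](subst_delta NA); apply: eq_subst_size => x Hx.
by apply: IH; apply: leq_trans (leq_trans Hx Hu) _.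
Qed.

End Cumulant.
End Words.

(** * Coefficients on both sides of a letter *)

Section Twist.
Variables (B : nzRingType) (T : Type) (act : T -> B -> T).
Hypothesis actM : forall t b b', act (act t b) b' = act t (b * b').
Hypothesis act1 : forall t, act t 1 = t.

(* A letter with a coefficient on each side; [shift_coef] moves each left
   coefficient to the right of the preceding letter. *)
Definition act2 (x : B * T) (b : B) : B * T := (x.1, act x.2 b).

Definition head_coef (w : seq (B * T)) (c : B) : B :=
  if w is x :: _ then x.1 else c.

Fixpoint shift_coef (w : seq (B * T)) (c : B) : seq T :=
  if w is x :: w' then act x.2 (head_coef w' c) :: shift_coef w' c else [::].

Definition twist (f : seq T -> B) (w : seq (B * T)) : B :=
  head_coef w 1 * f (shift_coef w 1).

Lemma head_coef_cat w v c : head_coef (w ++ v) c = head_coef w (head_coef v c).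
Proof. by case: w. Qed.

Lemma shift_coef_cat w v c :
  shift_coef (w ++ v) c = shift_coef w (head_coef v c) ++ shift_coef v c.
Proof. by elim: w => //= x w ->; rewrite head_coef_cat. Qed.

Lemma act2M x b b' : act2 (act2 x b) b' = act2 x (b * b').
Proof. by rewrite /act2 /= actM. Qed.

Lemma act21 x : act2 x 1 = x.
Proof. by case: x => a t; rewrite /act2 /= act1. Qed.

Lemma twist_adm f : admissible act f -> admissible act2 (twist f).
Proof.
move=> fA; split.
- by rewrite /twist /= (adm_nil fA) mulr1.
- move=> w x b; rewrite -!cats1 /twist !head_coef_cat !shift_coef_cat /= !act1.
  by rewrite !cats1 (adm_rcons fA) mulrA.
- move=> w x b b' v; rewrite /twist !head_coef_cat !shift_coef_cat /= !actM.
  by rewrite mulrDl (adm_add fA) mulrDr.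
Qed.

Lemma twist_act f G a : admissible act f ->
  twist f G * a = head_coef G a * f (shift_coef G a).
Proof.
move=> fA; case/lastP: G => [|G x].
  by rewrite /twist /= (adm_nil fA) !mulr1 mul1r.
rewrite /twist -!cats1 !head_coef_cat !shift_coef_cat /= !cats1 !act1.
by rewrite (adm_rcons fA) mulrA.
Qed.

(** The letter after a block letter is the head of its gap or, if the gap is empty, the next block
    letter; either way its left coefficient acts on that block letter. Hence shifting coefficients
    commutes with reading a block. *)
Lemma psi_twist f g W x G r : admissible act f -> admissible act g ->
  psi act2 (twist f) (twist g) W x G r
  = head_coef W x.1 * psi act f g (shift_coef W x.1)
      (act x.2 (head_coef (G ++ r) 1)) (shift_coef G (head_coef r 1))
      (shift_coef r 1).
Proof.
move=> fA gA; elim: r W x G => [|q r IH] W x G.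
  rewrite /psi /= {1}/twist -cats1 head_coef_cat shift_coef_cat /= act1 !cats1.
  by rewrite /twist cats0 (adm_rcons fA) !mulrA.
rewrite /psi /= -!/(psi act2 _ _ _ _ _) -!/(psi act _ _ _ _ _) !IH.
rewrite -!cats1 !head_coef_cat !shift_coef_cat /= mulrDr.
by rewrite !actM -twist_act.
Qed.

Lemma subst_twist f g w : admissible act f -> admissible act g ->
  subst act2 (twist f) (twist g) w = twist (subst act f g) w.
Proof.
move=> fA gA; case: w => [|x r]; first by rewrite /twist /= mul1r.
by rewrite /= psi_twist.
Qed.

End Twist.

(** * Evaluation of non-crossing partitions in one pass *)

(* Evaluation of a non-crossing partition by one pass over the line: the stack
   holds the blocks that are open, each with a representative, its letters but
   the last one, and its last letter.  A block that is complete is evaluated by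
   [f], and its value multiplies the last letter of the enclosing block. *)
Section Scan.
Variables (I : eqType) (B : nzRingType) (T : Type) (act : T -> B -> T).

Definition stack : Type := B * seq (I * seq T * T).

Definition act_stack (st : stack) (c : B) : stack :=
  if st is (b, (j, w, t) :: s) then (b, (j, w, act t c) :: s)
  else (st.1 * c, [::]).

Definition push (e : rel I) (i : I) (t : T) (st : stack) : stack :=
  if st is (b, (j, w, t') :: s) then
    if e j i then (b, (j, rcons w t', t) :: s)
    else (b, (i, [::], t) :: (j, w, t') :: s)
  else (st.1, [:: (i, [::], t)]).

Definition close (f : seq T -> B) (st : stack) : stack :=
  if st is (b, (j, w, t) :: s) then act_stack (b, s) (f (rcons w t)) else st.

(** [r] is lookahead only: a block stays open as long as a letter of it remains in [l' ++ r]. This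
    allows the scan to be cut at any point of the word. *)
Fixpoint scan (e : rel I) f (Z : I -> T) (st : stack) (l r : seq I) : stack :=
  if l is i :: l' then
    let st1 := push e i (Z i) st in
    scan e f Z (if has (e i) (l' ++ r) then st1 else close f st1) l' r
  else st.

Definition scan_val e f Z (l : seq I) : B := (scan e f Z (1, [::]) l [::]).1.

Definition reps (st : stack) : seq I := [seq x.1.1 | x <- st.2].

(** [y] placed on top of [st]: the value at the bottom of [y] acts on the topmost letter of [st], or
    on its value if no block is open. *)
Definition embed (y st : stack) : stack :=
  ((act_stack st y.1).1, y.2 ++ (act_stack st y.1).2).

Arguments embed : simpl never.
Arguments push : simpl never.
Arguments close : simpl never.
Arguments act_stack : simpl never.

Definition act_at (Z : I -> T) (p : I) (c : B) : I -> T :=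
  fun k => if k == p then act (Z k) c else Z k.

Hypothesis actM : forall t b b', act (act t b) b' = act t (b * b').
Hypothesis act1 : forall t, act t 1 = t.

Lemma act_stackM st b b' : act_stack (act_stack st b) b' = act_stack st (b * b').
Proof. by case: st => c [|[[j w] t] s]; rewrite /act_stack /= ?mulrA ?actM. Qed.

Lemma act_stack1 st : act_stack st 1 = st.
Proof. by case: st => c [|[[j w] t] s]; rewrite /act_stack /= ?mulr1 ?act1. Qed.

Lemma reps_act_stack st b : reps (act_stack st b) = reps st.
Proof. by case: st => c [|[[j w] t] s]. Qed.

Section Relation.
Variable e : rel I.

Lemma push_embed i t y st : {in reps st, forall j, ~~ e j i} ->
  push e i t (embed y st) = embed (push e i t y) st.
Proof.
case: y => b [|[[j w] t'] s] nst; rewrite /embed /push /=; last by case: ifP.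
rewrite -(reps_act_stack st b) in nst.
case: (act_stack st b) nst => c [|[[j w] t'] s] //= /(_ j).
by rewrite mem_head => /(_ isT) /negPf ->.
Qed.

Lemma close_embed f y st : y.2 <> [::] ->
  close f (embed y st) = embed (close f y) st.
Proof.
case: y => b [//|[[j w] t] [|[[j' w'] t'] s]] _ //.
rewrite /embed /close /= -act_stackM.
by case: (act_stack st b) => c s; rewrite /= -surjective_pairing.
Qed.

Lemma push_neq0 i t st : (push e i t st).2 <> [::].
Proof. by case: st => b [|[[j w] t'] s] //; rewrite /push; case: ifP. Qed.

Lemma scan_cat f Z st u v r :
  scan e f Z st (u ++ v) r = scan e f Z (scan e f Z st u (v ++ r)) v r.
Proof. by elim: u st => //= i u IH st; rewrite IH catA. Qed.

(** The scan is local: letters unrelated to the open blocks of [st] and to the lookahead [r] are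
    processed as if they stood alone. *)
Lemma scan_embed f Z y st v r :
  {in reps st & v, forall j i, ~~ e j i} -> {in v, forall i, ~~ has (e i) r} ->
  scan e f Z (embed y st) v r = embed (scan e f Z y v [::]) st.
Proof.
elim: v y => //= i v IH y nst nr.
rewrite push_embed; last by move=> j js; apply: nst; rewrite ?mem_head.
rewrite has_cat (negPf (nr i _)) ?mem_head // cats0 orbF.
have nst' : {in reps st & v, forall j i, ~~ e j i}.
  by move=> j k js kv; apply: nst; rewrite ?in_cons ?kv ?orbT.
have nr' : {in v, forall i, ~~ has (e i) r}.
  by move=> k kv; apply: nr; rewrite in_cons kv orbT.
case: ifP => _; first exact: IH.
by rewrite close_embed ?IH //; apply: push_neq0.
Qed.

Lemma eq_scan_rest f Z st u r r' : {in u, forall i, has (e i) r = has (e i) r'} ->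
  scan e f Z st u r = scan e f Z st u r'.
Proof.
elim: u st => //= i u IH st er.
rewrite !has_cat er ?mem_head // IH // => k ku.
by apply: er; rewrite in_cons ku orbT.
Qed.

Lemma eq_scan f Z Z' st u r : {in u, Z =1 Z'} ->
  scan e f Z st u r = scan e f Z' st u r.
Proof.
elim: u st => //= i u IH st eZ.
rewrite eZ ?mem_head // IH // => k ku.
by apply: eZ; rewrite in_cons ku orbT.
Qed.

Lemma reps_scan f Z st u r : {subset reps (scan e f Z st u r) <= reps st ++ u}.
Proof.
elim: u st => [|i u IH] st k /=; first by rewrite cats0.
have sub_push : {subset reps (push e i (Z i) st) <= i :: reps st}.
  case: st => b [|[[j w] t'] s] //= {}k; rewrite /push; case: ifP => //= _ ks.
  by rewrite inE; apply/orP; right.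
have sub_close st' : {subset reps (close f st') <= reps st'}.
  case: st' => b [|[[j w] t'] s] // {}k.
  by rewrite /close reps_act_stack => ks; rewrite inE; apply/orP; right.
move=> /IH; rewrite !mem_cat !inE => /orP[|->]; rewrite ?orbT //.
suff sub : {subset reps (if has (e i) (u ++ r) then push e i (Z i) st
    else close f (push e i (Z i) st)) <= i :: reps st}.
  by move=> /sub; rewrite inE => /orP[->|->]; rewrite ?orbT.
by case: ifP => _ // {}k /sub_close /sub_push.
Qed.

Definition nc_on (l : seq I) : Prop :=
  forall a b c d, subseq [:: a; b; c; d] l -> e a c -> e b d -> e a b.

Lemma nc_on_sub l l' : subseq l l' -> nc_on l' -> nc_on l.
Proof. by move=> sl nc a b c d /subseq_trans /(_ sl); apply: nc. Qed.

Hypotheses (e_sym : symmetric e) (e_trans : transitive e).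

(** Only the top block can be continued, and non-crossing is what makes this enough. Invariant: the
    open blocks are pairwise different, and each of them has a letter ahead. *)
Lemma scan_closed f Z st l :
    pairwise (fun i j => ~~ e i j) (reps st) ->
    {in reps st, forall j, has (e j) l} -> nc_on (rev (reps st) ++ l) ->
  (scan e f Z st l [::]).2 = [::].
Proof.
elim: l st => [|i l IH] st /=.
  case: st => b [|x s] //= _ /(_ x.1.1); rewrite mem_head => /(_ isT) //.
move=> pst hst nc; rewrite cats0.
have sub_js js : subseq (rev js) (rev (reps st)) ->
    nc_on (rev js ++ l) /\ nc_on (rev (i :: js) ++ l).
  move=> sj; split; apply: nc_on_sub nc.
    by rewrite cat_subseq // subseq_cons.
  by rewrite rev_cons cat_rcons cat_subseq.
case: st => b [|[[j w] t] s] /= in pst hst nc sub_js *; rewrite /push /=.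
  case: ifP => hi; last first.
    apply: IH; rewrite /close reps_act_stack //.
    exact: (sub_js [::] isT).1.
  apply: IH => //=; first by move=> k; rewrite inE => /eqP ->.
rewrite /= in pst; case/andP: pst => /allP pj ps.
have hj := hst j (mem_head _ _).
case: (boolP (e j i)) => eji /=.
  have hs : {in [seq x.1.1 | x <- s], forall k, has (e k) l}.
    move=> k ks; have := hst k; rewrite inE ks orbT => /(_ isT) /=.
    case/orP=> // eki; case/negP: (pj k ks).
    by apply: (e_trans eji); rewrite e_sym.
  have subs : subseq (rev [seq x.1.1 | x <- s]) (rev (reps (b, (j, w, t) :: s))).
    by rewrite /reps /= rev_cons -cats1 prefix_subseq.
  case: ifP => hi.
    apply: IH; rewrite /reps /=; first by rewrite ps andbT; apply/allP.
      move=> k; rewrite inE => /orP[/eqP ->|/hs //].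
      by apply: sub_has hi => x; apply: (e_trans eji).
    exact: (sub_js (j :: _) (subseq_refl _)).1.
  apply: IH; rewrite /close reps_act_stack //.
  exact: (sub_js _ subs).1.
have hjl : has (e j) l by move: hj => /=; rewrite (negPf eji).
(* If [i] belonged to a block [k] below the top block [j], then [k], [j], [i] and a later letter [d]
   of [j] would form a crossing. *)
have nei k : k \in j :: [seq x.1.1 | x <- s] -> ~~ e k i.
  rewrite inE => /orP[/eqP->|ks]; first by rewrite eji.
  apply/negP => eki; case/hasP: hjl => d dl ejd.
  have := pj k ks; rewrite e_sym; case/negP.
  apply: (nc k j i d) => //; rewrite /reps /= rev_cons cat_rcons.
  apply: (@cat_subseq _ [:: k] [:: j; i; d]); first by rewrite sub1seq mem_rev.
  by rewrite /= !eqxx sub1seq.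
have hst' : {in j :: [seq x.1.1 | x <- s], forall k, has (e k) l}.
  by move=> k ks; have := hst k ks => /=; rewrite (negPf (nei k ks)).
case: ifP => hi; apply: IH; rewrite /close ?reps_act_stack /reps /=.
- rewrite ps andbT e_sym nei ?mem_head //=; apply/andP; split; last exact/allP.
  by apply/allP => k ks; rewrite e_sym nei // inE ks orbT.
- by move=> k; rewrite inE => /orP[/eqP ->|/hst'].
- exact: (sub_js (j :: _) (subseq_refl _)).2.
- by rewrite ps andbT; apply/allP.
- exact: hst'.
- exact: (sub_js (j :: _) (subseq_refl _)).1.
Qed.

Lemma scan0_closed f Z l : nc_on l -> (scan e f Z (1, [::]) l [::]).2 = [::].
Proof. by move=> nc; apply: scan_closed. Qed.

Lemma scan_insert f Z st v r :
  nc_on v -> {in reps st & v, forall j i, ~~ e j i} -> {in v, forall i, ~~ has (e i) r} ->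
  scan e f Z st v r = act_stack st (scan_val e f Z v).
Proof.
move=> nc nst nr; rewrite -{1}(act_stack1 st).
have -> : act_stack st 1 = embed (1, [::]) st by rewrite /embed /= -surjective_pairing.
rewrite scan_embed // /scan_val /embed (scan0_closed _ _ nc) /=.
by rewrite -surjective_pairing.
Qed.

Lemma val_initial f Z v w : nc_on v -> {in v, forall i, ~~ has (e i) w} ->
  scan_val e f Z (v ++ w) = scan_val e f Z v * scan_val e f Z w.
Proof.
move=> nc nr; rewrite /scan_val scan_cat cats0 (@scan_insert f Z (1, [::]) v w) //.
set c := scan_val e f Z v.
rewrite (_ : act_stack (1, [::]) c = embed (1, [::]) (c, [::])).
  by rewrite scan_embed // /embed /act_stack.
by rewrite /embed /act_stack /= mulr1 mul1r.
Qed.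

Lemma val_terminal f Z u v : nc_on u -> nc_on v -> {in u, forall i, ~~ has (e i) v} ->
  scan_val e f Z (u ++ v) = scan_val e f Z u * scan_val e f Z v.
Proof. by move=> ncu ncv nr; rewrite val_initial. Qed.

(** If the block of [p] is still open after [p], the value of [v] acts on [p] directly. If it closes
    at [p], that value multiplies the closed block from the right, and right linearity of [f] moves
    it onto [p]. *)
Lemma val_middle f Z u p v w : admissible act f ->
    nc_on v -> p \notin u -> p \notin w ->
    {in rcons u p ++ w & v, forall j i, ~~ e j i} ->
  scan_val e f Z (rcons u p ++ v ++ w)
  = scan_val e f (act_at Z p (scan_val e f Z v)) (rcons u p ++ w).
Proof.
move=> fA nc pu pw nuv; rewrite /scan_val !scan_cat !cats0.
set c := scan_val e f Z v.
rewrite (scan_insert f Z nc); first last.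
- move=> i iv; apply/hasPn => j jw; rewrite e_sym; apply: nuv => //.
  by rewrite mem_cat jw orbT.
- move=> j i /reps_scan /= ju iv.
  by apply: nuv => //; rewrite mem_cat ju.
rewrite -/c; congr (_.1); rewrite -[RHS](@eq_scan f Z); last first.
  by move=> k kw; rewrite /act_at; case: eqP => // kp; rewrite -kp kw in pw.
congr (scan e f Z _ w [::]).
have nv i : i \in rcons u p -> has (e i) v = false.
  by move=> iu; apply/negbTE/hasPn => k kv; apply: nuv => //; rewrite mem_cat iu.
rewrite (@eq_scan_rest _ _ _ _ _ w); last first.
  by move=> i iu; rewrite has_cat nv.
rewrite -cats1 !scan_cat /=.
rewrite -(@eq_scan f Z _ _ u); last first.
  by move=> k ku; rewrite /act_at; case: eqP => // kp; rewrite -kp ku in pu.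
set st := scan e f Z _ u _.
have -> : act_at Z p c p = act (Z p) c by rewrite /act_at eqxx.
have pushE : push e p (act (Z p) c) st = act_stack (push e p (Z p) st) c.
  by case: st => b [|[[j x] t] s] //; rewrite /push; case: ifP.
rewrite pushE; case: ifP => // _.
case: (push _ _ _ _) (@push_neq0 p (Z p) st) => b [//|[[j x] t] s] _.
change (act_stack (act_stack (b, s) (f (rcons x t))) c
  = act_stack (b, s) (f (rcons x (act t c)))).
by rewrite (adm_rcons fA) act_stackM.
Qed.

Lemma val_block f Z l : l <> [::] -> f [::] = 1 ->
  {in l &, forall i j, e i j} -> scan_val e f Z l = f [seq Z i | i <- l].
Proof.
case: l => // i l _ f1 ell.
have scan_block b j w t l' : {in j :: l' &, forall i k, e i k} -> l' <> [::] ->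
    scan e f Z (b, [:: (j, w, t)]) l' [::]
    = (b * f (rcons w t ++ [seq Z i | i <- l']), [::]).
  elim: l' b j w t => // k l' IH b j w t el _; rewrite /= /push.
  rewrite el ?inE ?eqxx ?orbT //= cats0.
  case: l' IH el => [|k' l'] IH el; first by rewrite /close /act_stack /= cats1.
  have -> : has (e k) (k' :: l') by rewrite /= el // ?inE ?eqxx ?orbT.
  rewrite IH ?cat_rcons // => x y xl yl; apply: el.
    by move: xl; rewrite !inE => /or3P[->|->|->]; rewrite ?orbT.
  by move: yl; rewrite !inE => /or3P[->|->|->]; rewrite ?orbT.
rewrite /scan_val /= /push /= cats0; case: l ell => [|k l] ell.
  by rewrite /close /act_stack /= mul1r.
have -> : has (e i) (k :: l) by rewrite /= ell // ?inE ?eqxx ?orbT.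
rewrite scan_block //=.
by rewrite mul1r.
Qed.

(** Three stacks that differ in one coefficient, the third one holding the sum. Every step of the
    scan preserves this relation, which gives additivity of the value through all nestings. *)
Inductive add_stack : stack -> stack -> stack -> Prop :=
| AddBase b1 b2 s : add_stack (b1, s) (b2, s) (b1 + b2, s)
| AddLast b s1 j w t c1 c2 s2 :
    add_stack (b, s1 ++ (j, w, act t c1) :: s2) (b, s1 ++ (j, w, act t c2) :: s2)
      (b, s1 ++ (j, w, act t (c1 + c2)) :: s2)
| AddWord b s1 j w1 x c1 c2 w2 t s2 :
    add_stack (b, s1 ++ (j, w1 ++ act x c1 :: w2, t) :: s2)
      (b, s1 ++ (j, w1 ++ act x c2 :: w2, t) :: s2)
      (b, s1 ++ (j, w1 ++ act x (c1 + c2) :: w2, t) :: s2).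

Lemma add_stack_act st1 st2 st3 c : add_stack st1 st2 st3 ->
  add_stack (act_stack st1 c) (act_stack st2 c) (act_stack st3 c).
Proof.
case=> [b1 b2 [|[[j w] t] s]|b s1 j w t c1 c2 s2|b s1 j w1 x c1 c2 w2 t s2].
- by rewrite /act_stack /= mulrDl; constructor.
- by rewrite /act_stack /=; constructor.
- case: s1 => [|[[k v] t'] s1]; rewrite /act_stack /=.
    by rewrite !actM mulrDl; apply: (AddLast _ [::]).
  by apply: (AddLast _ (_ :: _)).
- case: s1 => [|[[k v] t'] s1]; rewrite /act_stack /=.
    by apply: (AddWord _ [::]).
  by apply: (AddWord _ (_ :: _)).
Qed.

Lemma act_stack_add st c1 c2 :
  add_stack (act_stack st c1) (act_stack st c2) (act_stack st (c1 + c2)).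
Proof.
case: st => b [|[[j w] t] s]; rewrite /act_stack /=.
  by rewrite mulrDr; constructor.
exact: (AddLast _ [::]).
Qed.

Lemma add_stack_push i t st1 st2 st3 : add_stack st1 st2 st3 ->
  add_stack (push e i t st1) (push e i t st2) (push e i t st3).
Proof.
case=> [b1 b2 s|b s1 j w t' c1 c2 s2|b s1 j w1 x c1 c2 w2 t' s2].
- by case: s => [|[[j w] t'] s]; rewrite /push /=; try case: ifP => _; constructor.
- case: s1 => [|[[k v] t1] s1]; rewrite /push /=; case: ifP => _.
  + by rewrite -!cats1; apply: (AddWord _ [::]).
  + exact: (AddLast _ [:: _]).
  + exact: (AddLast _ (_ :: _)).
  + exact: (AddLast _ (_ :: _ :: _)).
- case: s1 => [|[[k v] t1] s1]; rewrite /push /=; case: ifP => _.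
  + by rewrite !rcons_cat !rcons_cons; apply: (AddWord _ [::]).
  + exact: (AddWord _ [:: _]).
  + exact: (AddWord _ (_ :: _)).
  + exact: (AddWord _ (_ :: _ :: _)).
Qed.

Lemma add_stack_close f st1 st2 st3 : admissible act f ->
  add_stack st1 st2 st3 -> add_stack (close f st1) (close f st2) (close f st3).
Proof.
move=> fA; case=> [b1 b2 s|b s1 j w t' c1 c2 s2|b s1 j w1 x c1 c2 w2 t' s2].
- case: s => [|[[j w] t'] s]; rewrite /close /=; first by constructor.
  by apply: add_stack_act; constructor.
- case: s1 => [|[[k v] t1] s1]; rewrite /close /=.
    by rewrite (adm_rcons_add fA); apply: act_stack_add.
  by apply: add_stack_act; constructor.
- case: s1 => [|[[k v] t1] s1]; rewrite /close /=.
    rewrite !rcons_cat !rcons_cons (adm_add fA); exact: act_stack_add.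
  by apply: add_stack_act; constructor.
Qed.

Lemma add_stack_scan f Z st1 st2 st3 l r : admissible act f ->
  add_stack st1 st2 st3 ->
  add_stack (scan e f Z st1 l r) (scan e f Z st2 l r) (scan e f Z st3 l r).
Proof.
move=> fA; elim: l st1 st2 st3 => //= i l IH st1 st2 st3 add.
apply: IH; case: ifP => _; first exact: add_stack_push.
exact/add_stack_close/add_stack_push.
Qed.

Lemma add_stack_base st1 st2 st3 : add_stack st1 st2 st3 -> st1.2 = [::] ->
  st3.1 = st1.1 + st2.1.
Proof. by case=> [b1 b2 s|b [|? ?] j w t c1 c2 s2|b [|? ?] j w1 x c1 c2 w2 t s2] //=. Qed.

Lemma val_act_add f Z u p v c1 c2 : admissible act f -> uniq (rcons u p ++ v) ->
    nc_on (rcons u p ++ v) ->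
  scan_val e f (act_at Z p (c1 + c2)) (rcons u p ++ v)
  = scan_val e f (act_at Z p c1) (rcons u p ++ v) + scan_val e f (act_at Z p c2) (rcons u p ++ v).
Proof.
move=> fA; rewrite cat_rcons cat_uniq => /and3P[_ hu] /andP[pv _] nc.
have pu : p \notin u by apply: contraNN hu => pu; apply/hasP; exists p; rewrite ?mem_head.
pose sc c := scan e f (act_at Z p c) (1, [::]) (u ++ p :: v) [::].
have sc0 c : (sc c).2 = [::] by exact: scan0_closed.
suff: add_stack (sc c1) (sc c2) (sc (c1 + c2)).
  by move=> add; rewrite /scan_val; apply: (add_stack_base add); apply: sc0.
have scE c : sc c = scan e f Z (scan e f (act_at Z p c)
    (scan e f Z (1, [::]) u (p :: v)) [:: p] v) v [::].
  rewrite /sc -cat1s !scan_cat !cats0; rewrite -[RHS](@eq_scan f (act_at Z p c)).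
    rewrite -[in RHS](@eq_scan f (act_at Z p c)) // => i iu.
    by rewrite /act_at; case: eqP => // ip; rewrite -ip iu in pu.
  by move=> i iv; rewrite /act_at; case: eqP => // ip; rewrite -ip iv in pv.
rewrite !scE; apply: add_stack_scan => //.
set st := scan e f Z _ u _; rewrite /=.
have actE c : act_at Z p c p = act (Z p) c by rewrite /act_at eqxx.
rewrite !actE.
have add : add_stack (push e p (act (Z p) c1) st) (push e p (act (Z p) c2) st)
    (push e p (act (Z p) (c1 + c2)) st).
  case: st => b [|[[j w] t] s]; rewrite /push /=; try case: ifP => _;
    exact: (AddLast _ [::]).
by case: ifP => _ //; apply: add_stack_close.
Qed.


End Relation.

Lemma eq_scan_rel (e e' : rel I) f Z st l r :
    {in reps st & l, e =2 e'} -> {in l & l ++ r, e =2 e'} ->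
  scan e f Z st l r = scan e' f Z st l r.
Proof.
elim: l st => //= i l IH st est el.
have -> : push e i (Z i) st = push e' i (Z i) st.
  case: st est => b [|[[j w] t] s] //= /(_ j i); rewrite /push.
  by rewrite !mem_head => ->.
have -> : has (e i) (l ++ r) = has (e' i) (l ++ r).
  apply: eq_in_has => k kl; apply: el; rewrite ?mem_head // in_cons.
  by rewrite kl orbT.
have reps_push : {subset reps (push e' i (Z i) st) <= i :: reps st}.
  case: st {est} => b [|[[j w] t'] s] //= k; rewrite /push; case: ifP => //= _ ks.
  by rewrite inE; apply/orP; right.
have el' : {in i :: reps st & l, e =2 e'}.
  move=> j k; rewrite inE => /orP[/eqP ->|js] kl; last first.
    by apply: est; rewrite // inE kl orbT.
  by apply: el; rewrite ?mem_head // inE mem_cat kl orbT.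
apply: IH; last first.
  by move=> j k jl kl; apply: el; rewrite inE ?jl ?kl orbT.
move=> j k js; apply: el'; apply: reps_push; move: js; case: ifP => // _.
case: (push _ _ _ _) => b [|[[j' w] t'] s] //; rewrite /close reps_act_stack => js.
by rewrite inE; apply/orP; right.
Qed.

Lemma eq_scan_val e e' f Z l : {in l &, e =2 e'} -> scan_val e f Z l = scan_val e' f Z l.
Proof.
by move=> el; rewrite /scan_val (@eq_scan_rel e e') // => i j; rewrite cats0; apply: el.
Qed.

End Scan.

(** * Non-crossing partitions of a line *)

Lemma pairwise_index (T : eqType) (s : seq T) : uniq s ->
  pairwise (fun a b => index a s < index b s)%N s.
Proof.
case: s => // x0 s us; apply/(pairwiseP x0) => i j ilt jlt ij.
by rewrite !index_uniq.
Qed.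

Section Line.
Variables (n : nat) (chi : 'I_n -> side).
Local Notation I := 'I_n.
Local Notation prec := (prec chi).

Lemma mem_s_chi (i : I) : i \in s_chi chi.
Proof.
rewrite /s_chi mem_cat mem_rev mem_filter mem_enum mem_filter mem_enum.
by case: (Defs.is_left (chi i)).
Qed.

Lemma s_chi_uniq : uniq (s_chi chi).
Proof.
rewrite /s_chi cat_uniq rev_uniq; apply/and3P.
split; try by apply: filter_uniq; apply: enum_uniq.
apply/hasPn => i; rewrite mem_rev mem_filter => /andP[/negPf ni _] /=.
by rewrite mem_filter ni.
Qed.

Lemma prec_trans : transitive prec.
Proof. by move=> b a c; apply: ltn_trans. Qed.

Lemma prec_irr a : prec a a = false.
Proof. exact: ltnn. Qed.

Lemma prec_asym a b : prec a b -> prec b a = false.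
Proof. by move=> ab; apply/negP => /(prec_trans ab); rewrite prec_irr. Qed.

Definition same_block (sigma : {set {set I}}) : rel I :=
  fun i j => [exists U in sigma, (i \in U) && (j \in U)].

Lemma same_blockP (sigma : {set {set I}}) (i j : I) :
  reflect (exists2 U, U \in sigma & (i \in U) && (j \in U)) (same_block sigma i j).
Proof. exact: exists_inP. Qed.

Lemma same_sym sigma : symmetric (same_block sigma).
Proof.
by move=> i j; apply/same_blockP/same_blockP => -[U Us /andP[iU jU]];
  exists U; rewrite ?iU ?jU.
Qed.

Lemma trivIset_eq (sigma : {set {set I}}) U V i : trivIset sigma ->
  U \in sigma -> V \in sigma -> i \in U -> i \in V -> U = V.
Proof. by move=> tr Us Vs iU iV; rewrite -(def_pblock tr Us iU) (def_pblock tr Vs iV). Qed.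

Lemma same_trans sigma : trivIset sigma -> transitive (same_block sigma).
Proof.
move=> tr j i k /same_blockP[U Us /andP[iU jU]] /same_blockP[V Vs /andP[jV kV]].
by apply/same_blockP; exists U => //; rewrite iU (trivIset_eq tr Us Vs jU jV).
Qed.

Lemma noncrossingP (sigma : {set {set I}}) :
  reflect (forall U V a b c d, U \in sigma -> V \in sigma ->
      a \in U -> b \in V -> c \in U -> d \in V ->
      prec a b -> prec b c -> prec c d -> U = V)
    (noncrossing chi sigma).
Proof.
apply: (iffP forall_inP) => [nc U V a b c d Us Vs aU bV cU dV ab bc cd|nc U Us].
  apply/eqP/negPn/negP => UV; have /forall_inP/(_ V Vs) := nc U Us.
  rewrite UV /= => /exists_inPn/(_ a aU)/exists_inPn/(_ b bV).
  by move=> /exists_inPn/(_ c cU)/exists_inPn/(_ d dV); rewrite ab bc cd.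
apply/forall_inP => V Vs; apply/implyP => UV.
apply/exists_inP => -[a aU /exists_inP[b bV /exists_inP[c cU /exists_inP[d dV]]]].
case/and3P => ab bc cd; move: UV.
by rewrite (nc U V a b c d) ?eqxx.
Qed.

Lemma nc_on_same sigma l : trivIset sigma -> noncrossing chi sigma ->
  pairwise prec l -> nc_on (same_block sigma) l.
Proof.
move=> tr /noncrossingP nc pl a b c d /subseq_pairwise/(_ pl).
rewrite /= !andbT => /and3P[/and3P[ab ac ad] /andP[bc bd] cd].
move=> /same_blockP[U Us /andP[aU cU]] /same_blockP[V Vs /andP[bV dV]].
have UV := nc U V a b c d Us Vs aU bV cU dV ab bc cd.
by apply/same_blockP; exists U => //; rewrite aU UV.
Qed.

Definition NCP (l : seq I) : {set {set {set I}}} :=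
  [set sigma : {set {set I}} | partition sigma [set i in l] & noncrossing chi sigma].

Lemma NCP_P l sigma : sigma \in NCP l ->
  [/\ cover sigma = [set i in l], trivIset sigma, set0 \notin sigma
    & noncrossing chi sigma].
Proof. by rewrite inE => /andP[/and3P[/eqP ? ? ?] ?]; split. Qed.

Lemma NCP_sub l sigma U i : sigma \in NCP l -> U \in sigma -> i \in U -> i \in l.
Proof.
case/NCP_P => co _ _ _ Us iU; have : i \in cover sigma by apply/bigcupP; exists U.
by rewrite co inE.
Qed.

Lemma NCP_block l sigma i : sigma \in NCP l -> i \in l -> exists2 U, U \in sigma & i \in U.
Proof.
case/NCP_P => co _ _ _ il; have : i \in cover sigma by rewrite co inE.
by case/bigcupP => U Us iU; exists U.
Qed.

Lemma NCP_ne l sigma U : sigma \in NCP l -> U \in sigma -> exists i, i \in U.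
Proof.
case/NCP_P => _ _ s0 _ Us; apply/set0Pn; apply: contraNneq s0 => <-; exact: Us.
Qed.

Lemma same_refl l sigma i : sigma \in NCP l -> i \in l -> same_block sigma i i.
Proof. by move=> s /(NCP_block s)[U Us iU]; apply/same_blockP; exists U; rewrite ?iU. Qed.

Lemma NCP_nil : NCP [::] = [set set0].
Proof.
apply/setP => sigma; rewrite !inE; apply/idP/eqP => [sP|->].
  have sN : sigma \in NCP [::] by rewrite inE.
  apply/setP => U; rewrite inE; apply/negP => Us.
  by have [i iU] := NCP_ne sN Us; have := NCP_sub sN Us iU.
apply/andP; split; last by apply/noncrossingP => U V a b c d; rewrite inE.
apply/and3P; split; rewrite ?inE //.
  by apply/eqP/setP => i; rewrite !inE; apply/negbTE/bigcupP => -[U]; rewrite inE.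
by apply/trivIsetP => U V; rewrite inE.
Qed.

Lemma NCP_one l : l <> [::] -> [set [set i in l]] \in NCP l.
Proof.
move=> l0; rewrite inE; apply/andP; split; last first.
  by apply/noncrossingP => U V a b c d; rewrite !inE => /eqP -> /eqP ->.
apply/and3P; split.
- by rewrite /cover big_set1.
- by apply/trivIsetP => U V; rewrite !inE => /eqP -> /eqP ->; rewrite eqxx.
- rewrite inE eq_sym; apply/set0Pn; case: l l0 => // i l _.
  by exists i; rewrite inE mem_head.
Qed.

Lemma NCP_all_same l sigma : sigma \in NCP l -> l <> [::] ->
  {in l &, forall i j, same_block sigma i j} -> sigma = [set [set i in l]].
Proof.
move=> sN l0 al; have [co tr s0 _] := NCP_P sN.
have blockE U : U \in sigma -> U = [set i in l].
  move=> Us; have [i iU] := NCP_ne sN Us; have il := NCP_sub sN Us iU.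
  apply/setP => j; rewrite inE; apply/idP/idP => [/(NCP_sub sN Us) //|jl].
  have /same_blockP[V Vs /andP[iV jV]] := al i j il jl.
  by rewrite (trivIset_eq tr Us Vs iU iV).
apply/setP => U; rewrite inE; apply/idP/eqP => [/blockE //|->].
case: l l0 {al co} => // i l _ in sN blockE *.
have [V Vs iV] := NCP_block sN (mem_head i l).
by rewrite -(blockE V Vs).
Qed.

Definition closed_in (sigma : {set {set I}}) (v : seq I) : bool :=
  [forall U in sigma, (U \subset [set i in v]) || [disjoint U & [set i in v]]].

Lemma closed_inP l sigma v : sigma \in NCP l -> {subset v <= l} ->
  reflect {in v & l, forall i j, same_block sigma i j -> j \in v} (closed_in sigma v).
Proof.
move=> sN sub; apply: (iffP forall_inP) => [cl i j iv jl|cl U Us].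
  case/same_blockP => U Us /andP[iU jU]; case/orP: (cl U Us) => [/subsetP/(_ j jU)|].
    by rewrite inE.
  by move/disjoint_setI0/setP/(_ i); rewrite !inE iU iv.
apply/orP; have [dis|] := boolP [disjoint U & [set i in v]]; first by right.
rewrite -setI_eq0 => /set0Pn[i]; rewrite !inE => /andP[iU iv]; left.
apply/subsetP => j jU; rewrite inE; apply: (cl i) => //; first exact: (NCP_sub sN Us jU).
by apply/same_blockP; exists U; rewrite ?iU.
Qed.

Lemma NCP_restrict l sigma x : sigma \in NCP l ->
    {subset x <= l} -> closed_in sigma x ->
  sigma ::&: [set i in x] \in NCP x.
Proof.
move=> sN sub cl; have [co tr s0 nc] := NCP_P sN.
rewrite inE; apply/andP; split; last first.
  apply/noncrossingP => U V a b c d; rewrite !inE => /andP[Us _] /andP[Vs _].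
  by move/noncrossingP: nc; apply.
apply/and3P; split.
- apply/eqP/setP => i; rewrite inE; apply/bigcupP/idP => [[U]|ix].
    by rewrite inE => /andP[_ /subsetP Ux] iU; have := Ux i iU; rewrite inE.
  have [U Us iU] := NCP_block sN (sub i ix).
  exists U => //; rewrite inE Us; move/forall_inP: cl => /(_ U Us) /orP[//|].
  by move/disjoint_setI0/setP/(_ i); rewrite !inE iU ix.
- by apply: trivIsetS tr; apply/subsetP => U; rewrite inE => /andP[].
- by rewrite inE (negPf s0).
Qed.


Section Split.
Variables (u v w : seq I) (pl : pairwise prec (u ++ v ++ w)).

Lemma split_prec : [/\ {in u & v, forall a b, prec a b}, {in u & w, forall a b, prec a b},
  {in v & w, forall a b, prec a b}, pairwise prec v & pairwise prec (u ++ w)].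
Proof.
move: pl; rewrite !pairwise_cat allrel_catr.
case/and5P=> /andP[/allrelP uv /allrelP uw] pu /allrelP vw pv pw.
by split=> //; rewrite pu pw !andbT; apply/allrelP.
Qed.

Lemma split_disjoint i : i \in v -> i \in u ++ w -> False.
Proof.
have [uv _ vw _ _] := split_prec; move=> iv; rewrite mem_cat => /orP[iu|iw].
  by have := uv i i iu iv; rewrite prec_irr.
by have := vw i i iv iw; rewrite prec_irr.
Qed.

Lemma split_between i j k : i \in v -> j \in u ++ w -> k \in v ->
  prec i j -> prec j k -> False.
Proof.
have [uv _ vw _ _] := split_prec; move=> iv; rewrite mem_cat => /orP[ju|jw] kv ij jk.
  by have := uv j i ju iv; rewrite (prec_asym ij).
by have := vw k j kv jw; rewrite (prec_asym jk).
Qed.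

Lemma mem_split i : (i \in u ++ v ++ w) = (i \in v) || (i \in u ++ w).
Proof. by rewrite !mem_cat orbCA. Qed.

Lemma closed_in_compl sigma : sigma \in NCP (u ++ v ++ w) ->
  closed_in sigma v -> closed_in sigma (u ++ w).
Proof.
move=> sN cl.
have subv : {subset v <= u ++ v ++ w} by move=> i iv; rewrite mem_split iv.
have subu : {subset u ++ w <= u ++ v ++ w}.
  by move=> i iu; rewrite mem_split iu orbT.
apply/(closed_inP sN subu) => i j iu jl sij.
move: jl; rewrite mem_split => /orP[jv|//].
case: (@split_disjoint i) => //.
by apply: (elimT (closed_inP sN subv) cl j i); rewrite ?subu // same_sym.
Qed.

(** Blocks inside an interval of the line cannot cross blocks outside it, so any two non-crossing
    partitions can be glued. *)
Lemma NCP_union s1 s2 : s1 \in NCP v -> s2 \in NCP (u ++ w) ->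
  s1 :|: s2 \in NCP (u ++ v ++ w).
Proof.
move=> s1N s2N; have [co1 tr1 n1 nc1] := NCP_P s1N; have [co2 tr2 n2 nc2] := NCP_P s2N.
rewrite inE; apply/andP; split; last first.
  apply/noncrossingP => U V a b c d; rewrite !inE.
  case/orP=> Us /orP[Vs|Vs] aU bV cU dV ab bc cd.
  - by move/noncrossingP: nc1 => /(_ U V a b c d); apply.
  - case: (@split_between a b c) => //; first exact: (NCP_sub s1N Us aU).
      exact: (NCP_sub s2N Vs bV).
    exact: (NCP_sub s1N Us cU).
  - case: (@split_between b c d) => //; first exact: (NCP_sub s1N Vs bV).
      exact: (NCP_sub s2N Us cU).
    exact: (NCP_sub s1N Vs dV).
  - by move/noncrossingP: nc2 => /(_ U V a b c d); apply.
apply/and3P; split.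
- apply/eqP; rewrite /cover bigcup_setU -!/(cover _) co1 co2.
  by apply/setP => i; rewrite !inE mem_split.
- apply: trivIsetU => //; rewrite co1 co2 -setI_eq0; apply/eqP/setP => i.
  by rewrite !inE; apply/negP => /andP[iv]; apply: split_disjoint iv.
- by rewrite inE negb_or n1.
Qed.

Lemma same_union_l s1 s2 i j : s1 \in NCP v -> s2 \in NCP (u ++ w) ->
  i \in v -> same_block (s1 :|: s2) i j = same_block s1 i j.
Proof.
move=> s1N s2N iv; apply/same_blockP/same_blockP => -[U]; last first.
  by move=> Us ij; exists U; rewrite // inE Us.
rewrite inE => /orP[] Us ij; first by exists U.
case/andP: ij => /(NCP_sub s2N Us) iu _.
by case: (split_disjoint iv iu).
Qed.

Lemma same_union_r s1 s2 i j : s1 \in NCP v -> s2 \in NCP (u ++ w) ->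
  i \in u ++ w -> same_block (s1 :|: s2) i j = same_block s2 i j.
Proof.
move=> s1N s2N iu; apply/same_blockP/same_blockP => -[U]; last first.
  by move=> Us ij; exists U; rewrite // inE Us orbT.
rewrite inE => /orP[] Us ij; last by exists U.
case/andP: ij => /(NCP_sub s1N Us) iv _.
by case: (split_disjoint iv iu).
Qed.

Lemma closed_in_union s1 s2 : s1 \in NCP v -> s2 \in NCP (u ++ w) ->
  closed_in (s1 :|: s2) v.
Proof.
move=> s1N s2N; apply/(closed_inP (NCP_union s1N s2N)).
  by move=> i iv; rewrite mem_split iv.
move=> i j iv _; rewrite (same_union_l _ s1N s2N) // => /same_blockP[U Us /andP[_ jU]].
exact: (NCP_sub s1N Us jU).
Qed.

Lemma restrict_union_l s1 s2 : s1 \in NCP v -> s2 \in NCP (u ++ w) ->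
  (s1 :|: s2) ::&: [set i in v] = s1.
Proof.
move=> s1N s2N; apply/setP => U; rewrite !inE.
apply/andP/idP => [[/orP[//|Us] /subsetP sub]|Us].
  have [i iU] := NCP_ne s2N Us; have := sub i iU; rewrite inE => iv.
  by case: (split_disjoint iv (NCP_sub s2N Us iU)).
split; first by rewrite Us.
by apply/subsetP => i iU; rewrite inE (NCP_sub s1N Us iU).
Qed.

Lemma restrict_union_r s1 s2 : s1 \in NCP v -> s2 \in NCP (u ++ w) ->
  (s1 :|: s2) ::&: [set i in u ++ w] = s2.
Proof.
move=> s1N s2N; apply/setP => U; rewrite !inE.
apply/andP/idP => [[/orP[Us|//] /subsetP sub]|Us].
  have [i iU] := NCP_ne s1N Us; have := sub i iU; rewrite inE => iu.
  by case: (split_disjoint (NCP_sub s1N Us iU) iu).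
split; first by rewrite Us orbT.
by apply/subsetP => i iU; rewrite inE (NCP_sub s2N Us iU).
Qed.

Lemma restrictK sigma : sigma \in NCP (u ++ v ++ w) -> closed_in sigma v ->
  sigma ::&: [set i in v] :|: sigma ::&: [set i in u ++ w] = sigma.
Proof.
move=> sN cl; apply/setP => U; rewrite !inE -andb_orr.
apply/andP/idP => [[]//|Us]; split=> //.
have /forall_inP/(_ U Us) /orP[->//|dis] := cl.
apply/orP; right; apply/subsetP => i iU; have := NCP_sub sN Us iU.
rewrite mem_split inE => /orP[iv|//].
by move/disjoint_setI0/setP/(_ i): dis; rewrite !inE iU iv.
Qed.

Lemma sum_split (B : nmodType) (F : {set {set I}} -> B) :
  \sum_(sigma in NCP (u ++ v ++ w) | closed_in sigma v) F sigma
  = \sum_(s1 in NCP v) \sum_(s2 in NCP (u ++ w)) F (s1 :|: s2).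
Proof.
rewrite pair_big /=.
rewrite (reindex_onto (fun p : {set {set I}} * {set {set I}} => p.1 :|: p.2)
  (fun sigma => (sigma ::&: [set i in v], sigma ::&: [set i in u ++ w]))) /=.
  apply: eq_bigl => -[s1 s2] /=; apply/idP/idP.
    case/andP => /andP[sN cl] /eqP[e1 e2]; apply/andP; split.
      rewrite -e1; apply: (NCP_restrict sN) => // i iv.
      by rewrite mem_split iv.
    rewrite -e2; apply: (NCP_restrict sN) => // [i iu|].
      by rewrite mem_split iu orbT.
    exact: closed_in_compl.
  case/andP => s1N s2N; rewrite NCP_union // closed_in_union //=.
  by rewrite restrict_union_l // restrict_union_r.
by move=> sigma /andP[sN cl]; rewrite restrictK.
Qed.

End Split.

End Line.

(** * The moment-cumulant recursion *)

Lemma split_prefix (T : Type) (p : pred T) (l : seq T) :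
  exists u v, [/\ l = u ++ v, all p u & if v is x :: _ then ~~ p x else true].
Proof.
elim: l => [|x l [u [v [-> pu pv]]]]; first by exists [::], [::].
have [px|npx] := boolP (p x); last by exists [::], (x :: u ++ v).
by exists (x :: u), v; rewrite /= px.
Qed.

Section MomentCumulant.
Variables (n : nat) (chi : 'I_n -> side).
Variables (B : nzRingType) (T : Type) (act : T -> B -> T).
Hypothesis actM : forall t b b', act (act t b) b' = act t (b * b').
Hypothesis act1 : forall t, act t 1 = t.
Local Notation I := 'I_n.
Local Notation prec := (prec chi).
Local Notation NCP := (NCP chi).
Local Notation pval sigma := (scan_val act (same_block sigma)).

Lemma pairwise_split (u v w : seq I) : pairwise prec (u ++ v ++ w) ->
  [/\ pairwise prec u, pairwise prec v, pairwise prec w & pairwise prec (u ++ w)].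
Proof.
rewrite !pairwise_cat allrel_catr.
by case/and5P=> /andP[uv uw] pu vw pv pw; rewrite pu pv pw uw.
Qed.

Lemma line_uniq (l : seq I) : pairwise prec l -> uniq l.
Proof. by apply: pairwise_uniq => i; apply: prec_irr. Qed.

Section Union.
Variables (u v w : seq I) (pl : pairwise prec (u ++ v ++ w)).
Variables (sigma : {set {set I}}) (sN : sigma \in NCP (u ++ v ++ w)).
Hypothesis cl : closed_in sigma v.

Lemma closed_unrelated i j : i \in v -> j \in u ++ w -> same_block sigma i j = false.
Proof.
have subv : {subset v <= u ++ v ++ w} by move=> k kv; rewrite mem_split kv.
move=> iv ju; have [sij|/negbTE //] := boolP (same_block sigma i j).
have jl : j \in u ++ v ++ w by rewrite mem_split ju orbT.
case: (split_disjoint pl _ ju).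
exact: (elimT (closed_inP sN subv) cl i j iv jl sij).
Qed.

Lemma nc_on_part x : subseq x (u ++ v ++ w) -> nc_on (same_block sigma) x.
Proof.
move=> sx; have [_ tr _ nc] := NCP_P sN.
by apply: nc_on_same (subseq_pairwise sx pl).
Qed.

Lemma nc_on_mid : nc_on (same_block sigma) v.
Proof.
apply: nc_on_part.
by rewrite -[v in subseq v _]cats0 -[v ++ [::]]cat0s !cat_subseq ?sub0seq.
Qed.

Lemma sigma_trans : transitive (same_block sigma).
Proof. by case/NCP_P: sN => _ tr _ _; apply: same_trans. Qed.

End Union.

Lemma pval_initial f Z v w sigma : pairwise prec (v ++ w) ->
    sigma \in NCP (v ++ w) -> closed_in sigma v ->
  pval sigma f Z (v ++ w) = pval sigma f Z v * pval sigma f Z w.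
Proof.
move=> pl sN cl; have tr := @sigma_trans [::] v w _ sN.
apply: val_initial => //; first exact: same_sym.
  exact: (@nc_on_mid [::] v w).
move=> i iv; apply/hasPn => j jw.
by rewrite (@closed_unrelated [::] v w).
Qed.

Lemma pval_terminal f Z u v sigma : pairwise prec (u ++ v) ->
    sigma \in NCP (u ++ v) -> closed_in sigma v ->
  pval sigma f Z (u ++ v) = pval sigma f Z u * pval sigma f Z v.
Proof.
move=> pl sN cl; have {}pl' : pairwise prec (u ++ v ++ [::]) by rewrite cats0.
have sN' : sigma \in NCP (u ++ v ++ [::]) by rewrite cats0.
apply: val_terminal => //; first exact: same_sym.
- exact: sigma_trans sN'.
- by apply: (nc_on_part pl' sN'); apply: prefix_subseq.
- exact: (nc_on_mid pl' sN').
- move=> i iu; apply/hasPn => j jv; rewrite same_sym.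
  by rewrite (closed_unrelated pl' sN') // cats0.
Qed.

Lemma pval_middle f Z u p v w sigma : admissible act f ->
    pairwise prec (rcons u p ++ v ++ w) ->
    sigma \in NCP (rcons u p ++ v ++ w) -> closed_in sigma v ->
  pval sigma f Z (rcons u p ++ v ++ w)
  = pval sigma f (act_at act Z p (pval sigma f Z v)) (rcons u p ++ w).
Proof.
move=> fA pl sN cl; apply: val_middle => //.
- exact: same_sym.
- exact: sigma_trans sN.
- exact: (nc_on_mid pl sN).
- move: (line_uniq pl); rewrite cat_uniq rcons_uniq => /and3P[/andP[]] //.
- have [_ _ _ /line_uniq] := pairwise_split pl.
  rewrite cat_uniq => /and3P[_ /hasPn h _]; apply/negP => /h.
  by rewrite /= mem_rcons mem_head.
- by move=> j i ju iv; rewrite same_sym (closed_unrelated pl sN).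
Qed.

Lemma pval_act_add f Z u p v sigma c1 c2 : admissible act f ->
    pairwise prec (rcons u p ++ v) -> sigma \in NCP (rcons u p ++ v) ->
  pval sigma f (act_at act Z p (c1 + c2)) (rcons u p ++ v)
  = pval sigma f (act_at act Z p c1) (rcons u p ++ v)
    + pval sigma f (act_at act Z p c2) (rcons u p ++ v).
Proof.
move=> fA pl sN; have [_ tr _ nc] := NCP_P sN.
apply: val_act_add => //; first exact: same_sym.
- exact: same_trans.
- exact: line_uniq.
- exact: (nc_on_same tr nc pl).
Qed.

Lemma pval_one f (Z : I -> T) (l : seq I) : l <> [::] -> f [::] = 1 ->
  pval [set [set i in l]] f Z l = f [seq Z i | i <- l].
Proof.
move=> l0 f1; apply: val_block => // i j il jl.
apply: (introT (same_blockP _ _ _)); exists [set k in l]; rewrite !inE //.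
by rewrite il jl.
Qed.

Lemma pval_nil (f : seq T -> B) (Z : I -> T) (sigma : {set {set I}}) :
  pval sigma f Z [::] = 1.
Proof. by []. Qed.

(** The interval is the first gap of the block of the first letter: a block that meets this gap and
    leaves it would cross that block. Without a gap there is one block only. *)
Lemma exists_split l pi : pairwise prec l -> pi \in NCP l -> l <> [::] ->
  pi = [set [set i in l]] \/
  exists u v w, [/\ l = u ++ v ++ w, v <> [::], u ++ w <> [::] & closed_in pi v].
Proof.
case: l => // a l pl piN _; have [co tr s0 nc] := NCP_P piN.
have tran := same_trans tr; have sym := same_sym pi.
have refl := same_refl piN.
have [u [r [le hu hr]]] := split_prefix (same_block pi a) l.
have {}hu i : i \in a :: u -> same_block pi a i.
  by rewrite inE => /orP[/eqP ->|/(allP hu)]; rewrite ?refl ?mem_head.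
case: r => [|k r] in le hr.
  left; apply: (NCP_all_same piN) => // i j il jl.
  rewrite le cats0 in il jl.
  by apply: tran (hu j jl); rewrite sym hu.
right; have [g [r' [re hg hr']]] := split_prefix (predC (same_block pi a)) (k :: r).
have g0 : g <> [::].
  by case: g re {hg} => //= re; rewrite -re /= hr in hr'.
have {}hg i : i \in g -> same_block pi a i = false by move/(allP hg)/negPf.
rewrite {}re in le; rewrite {}le in pl piN refl *.
case: r' => [|q r'] in hr' pl piN refl *.
  rewrite cats0 in pl piN refl *.
  exists [::], (a :: u), g; split=> //.
  have subv : {subset a :: u <= a :: u ++ g}.
    by move=> i; rewrite -cat_cons mem_cat => ->.
  apply/(closed_inP piN subv) => i j iu; rewrite -cat_cons mem_cat => /orP[//|jg].
  by move=> sij; have := tran _ _ _ (hu i iu) sij; rewrite hg.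
exists (a :: u), g, (q :: r'); split=> //.
have subv : {subset g <= a :: u ++ g ++ q :: r'}.
  by move=> i ig; rewrite inE !mem_cat ig !orbT.
apply/(closed_inP piN subv) => i j ig; rewrite -cat_cons mem_split => /orP[//|].
rewrite /= negbK in hr'.
rewrite mem_cat => /orP[ju|ju] sij.
  by have := hg i ig; rewrite (tran _ _ _ (hu j ju)) // sym.
move: ju; rewrite inE => /orP[/eqP jq|jr].
  by have := hg i ig; rewrite (tran _ _ _ hr') // -jq sym.
have := hg i ig; suff -> : same_block pi a i by [].
apply: (nc_on_same tr nc pl (a := a) (b := i) (c := q) (d := j)) => //.
rewrite /= eqxx; apply: subseq_trans (suffix_subseq _ _).
apply: (@cat_subseq _ [:: i] [:: q; j]); first by rewrite sub1seq.
by rewrite /= eqxx sub1seq.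
Qed.

Section FirstBlock.
Variables (K phi : seq T -> B).
Hypotheses (KA : admissible act K) (phiA : admissible act phi).
Hypothesis phiE : forall w, subst act K phi w = phi w.

(** The partitions that are compatible with a state of [psi]; the unread letters are left free. *)
Definition starts_with (w : seq I) (t : I) (g : seq I) (sigma : {set {set I}}) : bool :=
  all (same_block sigma t) w && all (fun i => ~~ same_block sigma t i) g.

Lemma map_act_at (Z : I -> T) p c (l : seq I) : p \notin l ->
  [seq act_at act Z p c i | i <- l] = [seq Z i | i <- l].
Proof.
move=> pl; apply/eq_in_map => i il; rewrite /act_at; case: eqP => // ip.
by rewrite -ip il in pl.
Qed.

Lemma NCP_starts (w : seq I) t sigma : sigma \in NCP (rcons w t) ->
  all (same_block sigma t) w -> sigma = [set [set i in rcons w t]].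
Proof.
move=> sN al; have [_ tr _ _] := NCP_P sN; apply: (NCP_all_same sN).
  by case: w {sN al}.
have rel i : i \in rcons w t -> same_block sigma t i.
  rewrite mem_rcons inE => /orP[/eqP->|/(allP al) //].
  by apply: (same_refl sN); rewrite mem_rcons mem_head.
by move=> i j iw jw; apply: (same_trans tr) (rel j jw); rewrite same_sym rel.
Qed.

Lemma sum_one_block (w : seq I) t (Z : I -> T) :
  \sum_(sigma in NCP (rcons w t) | all (same_block sigma t) w)
    pval sigma K Z (rcons w t) = K (rcons [seq Z i | i <- w] (Z t)).
Proof.
have w0 : rcons w t <> [::] by case: w.
rewrite (big_pred1 [set [set i in rcons w t]]); last first.
  move=> sigma /=; apply/andP/eqP => [[sN al]|->]; first exact: NCP_starts.
  split; first exact: NCP_one.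
  apply/allP => i iw; apply: (introT (same_blockP _ _ _)).
  exists [set k in rcons w t]; rewrite !inE ?eqxx //.
  by rewrite !mem_rcons !inE eqxx iw orbT.
by rewrite pval_one ?(adm_nil KA) // map_rcons.
Qed.

Lemma starts_closed (w : seq I) t g r sigma :
    pairwise prec (rcons w t ++ g ++ r) -> sigma \in NCP (rcons w t ++ g ++ r) ->
    starts_with w t g sigma -> (if r is q :: _ then same_block sigma t q else true) ->
  closed_in sigma g.
Proof.
move=> pl sN /andP[wS /allP gS] tq; have [_ tr _ nc] := NCP_P sN.
have tran := same_trans tr; have sym := same_sym sigma.
have subg : {subset g <= rcons w t ++ g ++ r} by move=> i ig; rewrite mem_split ig.
apply: (introT (closed_inP sN subg)) => i j ig; rewrite mem_split => /orP[//|jl] sij.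
case/negP: (gS i ig).
move: jl; rewrite mem_cat mem_rcons inE -orbA => /or3P[/eqP jt|jw|jr].
- by rewrite -jt sym.
- by apply: tran (allP wS j jw) _; rewrite sym.
- case: r => // q r in tq jr pl sN subg *; move: jr; rewrite inE => /orP[/eqP jq|jr].
    by apply: tran tq _; rewrite -jq sym.
  apply: (nc_on_same tr nc pl (a := t) (b := i) (c := q) (d := j)) => //.
  apply: (@cat_subseq _ [:: t] [:: i; q; j]).
    by rewrite sub1seq mem_rcons mem_head.
  apply: (@cat_subseq _ [:: i] [:: q; j]); first by rewrite sub1seq.
  by rewrite /= eqxx sub1seq.
Qed.

Lemma closed_starts (w : seq I) t g r sigma :
    pairwise prec (rcons w t ++ g ++ r) -> sigma \in NCP (rcons w t ++ g ++ r) ->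
  closed_in sigma g -> starts_with w t g sigma = all (same_block sigma t) w.
Proof.
move=> pl sN cl; rewrite /starts_with; case: all => //=.
apply/allP => i ig; rewrite same_sym (closed_unrelated pl sN cl ig) //.
by rewrite mem_cat mem_rcons mem_head.
Qed.

(** The two branches of [psi] correspond to whether the next letter [q] joins the block of [t]. If
    it does, non-crossing makes the gap [g] a union of blocks; its partitions sum to a value of
    [phi] by induction on the length, and additivity carries this sum onto the letter [t]. *)
Lemma sum_first_block N (w : seq I) t g r (Z : I -> T) :
    (forall l Z', (size l < N)%N -> pairwise prec l ->
       \sum_(sigma in NCP l) pval sigma K Z' l = phi [seq Z' i | i <- l]) ->
    (size (rcons w t ++ g ++ r) <= N)%N ->
    pairwise prec (rcons w t ++ g ++ r) ->
  \sum_(sigma in NCP (rcons w t ++ g ++ r) | starts_with w t g sigma)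
    pval sigma K Z (rcons w t ++ g ++ r)
  = psi act K phi [seq Z i | i <- w] (Z t) [seq Z i | i <- g] [seq Z i | i <- r].
Proof.
move=> IHN; elim: r w t g Z => [|q r IHr] w t g Z sz pl.
  rewrite /psi /=; have szg : (size g < N)%N.
    apply: leq_trans sz; rewrite cats0 size_cat size_rcons.
    by rewrite addSn ltnS leq_addl.
  have [_ pg _ pu] := pairwise_split pl.
  rewrite -IHN // -sum_one_block big_distrl /=.
  transitivity (\sum_(sigma in NCP (rcons w t ++ g ++ [::]) | closed_in sigma g)
     (if all (same_block sigma t) w
      then pval sigma K Z (rcons w t ++ [::]) * pval sigma K Z g else 0)).
    rewrite big_mkcondr [RHS]big_mkcondr; apply: eq_bigr => sigma sN.
    have [cl|ncl] := boolP (closed_in sigma g); last first.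
      by case: ifP => // st; rewrite (starts_closed pl sN st) in ncl.
    rewrite (closed_starts pl sN cl); case: ifP => // _.
    by rewrite !cats0 in pl sN *; rewrite pval_terminal.
  rewrite (sum_split pl) exchange_big big_mkcondr /= cats0.
  apply: eq_bigr => s2 s2N.
  have {}s2N : s2 \in NCP (rcons w t ++ [::]) by rewrite cats0.
  transitivity (\sum_(s1 in NCP g) (if all (same_block s2 t) w
      then pval s2 K Z (rcons w t) * pval s1 K Z g else 0)).
    apply: eq_bigr => s1 s1N.
    have e2 i : i \in rcons w t ++ [::] ->
        same_block (s1 :|: s2) i =1 same_block s2 i.
      by move=> iw j; rewrite (same_union_r pl).
    have tw : t \in rcons w t ++ [::] by rewrite cats0 mem_rcons mem_head.
    rewrite (eq_all (e2 t tw)); case: ifP => // _; congr (_ * _).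
      by apply: eq_scan_val => i j iw _; apply: e2; rewrite cats0.
    by apply: eq_scan_val => i j ig _; rewrite (same_union_l pl).
  case: ifP => _; last by rewrite big1.
  by rewrite big_distrr.
have lE : rcons w t ++ g ++ q :: r = rcons w t ++ rcons g q ++ r.
  by rewrite (cat_rcons q g).
rewrite (bigID (fun sigma => same_block sigma t q)) /= addrC /psi /=.
rewrite -!/(psi act K phi _ _ _ _); congr (_ + _).
  rewrite -map_rcons -IHr -?lE //.
  apply: eq_bigl => sigma; rewrite /starts_with all_rcons.
  by rewrite -!andbA; do 2!congr (_ && _); rewrite andbC.
have [_ pg _ pwr] := pairwise_split pl.
have szg : (size g < N)%N.
  by apply: leq_trans sz; rewrite !size_cat size_rcons addSn ltnS addnA addnAC leq_addl.
have startsE sigma : sigma \in NCP (rcons w t ++ q :: r) ->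
    all (same_block sigma t) w && same_block sigma t q
    = starts_with (rcons w t) q [::] sigma.
  move=> sN; have [_ tr _ _] := NCP_P sN; have tran := same_trans tr.
  rewrite /starts_with andbT all_rcons [same_block _ q t]same_sym andbC.
  have [tq|//] := boolP (same_block sigma t q); apply: eq_all => i.
  by apply/idP/idP; apply: tran; rewrite // same_sym.
pose h (b : B) : B := psi act K phi (rcons [seq Z i | i <- w] (act (Z t) b)) (Z q) [::]
  [seq Z i | i <- r].
have hD : {morph h : x y / x + y} by move=> x y; rewrite /h -!cats1 (psi_add_block _ KA).
have h0 : h 0 = 0 by rewrite /h -cats1 (psi_block0 _ KA).
rewrite -IHN // -/(h _) (big_morph h hD h0).
transitivity (\sum_(sigma in NCP (rcons w t ++ g ++ q :: r) | closed_in sigma g)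
   (if all (same_block sigma t) w && same_block sigma t q
    then pval sigma K (act_at act Z t (pval sigma K Z g)) (rcons w t ++ q :: r)
    else 0)).
  under eq_bigl do rewrite -andbA.
  rewrite big_mkcondr [RHS]big_mkcondr; apply: eq_bigr => sigma sN.
  have [cl|ncl] := boolP (closed_in sigma g); last first.
    by case: ifP => // /andP[st tq]; rewrite (starts_closed pl sN st) in ncl.
  by rewrite (closed_starts pl sN cl) pval_middle.
rewrite (sum_split pl); apply: eq_bigr => s1 s1N.
have tl : t \in rcons w t ++ q :: r by rewrite mem_cat mem_rcons mem_head.
transitivity (\sum_(s2 in NCP (rcons w t ++ q :: r) | starts_with (rcons w t) q [::] s2)
    pval s2 K (act_at act Z t (pval s1 K Z g)) (rcons w t ++ q :: r)).
  rewrite [RHS]big_mkcondr; apply: eq_bigr => s2 s2N; rewrite -startsE //.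
  have e2 i : i \in rcons w t ++ q :: r ->
      same_block (s1 :|: s2) i =1 same_block s2 i.
    by move=> iw j; rewrite (same_union_r pl).
  rewrite (eq_all (e2 t tl)) e2 //; case: ifP => // _.
  rewrite (_ : pval (s1 :|: s2) K Z g = pval s1 K Z g).
    by apply: eq_scan_val => i j iw _; apply: e2.
  by apply: eq_scan_val => i j ig _; rewrite (same_union_l pl).
have := line_uniq pwr; rewrite -cat_rcons cat_uniq rcons_uniq rcons_uniq.
rewrite mem_rcons inE negb_or => /and3P[/and3P[/andP[qt qw] tw _] hr _].
have tr : t \notin r.
  apply/negP => trr; case/hasP: hr; exists t => //.
  by rewrite /= mem_rcons in_cons mem_rcons mem_head orbT.
have := IHr (rcons w t) q [::] (act_at act Z t (pval s1 K Z g)).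
rewrite /= cat_rcons => -> //; last first.
  by apply: leq_trans sz; rewrite !size_cat leq_add2l leq_addl.
rewrite map_rcons !map_act_at // /h /act_at eqxx.
by rewrite (negPf qt).
Qed.

Lemma moment_cumulant l (Z : I -> T) : pairwise prec l ->
  \sum_(sigma in NCP l) pval sigma K Z l = phi [seq Z i | i <- l].
Proof.
have [N] := ubnP (size l); elim: N l Z => // N IH l Z szl pl.
case: l szl pl => [|t r] szl pl.
  by rewrite NCP_nil big_set1 /= (adm_nil phiA).
rewrite -phiE; have /= <- // := @sum_first_block N [::] t [::] r Z.
by apply: eq_bigl => sigma; rewrite /starts_with andbT.
Qed.

Lemma finer_same (sigma pi : {set {set I}}) i j : finer sigma pi ->
  same_block sigma i j -> same_block pi i j.
Proof.
move=> /forall_inP fin /same_blockP[U Us /andP[iU jU]].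
have /exists_inP[V Vp /subsetP UV] := fin U Us.
by apply: (introT (same_blockP _ _ _)); exists V; rewrite ?UV.
Qed.

Lemma finer_restrict (s1 s2 pi : {set {set I}}) l x : s1 \in NCP x ->
    pi \in NCP l -> {subset x <= l} -> closed_in pi x -> {subset s1 <= s2} ->
  finer s2 pi -> finer s1 (pi ::&: [set i in x]).
Proof.
move=> s1N piN sub /forall_inP cl s12 /forall_inP fin.
apply/forall_inP => U Us; have /exists_inP[V Vp UV] := fin U (s12 U Us).
apply/exists_inP; exists V; rewrite // inE Vp.
case/orP: (cl V Vp) => // dis; have [i iU] := NCP_ne s1N Us.
move/disjoint_setI0/setP/(_ i): dis.
by rewrite !inE (subsetP UV) // (NCP_sub s1N Us iU).
Qed.

Section SplitSum.
Variables (u v w : seq I) (pl : pairwise prec (u ++ v ++ w)).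
Variables (pi : {set {set I}}) (piN : pi \in NCP (u ++ v ++ w)).
Hypothesis cl : closed_in pi v.
Let pi1 := pi ::&: [set i in v].
Let pi2 := pi ::&: [set i in u ++ w].

Lemma finer_union s1 s2 : s1 \in NCP v -> s2 \in NCP (u ++ w) ->
  finer (s1 :|: s2) pi = finer s1 pi1 && finer s2 pi2.
Proof.
move=> s1N s2N; apply/idP/andP => [fin|[/forall_inP f1 /forall_inP f2]].
  split.
    apply: (finer_restrict s1N piN _ cl _ fin) => [i iv|U Us].
      by rewrite mem_split iv.
    by rewrite inE Us.
  apply: (finer_restrict s2N piN _ _ _ fin) => [i iv||U Us].
  - by rewrite mem_split iv orbT.
  - exact: (closed_in_compl pl piN).
  - by rewrite inE Us orbT.
apply/forall_inP => U; rewrite inE => /orP[/f1|/f2] /exists_inP[V];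
  rewrite inE => /andP[Vp _] UV; by apply/exists_inP; exists V.
Qed.

Lemma sum_finer_split (M : nmodType) (F : {set {set I}} -> M) :
  \sum_(sigma in NCP (u ++ v ++ w) | finer sigma pi) F sigma
  = \sum_(s1 in NCP v | finer s1 pi1) \sum_(s2 in NCP (u ++ w) | finer s2 pi2)
      F (s1 :|: s2).
Proof.
transitivity (\sum_(sigma in NCP (u ++ v ++ w) | closed_in sigma v)
    if finer sigma pi then F sigma else 0).
  rewrite big_mkcondr [RHS]big_mkcondr; apply: eq_bigr => sigma sN.
  case: ifP => [fin|_]; last by rewrite if_same.
  have subv : {subset v <= u ++ v ++ w} by move=> i iv; rewrite mem_split iv.
  rewrite (introT (closed_inP sN subv)) // => i j iv jl /(finer_same fin).
  exact: (elimT (closed_inP piN subv) cl).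
rewrite (sum_split pl) big_mkcondr; apply: eq_bigr => s1 s1N.
case: ifP => f1; last first.
  by rewrite big1 // => s2 s2N; rewrite finer_union // f1.
rewrite [RHS]big_mkcondr; apply: eq_bigr => s2 s2N.
by rewrite finer_union // f1.
Qed.

End SplitSum.

Lemma pval_union_initial f Z v w s1 s2 : pairwise prec (v ++ w) ->
    s1 \in NCP v -> s2 \in NCP w ->
  pval (s1 :|: s2) f Z (v ++ w) = pval s1 f Z v * pval s2 f Z w.
Proof.
move=> pl s1N s2N; rewrite pval_initial //.
- congr (_ * _); apply: eq_scan_val => i j il _.
    exact: (@same_union_l _ chi [::] v w).
  exact: (@same_union_r _ chi [::] v w).
- exact: (@NCP_union _ _ [::] v w).
- exact: (@closed_in_union _ chi [::] v w).
Qed.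

Lemma pval_union_middle f Z u p v w s1 s2 : admissible act f ->
    pairwise prec (rcons u p ++ v ++ w) ->
    s1 \in NCP v -> s2 \in NCP (rcons u p ++ w) ->
  pval (s1 :|: s2) f Z (rcons u p ++ v ++ w)
  = pval s2 f (act_at act Z p (pval s1 f Z v)) (rcons u p ++ w).
Proof.
move=> fA pl s1N s2N; rewrite pval_middle ?NCP_union //; last first.
  exact: (closed_in_union pl s1N s2N).
rewrite (_ : pval (s1 :|: s2) f Z v = pval s1 f Z v).
  by apply: eq_scan_val => i j iw _; apply: (same_union_r pl).
by apply: eq_scan_val => i j ig _; apply: (same_union_l pl).
Qed.

(** Both sides split in the same way along an interval that is a union of blocks of [pi]. This
    reduces the claim to a single block, where it is [moment_cumulant]. *)
Lemma sum_finer l pi (Z : I -> T) : pairwise prec l -> pi \in NCP l ->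
  \sum_(sigma in NCP l | finer sigma pi) pval sigma K Z l = pval pi phi Z l.
Proof.
have [N] := ubnP (size l); elim: N l pi Z => // N IH l pi Z szl pl piN.
have [l0|l0] := eqVneq l [::].
  rewrite {}l0 NCP_nil in piN *; rewrite big_mkcondr big_set1 pval_nil.
  by rewrite /finer (_ : [forall _ in _, _]) //; apply/forall_inP => U; rewrite inE.
have {}l0 : l <> [::] by apply/eqP.
have [pi1|[u [v [w [le v0 uw0 cl]]]]] := exists_split pl piN l0.
  rewrite pi1 pval_one ?(adm_nil phiA) // -moment_cumulant //.
  rewrite big_mkcondr; apply: eq_bigr => sigma sN.
  rewrite ifT //; apply/forall_inP => U Us; apply/exists_inP.
  exists [set i in l]; rewrite ?inE //; apply/subsetP => i iU.
  by rewrite inE (NCP_sub sN Us iU).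
rewrite {l l0}le in szl pl piN *; rewrite (sum_finer_split pl piN cl).
have [_ pv _ puw] := pairwise_split pl.
have piE := restrictK piN cl; have clc := closed_in_compl pl piN cl.
have pi1N := @NCP_restrict _ chi _ pi v piN _ cl.
have {}pi1N : pi ::&: [set i in v] \in NCP v.
  by apply: pi1N => i iv; rewrite mem_split iv.
have pi2N : pi ::&: [set i in u ++ w] \in NCP (u ++ w).
  apply: (NCP_restrict piN) => // i iu.
  by rewrite mem_split iu orbT.
set pi1 := pi ::&: _ in piE pi1N *; set pi2 := pi ::&: _ in piE pi2N *.
have szv : (size v < N)%N.
  rewrite -ltnS; apply: leq_trans szl; rewrite ltnS !size_cat addnCA -size_cat.
  by case: (u ++ w) uw0 => // i x _; rewrite /= addnS ltnS leq_addr.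
have szuw : (size (u ++ w) < N)%N.
  rewrite -ltnS; apply: leq_trans szl; rewrite ltnS !size_cat addnCA.
  by case: (v) v0 => // i x _; rewrite /= addSn ltnS leq_addl.
clearbody pi1 pi2; rewrite -piE.
case/lastP: u => [|u p] in pl piN cl puw piE clc pi2N szl szv szuw uw0 *.
  rewrite !cat0s in pl piN puw pi2N szuw *.
  rewrite pval_union_initial // -(IH v) // -(IH w) // big_distrl.
  apply: eq_big => // s1 /andP[s1N _]; rewrite big_distrr.
  by apply: eq_big => // s2 /andP[s2N _]; rewrite pval_union_initial.
rewrite pval_union_middle // -(IH v pi1) //.
pose h (b : B) : B := pval pi2 phi (act_at act Z p b) (rcons u p ++ w).
have hD : {morph h : x y / x + y} by move=> x y; rewrite /h pval_act_add.
have h0 : h 0 = 0.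
  have := hD 0 0; rewrite addr0 => /eqP.
  by rewrite -subr_eq0 opprD addNKr oppr_eq0 => /eqP.
rewrite -/(h _) (big_morph h hD h0).
apply: eq_big => // s1 /andP[s1N _]; rewrite /h -IH //.
by apply: eq_big => // s2 /andP[s2N _]; rewrite pval_union_middle.
Qed.

End FirstBlock.

End MomentCumulant.

(** * Cumulants as values on words *)

Section MoebiusInversion.
Variables (T : finType) (P : {set T}) (le : rel T).
Hypotheses (le_refl : {in P, reflexive le}) (le_tr : {in P & &, transitive le}).
Hypothesis le_anti : {in P &, forall x y, le x y -> le y x -> x = y}.

Let itv x y := [set z in P | [&& le x z, le z y & z != y]].

(** Passing from [y] to a smaller [z] shrinks the interval, so the size of the interval is enough
    fuel. *)
Lemma mobius_rec_stable k k' x y : x \in P -> y \in P ->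
    (#|itv x y| <= k)%N -> (#|itv x y| <= k')%N ->
  mobius_rec P le k x y = mobius_rec P le k' x y.
Proof.
move=> xP; have sum0 m z : #|itv x z| = 0%N ->
    \sum_(z' in P | [&& le x z', le z' z & z' != z]) mobius_rec P le m x z' = 0.
  move=> /eqP; rewrite cards_eq0 => /eqP i0; apply: big1 => z' /andP[z'P z'le].
  by have := in_set0 z'; rewrite -i0 inE z'P z'le.
elim: k k' y => [|k IH] [|k'] y yP //=.
- rewrite leqn0 => /eqP i0 _; case: eqP => // _.
  by rewrite sum0 ?oppr0.
- move=> _; rewrite leqn0 => /eqP i0; case: eqP => // _.
  by rewrite sum0 ?oppr0.
- move=> ik ik'; case: eqP => // _; congr (- _); apply: eq_bigr => z.
  case/and4P => zP xz zy zny.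
  have lt : (#|itv x z| < #|itv x y|)%N.
    apply: proper_card; apply/properP; split.
      apply/subsetP => t; rewrite !inE => /and4P[tP xt tz tnz].
      rewrite tP xt (le_tr zP tP yP tz zy); apply: contraNneq tnz => ty.
      by apply/eqP/le_anti; rewrite // ty.
    by exists z; rewrite !inE ?zP ?xz ?zy ?eqxx ?andbF.
  by apply: IH => //; rewrite -ltnS; apply: leq_trans lt _.
Qed.

Lemma sum_mobius_left x y : x \in P -> y \in P ->
  \sum_(z in P | le x z && le z y) mobius P le x z = (x == y)%:R.
Proof.
move=> xP yP; have mob0 z : mobius P le z z = 1.
  by rewrite /mobius; case: #|T| => [|m] /=; rewrite eqxx.
have [xy|nxy] := eqVneq x y.
  rewrite -xy (big_pred1 x) // => z /=; apply/and3P/eqP => [[zP xz zx]|->].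
    exact: le_anti.
  by rewrite xP le_refl.
have [xy|nlexy] := boolP (le x y); last first.
  rewrite big1 // => z /and3P[zP xz zy]; case/negP: nlexy.
  exact: le_tr xz zy.
rewrite (bigD1 y) /= ?yP ?xy ?le_refl //.
have itvT : (#|itv x y| < #|T|)%N.
  rewrite -cardsT; apply: proper_card; apply/properP; split; first exact: subsetT.
  by exists y; rewrite !inE // eqxx !andbF.
(* One extra unit of fuel, so that one unfolding produces [mobius] itself with its own fuel. *)
rewrite {1}/mobius (@mobius_rec_stable _ #|T|.+1) //=; last first.
- by rewrite ltnW // ltnS ltnW.
- exact: ltnW.
rewrite (negPf nxy) addrC; apply/eqP; rewrite subr_eq0; apply/eqP.
by apply: eq_bigl => z; rewrite !andbA.
Qed.

(** The recursion defining [mobius] makes it a left inverse of the zeta matrix; inversion needs a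
    right inverse, and for square matrices these coincide. *)
Lemma sum_mobius_right x y : x \in P -> y \in P ->
  \sum_(z in P | le x z && le z y) mobius P le z y = (x == y)%:R.
Proof.
move=> xP yP.
pose Z := \matrix_(i < #|P|, j < #|P|) ((le (enum_val i) (enum_val j))%:R : int).
pose M := \matrix_(i < #|P|, j < #|P|)
  (if le (enum_val i) (enum_val j) then mobius P le (enum_val i) (enum_val j) else 0).
have MZ : M *m Z = 1%:M.
  apply/matrixP => i j; rewrite !mxE.
  have := sum_mobius_left (enum_valP i) (enum_valP j).
  rewrite (inj_eq enum_val_inj) => <-; rewrite big_mkcondr.
  apply/esym; rewrite big_enum_val; apply: eq_bigr => k _; rewrite !mxE.
  by case: (le (enum_val i)); case: (le (enum_val k));
    rewrite /= ?mulr1 ?mulr0 ?mul0r.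
have {MZ} /matrixP ZM := mulmx1C MZ.
pose i := enum_rank_in xP x; pose j := enum_rank_in xP y.
have iE : enum_val i = x by apply: enum_rankK_in.
have jE : enum_val j = y by apply: enum_rankK_in.
have := ZM i j; rewrite !mxE -(inj_eq enum_val_inj) iE jE => <-.
rewrite big_mkcondr big_enum_val; apply: eq_bigr => k _.
rewrite !mxE iE jE.
by case: (le x); case: (le (enum_val k)); rewrite /= ?mul1r ?mulr0 ?mul0r.
Qed.

Lemma mobius_inversion (V : zmodType) (F G : T -> V) :
    {in P, forall y, G y = \sum_(x in P | le x y) F x} ->
  {in P, forall y, \sum_(x in P | le x y) G x *~ mobius P le x y = F y}.
Proof.
move=> GE y yP.
transitivity (\sum_(x in P) \sum_(z in P | le x z && le z y)
    F x *~ mobius P le z y).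
  transitivity (\sum_(z in P | le z y) \sum_(x in P | le x z)
      F x *~ mobius P le z y).
    by apply: eq_bigr => z /andP[zP _]; rewrite GE // mulrz_suml.
  rewrite (exchange_big_dep (mem P)) //=; last by move=> z x /andP[_ _] /andP[].
  apply: eq_bigr => x xP; apply: eq_bigl => z.
  by rewrite xP andTb -andbA; congr (_ && _); rewrite andbC.
rewrite (bigD1 y) //= -mulrz_sumr sum_mobius_right // eqxx addrC big1 ?add0r //.
move=> x /andP[xP xy]; rewrite -mulrz_sumr sum_mobius_right //.
rewrite (negPf xy); exact: mulr0z.
Qed.

End MoebiusInversion.

(** * Position of an interval on the line *)

Section Moments.
Variables (n : nat) (chi : 'I_n -> side).
Local Notation I := 'I_n.
Local Notation prec := (prec chi).
Local Notation NCP := (NCP chi).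

Definition line (S : {set I}) : seq I := [seq i <- s_chi chi | i \in S].

Lemma mem_line S i : (i \in line S) = (i \in S).
Proof. by rewrite mem_filter mem_s_chi andbT. Qed.

Lemma line_set S : [set i in line S] = S.
Proof. by apply/setP => i; rewrite inE mem_line. Qed.

Lemma line_pairwise S : pairwise prec (line S).
Proof. exact/pairwise_filter/pairwise_index/s_chi_uniq. Qed.

Lemma line_setT : line setT = s_chi chi.
Proof. by apply/all_filterP/allP => i _; rewrite inE. Qed.

Lemma BNC_NCP : BNC chi = NCP (s_chi chi).
Proof.
apply/setP => sigma; rewrite !inE; congr (partition _ _ && _).
by rewrite -line_setT line_set.
Qed.

Lemma finer_refl : reflexive (@finer n).
Proof. by move=> sigma; apply/forall_inP => U Us; apply/exists_inP; exists U. Qed.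

Lemma finer_trans : transitive (@finer n).
Proof.
move=> b a c /forall_inP ab /forall_inP bc; apply/forall_inP => U Us.
have /exists_inP[V Vb UV] := ab U Us; have /exists_inP[W Wc VW] := bc V Vb.
by apply/exists_inP; exists W => //; apply: subset_trans VW.
Qed.

Lemma finer_anti l : {in NCP l &, forall a b, finer a b -> finer b a -> a = b}.
Proof.
have sub a b : a \in NCP l -> finer a b -> finer b a -> a \subset b.
  move=> aN /forall_inP ab /forall_inP ba; apply/subsetP => U Ua.
  have /exists_inP[V Vb UV] := ab U Ua; have /exists_inP[W Wa VW] := ba V Vb.
  have [i iU] := NCP_ne aN Ua; have [_ tr _ _] := NCP_P aN.
  have UW : U = W.
    by apply: (trivIset_eq tr Ua Wa iU); apply: (subsetP VW); apply: (subsetP UV).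
  suff -> : U = V by [].
  by apply/eqP; rewrite eqEsubset UV UW.
by move=> a b aN bN ab ba; apply/eqP; rewrite eqEsubset !sub.
Qed.

Lemma line_split (S V : {set I}) : V != set0 -> V \subset S -> chi_interval chi S V ->
  exists u w, line S = u ++ line V ++ w /\ line (S :\: V) = u ++ w.
Proof.
move=> V0 VS /forall_inP itv.
have filtV : line V = [seq i <- line S | i \in V].
  rewrite -filter_predI; apply: eq_filter => i /=.
  by have [iV|//] := boolP (i \in V); rewrite (subsetP VS).
have filtW : line (S :\: V) = [seq i <- line S | i \notin V].
  by rewrite -filter_predI; apply: eq_filter => i /=; rewrite inE.
have [u [r [le hu hr]]] := split_prefix (fun i => i \notin V) (line S).
have [v [w [re hv hw]]] := split_prefix (mem V) r.
have v0 : v <> [::].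
  move=> v0; rewrite v0 /= in re.
  case: r => [|x r] in le hr re; last first.
    by case: w re hw => // y w [<- _]; rewrite /= negbK in hr *; rewrite hr.
  case/set0Pn: V0 => i iV; have := subsetP VS i iV; rewrite -mem_line le cats0.
  by move/(allP hu); rewrite iV.
have {}hw : all (fun i => i \notin V) w.
  case: w hw re => // y w /= yV re; rewrite yV; apply/allP => z zw /=.
  apply/negP => zV; case: v v0 re hv => // x v _ re /= /andP[xV _].
  have := line_pairwise S; rewrite le re => /(subseq_pairwise (xs := [:: x; y; z])).
  have -> : subseq [:: x; y; z] (u ++ (x :: v) ++ y :: w).
    apply: subseq_trans (suffix_subseq _ _).
    apply: (@cat_subseq _ [:: x] [:: y; z]); first by rewrite sub1seq mem_head.
    by rewrite /= eqxx sub1seq.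
  rewrite /= !andbT => /(_ isT) /andP[/andP[xy _] yz].
  have yS : y \in S by rewrite -mem_line le re !mem_cat mem_head !orbT.
  have := itv x xV; move=> /forall_inP/(_ z zV)/forall_inP/(_ y yS).
  by rewrite xy yz /= (negPf yV).
have allF x : all (fun i => i \notin V) x ->
    [seq i <- x | i \in V] = [::] /\ [seq i <- x | i \notin V] = x.
  move=> ax; split; last exact/all_filterP.
  by apply/eqP; rewrite -size_eq0 size_filter -leqn0 leqNgt -has_count -all_predC.
have [uF uT] := allF u hu; have [wF wT] := allF w hw.
have vT : [seq i <- v | i \in V] = v by apply/all_filterP.
have vF : [seq i <- v | i \notin V] = [::].
  apply/eqP; rewrite -size_eq0 size_filter -leqn0 leqNgt -has_count -all_predC.
  by apply: sub_all hv => i /= ->.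
have vE : line V = v by rewrite filtV le re !filter_cat uF vT wF cats0.
exists u, w; rewrite vE le re; split=> //.
by rewrite filtW le re !filter_cat uT vF wT.
Qed.

Section Position.
Variables (S V : {set I}) (u w : seq I).
Hypotheses (V0 : V != set0) (lS : line S = u ++ line V ++ w).
Hypothesis lW : line (S :\: V) = u ++ w.

Let pl : pairwise prec (u ++ line V ++ w).
Proof. by rewrite -lS line_pairwise. Qed.

Let memW k : (k \in S :\: V) = (k \in u ++ w).
Proof. by rewrite -lW mem_line. Qed.

Lemma chi_initialE : chi_initial chi S V = (u == [::]).
Proof.
have [uv uw vw _ _] := split_prec pl; have [v vV] := set0Pn _ V0.
have [u0|u0] := eqVneq u [::].
  apply/forall_inP => a aV; apply/forall_inP => k; rewrite memW u0 => kw.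
  by apply: vw; rewrite ?mem_line.
apply/negP => /forall_inP/(_ v vV)/forall_inP ini.
case: u u0 uv memW => // x u' _ uv mW.
have /ini : x \in S :\: V by rewrite mW mem_cat mem_head.
by rewrite (prec_asym (uv x v _ _)) ?mem_head ?mem_line.
Qed.

Lemma chi_terminalE : chi_terminal chi S V = (w == [::]).
Proof.
have [uv uw vw _ _] := split_prec pl; have [v vV] := set0Pn _ V0.
have [w0|w0] := eqVneq w [::].
  apply/forall_inP => a aV; apply/forall_inP => k; rewrite memW w0 cats0 => ku.
  by apply: uv; rewrite ?mem_line.
apply/negP => /forall_inP/(_ v vV)/forall_inP ter.
case: w w0 vw memW => // x w' _ vw mW.
have /ter : x \in S :\: V by rewrite mW mem_cat mem_head orbT.
by rewrite (prec_asym (vw v x _ _)) ?mem_head ?mem_line.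
Qed.

Lemma chi_predE u' p k : u = rcons u' p -> chi_pred chi S V k = (k == p).
Proof.
move=> uE; have [uv uw vw _] := split_prec pl; have [v vV] := set0Pn _ V0.
rewrite pairwise_cat uE pairwise_rcons => /and3P[_ /andP[/allP up _] _].
have beforeP j : j \in S :\: V -> [forall a in V, prec j a] -> j \in u.
  rewrite memW mem_cat => /orP[//|jw] /forall_inP/(_ v vV).
  by rewrite (prec_asym (vw v j _ _)) ?mem_line.
have before j : j \in u -> [forall a in V, prec j a].
  by move=> ju; apply/forall_inP => a aV; apply: uv; rewrite ?mem_line.
have pu : p \in u by rewrite uE mem_rcons mem_head.
apply/and3P/eqP => [[kW kb /forall_inP kmax]|->]; last first.
  split; [by rewrite memW mem_cat pu | exact: before |].
  apply/forall_inP => j jW; apply/implyP => jb; have := beforeP j jW jb.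
  rewrite uE mem_rcons inE => /orP[/eqP ->|/up jp]; first by rewrite prec_irr.
  by rewrite (prec_asym jp).
have := beforeP k kW kb; rewrite uE mem_rcons inE => /orP[/eqP //|/up kp].
have pW : p \in S :\: V by rewrite memW mem_cat pu.
by have := kmax p pW; rewrite before //= kp.
Qed.

End Position.

End Moments.

(** * Recursive moments as values of the scan *)

Section Moments.
Variables (A B : nzRingType) (E : A -> B) (eps : B -> B -> A).
Variables (T : Type) (act : T -> B -> T) (emb : T -> A) (sd : T -> side).
Hypothesis actM : forall t b b', act (act t b) b' = act t (b * b').
Hypothesis act1 : forall t, act t 1 = t.
Hypothesis sd_act : forall t b, sd (act t b) = sd t.
Hypothesis emb_act : forall t b, emb (act t b)
  = if Defs.is_left (sd t) then emb t * Lop eps b else Rop eps b * emb t.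
Variables (phi : seq T -> B) (phiA : admissible act phi).
Variables (n : nat) (chi : 'I_n -> side).
Local Notation I := 'I_n.
Local Notation NCP := (NCP chi).
Local Notation pval sigma := (scan_val act (same_block sigma)).

Hypothesis phi_prod : forall (S : {set I}) (Z : I -> T), (forall i, sd (Z i) = chi i) ->
  E (\prod_(i < n | i \in S) emb (Z i)) = phi [seq Z i | i <- line chi S].

Lemma cover_closed sigma (S V : {set I}) : trivIset sigma ->
  cover (sigma ::&: V) == V -> closed_in (sigma ::&: S) (line chi V).
Proof.
move=> tr /eqP co; apply/forall_inP => U; rewrite inE line_set => /andP[Us _].
apply/orP; have [dis|] := boolP [disjoint U & V]; first by right.
rewrite -setI_eq0 => /set0Pn X; left; case: X => i; rewrite inE => /andP[iU iV].
have : i \in cover (sigma ::&: V) by rewrite co.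
case/bigcupP=> U'; rewrite inE => /andP[Us' sub] iU'.
by rewrite (trivIset_eq tr Us Us' iU iU').
Qed.

Lemma closed_cover l sigma (S : {set I}) v : sigma ::&: S \in NCP l ->
  {subset v <= l} -> closed_in (sigma ::&: S) v ->
  cover (sigma ::&: [set i in v]) == [set i in v].
Proof.
move=> sN sub /forall_inP cl; apply/eqP/setP => i.
apply/bigcupP/idP => [[U]|].
  by rewrite inE => /andP[_ /subsetP Uv] iU; apply: Uv.
rewrite inE => iv; have [U Us iU] := NCP_block sN (sub i iv).
exists U => //; have := Us; rewrite !inE => /andP[-> _].
case/orP: (cl U Us) => // /disjoint_setI0/setP/(_ i).
by rewrite !inE iU iv.
Qed.

Lemma cover_compl sigma (S V : {set I}) : trivIset sigma ->
  cover (sigma ::&: S) == S -> cover (sigma ::&: V) == V ->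
  cover (sigma ::&: (S :\: V)) == S :\: V.
Proof.
move=> tr /eqP coS /eqP coV; apply/eqP/setP => i; apply/bigcupP/idP => [[U]|].
  by rewrite inE => /andP[_ /subsetP Uv] iU; apply: Uv.
rewrite inE => /andP[niV iS]; have : i \in cover (sigma ::&: S) by rewrite coS.
case/bigcupP=> U; rewrite inE => /andP[Us US] iU.
exists U => //; rewrite inE Us; apply/subsetP => j jU; rewrite inE (subsetP US) // andbT.
apply/negP => jV; have : j \in cover (sigma ::&: V) by rewrite coV.
case/bigcupP=> U'; rewrite inE => /andP[Us' /subsetP sub] jU'.
by case/negP: niV; apply: sub; rewrite -(trivIset_eq tr Us Us' jU jU').
Qed.

Lemma same_block_restrict sigma (S : {set I}) i j : cover (sigma ::&: S) == S ->
  trivIset sigma -> i \in S -> same_block (sigma ::&: S) i j = same_block sigma i j.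
Proof.
move=> /eqP co tr iS; apply/same_blockP/same_blockP => -[U].
  by rewrite inE => /andP[Us _] ij; exists U.
move=> Us /andP[iU jU]; exists U; rewrite ?iU // inE Us.
have : i \in cover (sigma ::&: S) by rewrite co.
case/bigcupP=> U'; rewrite inE => /andP[Us' sub] iU'.
by rewrite (trivIset_eq tr Us Us' iU iU').
Qed.

(** Whichever interval is picked, its position on the line selects the matching rule of the scan, so
    the choice does not matter. If nothing splits [S], there is one block by [exists_split], or no
    letter at all. *)
Lemma moment_recE k (S : {set I}) (Z : I -> T) (ZA : I -> A) pi :
    (forall i, sd (Z i) = chi i) -> (forall i, ZA i = emb (Z i)) ->
    pi \in BNC chi -> cover (pi ::&: S) == S -> (#|S| <= k)%N ->
  moment_rec E eps chi pi k S ZA = pval pi phi Z (line chi S).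
Proof.
move=> sdZ ZAE piB; rewrite BNC_NCP in piB; have [co tr s0 nc] := NCP_P piB.
elim: k S Z ZA sdZ ZAE => [|k IH] S Z ZA sdZ ZAE clS szS.
  have S0 : S = set0 by apply/eqP; rewrite -cards_eq0 -leqn0.
  rewrite /=; under eq_bigr do rewrite ZAE; rewrite phi_prod //.
  have -> : line chi S = [::].
    by apply/eqP; rewrite -size_eq0 size_filter -leqn0 leqNgt -has_count S0; 
       apply/hasP => -[i _]; rewrite inE.
  by rewrite (adm_nil phiA).
have sN : pi ::&: S \in NCP (line chi S).
  rewrite -{1}(line_set chi S); apply: (NCP_restrict piB).
    by move=> i _; apply: mem_s_chi.
  have := cover_closed setT tr clS; congr closed_in.
  by apply/setP => U; rewrite inE subsetT andbT.
have pvalS l : {subset l <= S} ->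
    pval pi phi Z l = pval (pi ::&: S) phi Z l.
  by move=> sub; apply: eq_scan_val => i j il _; rewrite same_block_restrict ?sub.
rewrite /=; case: pickP => [V /and4P[V0 VS itv clV]|nosplit].
  have [u [w [lS lW]]] := line_split V0 (proper_sub VS) itv.
  have pl := line_pairwise chi S; have cl := cover_closed S tr clV.
  have szV : (#|V| <= k)%N by rewrite -ltnS; apply: leq_trans (proper_card VS) szS.
  have szW : (#|S :\: V| <= k)%N.
    rewrite -ltnS; apply: leq_trans szS; rewrite -(cardsID V S) -add1n leq_add2r.
    by rewrite card_gt0 (setIidPr (proper_sub VS)).
  have clW := cover_compl tr clS clV.
  have betaE : moment_rec E eps chi pi k V ZA = pval pi phi Z (line chi V).
    exact: IH.
  have subl l : {subset l <= line chi S} -> {subset l <= S}.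
    by move=> sub i /sub; rewrite mem_line.
  rewrite betaE (chi_initialE V0 lS lW) (chi_terminalE V0 lS lW).
  rewrite (pvalS (line chi S)); last by move=> i; rewrite mem_line.
  rewrite (pvalS (line chi V)); last first.
    by move=> i; rewrite mem_line; apply: (subsetP (proper_sub VS)).
  rewrite lS in pl sN *.
  have [u0|u0] := eqVneq u [::].
    rewrite {}u0 /= in lW lS pl sN *; rewrite (@pval_initial _ chi) //.
    rewrite (IH _ Z) // lW pvalS // => i iw; rewrite -(mem_line chi) lS.
    by rewrite mem_cat iw orbT.
  have [w0|w0] := eqVneq w [::].
    rewrite {}w0 !cats0 in lW lS pl sN *; rewrite (@pval_terminal _ chi) //.
    rewrite (IH _ Z) // lW pvalS // => i iu; rewrite -(mem_line chi) lS.
    by rewrite mem_cat iu.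
  case/lastP: u u0 => // u p _ in lW lS pl sN *.
  rewrite (@pval_middle _ chi) // -lW.
  rewrite (IH _ (act_at act Z p (pval (pi ::&: S) phi Z (line chi V)))) //.
  - apply: eq_scan_val => i j; rewrite mem_line inE => /andP[_ iS] _.
    by rewrite same_block_restrict.
  - by move=> i; rewrite /act_at; case: eqP; rewrite ?sd_act.
  - move=> i; rewrite /insert_at (chi_predE V0 lS lW _ erefl) /act_at ZAE.
    by case: eqP => // _; rewrite emb_act sdZ.
under eq_bigr do rewrite ZAE; rewrite phi_prod //.
have [l0|/eqP l0] := eqVneq (line chi S) [::].
  by rewrite l0 (adm_nil phiA).
rewrite pvalS; last by move=> i; rewrite mem_line.
have [piE|[u [v [w [lS v0 uw0 cl]]]]] := exists_split (line_pairwise chi S) sN l0.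
  by rewrite piE pval_one ?(adm_nil phiA).
have := nosplit [set i in v]; case/and4P.
have pl := line_pairwise chi S; rewrite lS in pl.
have subv : {subset v <= line chi S} by move=> i iv; rewrite lS mem_split iv.
have subS i : i \in v -> i \in S by move/subv; rewrite mem_line.
split.
- by case: (v) v0 => // x v' _; apply/set0Pn; exists x; rewrite inE mem_head.
- apply/properP; split; first by apply/subsetP => i; rewrite inE => /subS.
  case E0 : (u ++ w) uw0 => [//|x y] _; have xuw : x \in u ++ w by rewrite E0 mem_head.
  exists x; first by rewrite -(mem_line chi) lS mem_split xuw orbT.
  by rewrite inE; apply/negP => /split_disjoint; apply; first exact: pl.
- apply/forall_inP => a; rewrite inE => av; apply/forall_inP => b; rewrite inE => bv.
  apply/forall_inP => i; rewrite -(mem_line chi) lS mem_split inE => /orP[->|iuw].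
    by rewrite implybT.
  by apply/implyP => /andP[ai ib]; case: (split_between pl av iuw bv ai ib).
- exact: (closed_cover sN subv cl).
Qed.

Variables (K : seq T -> B) (KA : admissible act K).
Hypothesis phiE : forall w, subst act K phi w = phi w.

Lemma kappaE (Z : I -> T) (ZA : I -> A) : (0 < n)%N ->
    (forall i, sd (Z i) = chi i) -> (forall i, ZA i = emb (Z i)) ->
  kappa E eps chi ZA = K [seq Z i | i <- s_chi chi].
Proof.
move=> n0 sdZ ZAE; rewrite /kappa /cumulant.
have pl : pairwise (prec chi) (s_chi chi) by rewrite -(line_setT chi) line_pairwise.
have l0 : s_chi chi <> [::].
  by move=> l0; have := mem_s_chi chi (Ordinal n0); rewrite l0.
have oneE : [set [set: I]] = [set [set i in s_chi chi]].
  by congr [set _]; apply/setP => i; rewrite !inE mem_s_chi.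
have oneN : [set [set: I]] \in BNC chi by rewrite oneE BNC_NCP NCP_one.
transitivity (\sum_(sigma in BNC chi | finer sigma [set [set: I]])
    pval sigma phi Z (s_chi chi) *~ mu_BNC chi sigma [set [set: I]]).
  apply: eq_bigr => sigma /andP[sB _]; rewrite /moment.
  rewrite (@moment_recE _ _ Z) ?line_setT ?cardsT ?card_ord //.
  have [co _ _ _] : [/\ cover sigma = [set i in s_chi chi], trivIset sigma,
      set0 \notin sigma & noncrossing chi sigma] by apply: NCP_P; rewrite -BNC_NCP.
  rewrite (_ : sigma ::&: setT = sigma) ?co.
    by apply/eqP/setP => i; rewrite !inE mem_s_chi.
  by apply/setP => U; rewrite inE subsetT andbT.
rewrite /mu_BNC.
rewrite (@mobius_inversion _ _ _ _ _ _ _ (fun s => pval s K Z (s_chi chi))) //.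
- by rewrite oneE pval_one // (adm_nil KA).
- by move=> s _; apply: finer_refl.
- by move=> a b c _ _ _; apply: finer_trans.
- by rewrite BNC_NCP; apply: finer_anti.
- by move=> pi; rewrite BNC_NCP => piN; rewrite (sum_finer actM act1 KA phiA phiE).
Qed.

End Moments.

(** * Words in X and Y *)

Section Letters.
Variables (F : comNzRingType) (A B : algType F) (E : A -> B) (eps : B -> B -> A).
Hypothesis hE : bb_ncps E eps.
Variables (X Y : A) (hX : left_face eps X) (hY : right_face eps Y).
Local Notation L := (Lop eps).
Local Notation R := (Rop eps).
Local Notation isl := Defs.is_left.

Definition act_letter (t : side * B) (b : B) : side * B := (t.1, t.2 * b).

Definition letter (t : side * B) : A :=
  if isl t.1 then X * L t.2 else R t.2 * Y.

(** Right letters are multiplied in the reverse of the order of [chi], so the coefficient in front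
    of a right letter stands on the right of [Y]. *)
Definition letter2 (x : B * (side * B)) : A :=
  if isl x.2.1 then L x.1 * X * L x.2.2 else R x.2.2 * Y * R x.1.

Definition sides_ordered (w : seq (side * B)) : bool :=
  pairwise (fun s s' : side => isl s' ==> isl s) [seq t.1 | t <- w].

Definition face_prod (w : seq (side * B)) : A :=
  (\prod_(t <- w | isl t.1) letter t) * \prod_(t <- rev w | ~~ isl t.1) letter t.

(** On a word with a left letter behind a right one the product may violate right linearity: for a
    final left letter, [L_b] turns into an [R_b] that is stuck behind the right letters. The value 0
    keeps the functional admissible, and subwords of ordered words are ordered. *)
Definition word_moment (w : seq (side * B)) : B :=
  if sides_ordered w then E (face_prod w) else 0.

Lemma act_letterM t b b' : act_letter (act_letter t b) b' = act_letter t (b * b').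
Proof. by rewrite /act_letter /= mulrA. Qed.

Lemma act_letter1 t : act_letter t 1 = t.
Proof. by case: t => s b; rewrite /act_letter mulr1. Qed.

Lemma L1 : L 1 = 1. Proof. exact: eps_one hE. Qed.
Lemma R1 : R 1 = 1. Proof. exact: eps_one hE. Qed.

Lemma LM b b' : L (b * b') = L b * L b'.
Proof. by rewrite /Lop (eps_mul hE) mulr1. Qed.

Lemma RM b b' : R (b * b') = R b' * R b.
Proof. by rewrite /Rop (eps_mul hE) mulr1. Qed.

Lemma LR_comm b b' : L b * R b' = R b' * L b.
Proof. by rewrite /Lop /Rop !(eps_mul hE) !mulr1 !mul1r. Qed.

Lemma LD b b' : L (b + b') = L b + L b'.
Proof. by have := eps_linl hE 1 1 b b'; rewrite !scale1r. Qed.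

Lemma RD b b' : R (b + b') = R b + R b'.
Proof. by have := eps_linr hE 1 1 b b'; rewrite !scale1r. Qed.

Lemma ED x y : E (x + y) = E x + E y.
Proof. by have := E_lin hE 1 x y; rewrite !scale1r. Qed.

Lemma E_L b z : E (L b * z) = b * E z.
Proof. by rewrite /Lop (E_bimod hE) mulr1. Qed.

Lemma E_R b z : E (R b * z) = E z * b.
Proof. by rewrite /Rop (E_bimod hE) mul1r. Qed.

Lemma E_LR b z : E (z * L b) = E (z * R b).
Proof. exact: E_balanced hE b z. Qed.

Lemma left_letter_comm t b : isl t.1 -> letter t * R b = R b * letter t.
Proof.
by rewrite /letter => ->; rewrite -mulrA LR_comm !mulrA hX.
Qed.

Lemma right_letter_comm t b : ~~ isl t.1 -> letter t * L b = L b * letter t.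
Proof.
by rewrite /letter => /negPf ->; rewrite -mulrA hY !mulrA LR_comm.
Qed.

Lemma left_prod_comm w b :
  (\prod_(t <- w | isl t.1) letter t) * R b = R b * \prod_(t <- w | isl t.1) letter t.
Proof.
elim/big_rec: _ => [|t p lt IH]; first by rewrite mul1r mulr1.
by rewrite -mulrA IH !mulrA left_letter_comm.
Qed.

Lemma right_prod_comm w b :
  (\prod_(t <- w | ~~ isl t.1) letter t) * L b
  = L b * \prod_(t <- w | ~~ isl t.1) letter t.
Proof.
elim/big_rec: _ => [|t p lt IH]; first by rewrite mul1r mulr1.
by rewrite -mulrA IH !mulrA right_letter_comm.
Qed.

Lemma letter_act t b : letter (act_letter t b)
  = if isl t.1 then letter t * L b else R b * letter t.
Proof. by rewrite /letter /=; case: ifP => _; rewrite ?LM ?RM !mulrA. Qed.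

Lemma letter_add t b b' :
  letter (act_letter t (b + b')) = letter (act_letter t b) + letter (act_letter t b').
Proof. by rewrite !letter_act; case: ifP => _; rewrite ?LD ?RD (mulrDl, mulrDr). Qed.

Lemma word_moment_adm : admissible act_letter word_moment.
Proof.
split.
- by rewrite /word_moment /face_prod /= !big_nil mulr1 (E_one hE).
- move=> w t b; rewrite /word_moment /sides_ordered !map_rcons /=.
  case: ifP => ord; last by rewrite mul0r.
  rewrite /face_prod !rev_rcons -!cats1 !big_cat /= !big_cons !big_nil /=.
  have [lt|rt] := boolP (isl t.1); last first.
    rewrite letter_act (negPf rt) !mulr1 !mulrA left_prod_comm.
    by rewrite -!mulrA E_R.
  have -> : \prod_(t <- rev w | ~~ isl t.1) letter t = 1.
    apply: big_hasC; rewrite has_rev -all_predC; move: ord.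
    rewrite pairwise_rcons all_map => /andP[+ _]; apply: sub_all => s /=.
    by rewrite lt negbK.
  (* With no right letter present, [L b] is the last factor; it becomes [R b] under [E], commutes
     with the left letters and leaves on the right. *)
  rewrite letter_act lt !mulr1 mulrA E_LR -mulrA left_letter_comm // mulrA.
  by rewrite left_prod_comm -mulrA E_R.
- move=> w t b b' v; rewrite /word_moment /sides_ordered !map_cat /=.
  case: ifP => ord; last by rewrite addr0.
  rewrite /face_prod !rev_cat !rev_cons -!cats1 !big_cat /= !big_cons !big_nil /=.
  case: ifP => lt /=; rewrite letter_add.
    by rewrite !(mulrDl, mulrDr) ED.
  by rewrite !(mulrDl, mulrDr) ED.
Qed.


Local Notation phi2 := (twist act_letter word_moment).

Lemma letter2_act x b : letter2 (act2 act_letter x b)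
  = if isl x.2.1 then letter2 x * L b else R b * letter2 x.
Proof. by rewrite /letter2 /=; case: ifP => _; rewrite ?LM ?RM !mulrA. Qed.

Lemma shift_left u c : all (fun x => isl x.2.1) u ->
  (\prod_(x <- u) letter2 x) * L c
  = L (head_coef u c) * \prod_(t <- shift_coef act_letter u c) letter t.
Proof.
elim: u => [_|[a [s b]] u IH /= /andP[ls lu]]; first by rewrite !big_nil mul1r mulr1.
rewrite !big_cons -mulrA IH // /letter2 /letter /= ls LM.
by rewrite !mulrA.
Qed.

Lemma shift_right v : all (fun x => ~~ isl x.2.1) v ->
  \prod_(x <- rev v) letter2 x
  = (\prod_(t <- rev (shift_coef act_letter v 1)) letter t) * R (head_coef v 1).
Proof.
elim: v => [_|[a [s b]] v IH /= /andP[/negPf rs rv]].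
  by rewrite !big_nil mul1r R1.
rewrite !rev_cons -!cats1 !big_cat !big_cons !big_nil IH //= /letter2 /letter /= rs RM.
by rewrite !mulr1 !mulrA.
Qed.

Lemma all_shift (P : pred side) v c :
  all (fun t => P t.1) (shift_coef act_letter v c) = all (fun x => P x.2.1) v.
Proof. by elim: v => //= x v ->. Qed.

Lemma sides_orderedE u v : all (fun t => isl t.1) u -> all (fun t => ~~ isl t.1) v ->
  sides_ordered (u ++ v).
Proof.
move=> lu rv; rewrite /sides_ordered map_cat pairwise_cat; apply/and3P; split.
- rewrite /allrel all_map; apply: sub_all lu => t lt /=; rewrite all_map.
  by apply: sub_all rv => s /= /negPf ->.
- elim: u lu => //= t u IH /andP[lt lu]; rewrite IH // andbT all_map.
  by apply: sub_all lu => s _ /=; rewrite lt implybT.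
- elim: v rv => //= t v IH /andP[rt rv]; rewrite IH // andbT all_map.
  by apply: sub_all rv => s /= /negPf ->.
Qed.

(** The coefficient at the change of faces arrives as a final factor [R h]. Under [E] it becomes
    [L h], which commutes with the right letters and is absorbed by the last left letter. *)
Lemma word_moment2E u v : all (fun x => isl x.2.1) u -> all (fun x => ~~ isl x.2.1) v ->
  phi2 (u ++ v) = E ((\prod_(x <- u) letter2 x) * \prod_(x <- rev v) letter2 x).
Proof.
move=> lu rv; set h := head_coef v 1.
have lu' : all (fun t => isl t.1) (shift_coef act_letter u h) by rewrite all_shift.
have rv' : all (fun t => ~~ isl t.1) (shift_coef act_letter v 1).
  by rewrite (all_shift (fun s => ~~ isl s)).
rewrite /twist head_coef_cat shift_coef_cat -/h /word_moment sides_orderedE //.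
rewrite shift_right // -/h mulrA -E_LR -mulrA.
set V := (\prod_(t <- rev _) letter t).
have VE : V = \prod_(t <- rev (shift_coef act_letter v 1) | ~~ isl t.1) letter t.
  by rewrite -big_filter (_ : filter _ _ = rev (shift_coef act_letter v 1)) //;
    apply/all_filterP; rewrite all_rev.
rewrite {1}VE right_prod_comm -VE mulrA shift_left // -mulrA E_L.
congr (_ * E _); rewrite /face_prod rev_cat !big_cat /=.
set U := \prod_(t <- shift_coef act_letter u h) letter t.
have -> : \prod_(t <- shift_coef act_letter u h | isl t.1) letter t = U.
  by rewrite -big_filter; congr bigop; apply/all_filterP.
rewrite -VE.
have -> : \prod_(t <- shift_coef act_letter v 1 | isl t.1) letter t = 1.
  by apply: big_hasC; rewrite -all_predC.
have -> : \prod_(t <- rev (shift_coef act_letter u h) | ~~ isl t.1) letter t = 1.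
  apply: big_hasC; rewrite has_rev -all_predC; apply: sub_all lu' => t /=.
  by rewrite negbK.
by rewrite !mulr1.
Qed.

Lemma phi2_adm : admissible (act2 act_letter) phi2.
Proof. exact: twist_adm act_letterM act_letter1 _ word_moment_adm. Qed.

Local Notation K2 := (twist act_letter (cumul act_letter word_moment)).

Lemma K2_adm : admissible (act2 act_letter) K2.
Proof.
apply: twist_adm; [exact: act_letterM | exact: act_letter1 |].
by apply: cumul_adm; [exact: act_letterM | exact: word_moment_adm].
Qed.

Lemma subst_K2 w : subst (act2 act_letter) K2 phi2 w = phi2 w.
Proof.
rewrite subst_twist; first last.
- exact: word_moment_adm.
- by apply: cumul_adm; [exact: act_letterM | exact: word_moment_adm].
- exact: act_letter1.
- exact: act_letterM.
congr (_ * _); apply: subst_cumul; [exact: act_letterM | exact: act_letter1 |].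
exact: word_moment_adm.
Qed.

Section NM.
Variables (n m : nat).
Local Notation I := 'I_(n + m).

Let eL := [seq i <- enum I | isl (chi_nm i)].
Let eR := [seq i <- enum I | ~~ isl (chi_nm i)].

Lemma val_eL : map val eL = iota 0 n.
Proof.
rewrite -[RHS](@filter_iota_ltn 0 (n + m) n) ?leq_addr // -val_enum_ord filter_map.
by congr map; apply: eq_filter => i; rewrite /chi_nm /= add0n; case: ltnP.
Qed.

Lemma val_eR : map val eR = iota n m.
Proof.
have -> : iota n m = [seq i <- iota 0 (n + m) | ~~ (i < n)%N].
  rewrite iotaD filter_cat add0n [X in X ++ _](_ : _ = [::]).
    by apply/esym/all_filterP/allP => i; rewrite mem_iota -leqNgt => /andP[].
  apply/eqP; rewrite -[_ == _]negbK -has_filter -all_predC.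
  by apply/allP => i; rewrite mem_iota add0n /= => ->.
rewrite -val_enum_ord filter_map.
by congr map; apply: eq_filter => i; rewrite /chi_nm /=; case: ltnP.
Qed.

Lemma enum_nm : enum I = eL ++ eR.
Proof.
apply: (inj_map val_inj); rewrite map_cat val_eL val_eR.
by rewrite val_enum_ord iotaD.
Qed.

Lemma map_s_chi_nm (z : nat -> B * (side * B)) :
  [seq z (val i) | i <- s_chi (@chi_nm n m)]
  = [seq z k | k <- iota 0 n] ++ rev [seq z k | k <- iota n m].
Proof.
by rewrite /s_chi map_cat map_rev -/eL -/eR -val_eL -val_eR -!map_comp.
Qed.

Lemma word_moment_line (S : {set I}) (Z : I -> B * (side * B)) :
    (forall i, (Z i).2.1 = chi_nm i) ->
  E (\prod_(i < n + m | i \in S) letter2 (Z i))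
  = phi2 [seq Z i | i <- line (@chi_nm n m) S].
Proof.
move=> sdZ; rewrite /line /s_chi -/eL -/eR filter_cat filter_rev map_cat map_rev.
rewrite word_moment2E; first last.
- rewrite all_rev all_map; apply/allP => i; rewrite mem_filter => /andP[_].
  by rewrite mem_filter /= sdZ => /andP[].
- rewrite all_map; apply/allP => i; rewrite mem_filter => /andP[_].
  by rewrite mem_filter /= sdZ => /andP[].
rewrite revK !big_map -big_cat -filter_cat -enum_nm; congr (E _).
by rewrite big_filter; congr bigop; rewrite [index_enum _]unlock enumT.
Qed.

Lemma kappa_nm (z : nat -> B * (side * B)) (ZA : I -> A) : (0 < n + m)%N ->
    (forall i : I, (z i).2.1 = chi_nm i) ->
    (forall i : I, ZA i = letter2 (z i)) ->
  kappa E eps (@chi_nm n m) ZA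
  = K2 ([seq z k | k <- iota 0 n] ++ rev [seq z k | k <- iota n m]).
Proof.
move=> n0 sdz ZAE; rewrite -map_s_chi_nm.
apply: (@kappaE _ _ E eps _ (act2 act_letter) letter2 (fun x => x.2.1) _ _ _ _ phi2)
  => //.
- exact: act2M act_letterM.
- exact: act21 act_letter1.
- exact: letter2_act.
- exact: phi2_adm.
- exact: word_moment_line.
- exact: K2_adm.
- exact: subst_K2.
Qed.

End NM.

Variables (b c d : B).
Let x : B * (side * B) := (b, (lft, 1)).
Let xc : B * (side * B) := (b, (lft, c)).
Let y : B * (side * B) := (1, (rgt, d)).
Let yc : B * (side * B) := (c, (rgt, d)).

Lemma map_const_iota (T : Type) (z : nat -> T) t i j :
  (forall k, (i <= k < i + j)%N -> z k = t) -> [seq z k | k <- iota i j] = nseq j t.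
Proof.
elim: j i => //= j IH i zt; rewrite zt ?leqnn ?addnS ?ltnS ?leq_addr // IH // => k.
by case/andP=> ik kj; rewrite zt // (ltnW ik) -addSnnS.
Qed.

Lemma prod_nseq n z : \prod_(t <- nseq n z) letter2 t = letter2 z ^+ n.
Proof. by elim: n => [|n IH]; rewrite ?big_nil // big_cons IH exprS. Qed.

Lemma Cl_termE n : Cl_term E eps X Y b c d n = K2 (rcons (nseq n x) xc).
Proof.
rewrite /Cl_term (@kappa_nm _ _ (fun k => (b, (lft, if k == n then c else 1)))) //.
- rewrite cats0 -addn1 iotaD map_cat -cats1 /= add0n eqxx.
  rewrite (@map_const_iota _ _ x) // => k; rewrite add0n => /ltn_eqF.
  by rewrite /x => ->.
- by move=> i; rewrite /chi_nm /=; case: i => i; rewrite addn0 /= => ->.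
- move=> i; have lt_in : (i < n.+1)%N by case: i => i; rewrite addn0.
  have eqn : (i.+1 == n.+1 + 0)%N = (i == n :> nat).
    by apply/eqP/eqP => [h|->]; [exact: succn_inj (etrans h (addn0 _)) | rewrite addn0].
  by rewrite /C_args /letter2 lt_in eqn /=; case: ifP => // _; rewrite L1 mulr1.
Qed.

(** The entry of highest index, which carries [R_c], is the first right letter in the order of
    [chi]. *)
Lemma Clr_termE n m :
  Clr_term E eps X Y b c d (n, m) = K2 (nseq n x ++ yc :: nseq m y).
Proof.
pose z k := if (k < n)%N then x else (if (k == n + m)%N then c else 1, (rgt, d)).
rewrite /Clr_term /= (@kappa_nm _ _ z) ?addnS //.
- rewrite (@map_const_iota _ z x); last by move=> k; rewrite add0n /z => /andP[_ ->].
  rewrite -addn1 iotaD map_cat rev_cat /= /z ltnNge leq_addr /= eqxx.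
  rewrite (@map_const_iota _ _ y) ?rev_nseq // => k /andP[nk km].
  by rewrite ltnNge nk (ltn_eqF km).
- by move=> i; rewrite /chi_nm /z; case: ifP.
- move=> i; have eqn : (i.+1 == n + m.+1)%N = (i == n + m :> nat)%N.
    by apply/eqP/eqP => [h|->]; [exact: succn_inj (etrans h (addnS _ _)) | rewrite addnS].
  rewrite /C_args /letter2 /z eqn; case: ifP => /= ni.
    case: eqP => [e|_]; last by rewrite L1 mulr1.
    by move: ni; rewrite e ltnNge leq_addr.
  by case: ifP => // _; rewrite R1 mulr1.
Qed.

Lemma letter2_x : letter2 x = L b * X.
Proof. by rewrite /letter2 /= L1 mulr1. Qed.

Lemma letter2_y : letter2 y = R d * Y.
Proof. by rewrite /letter2 /= R1 mulr1. Qed.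

Lemma all_nseq_x n : all (fun t => isl t.2.1) (nseq n x).
Proof. by rewrite all_nseq orbT. Qed.

Lemma all_nseq_y n : all (fun t => ~~ isl t.2.1) (nseq n y).
Proof. by rewrite all_nseq orbT. Qed.

Lemma Ml_termE n : Ml_term E eps X b n = phi2 (nseq n.+1 x).
Proof.
rewrite -[nseq _ _]cats0 word_moment2E ?all_nseq_x // big_nil mulr1.
by rewrite prod_nseq letter2_x.
Qed.

Lemma Mr_termE n : Mr_term E eps Y d n = phi2 (nseq n.+1 y).
Proof.
rewrite -[nseq _ _]cat0s word_moment2E ?all_nseq_y // big_nil mul1r.
by rewrite rev_nseq prod_nseq letter2_y.
Qed.

Lemma M_term0E n : M_term E eps X Y b c d (n, 0%N) = phi2 (nseq n x) * c.
Proof.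
rewrite -[nseq _ _]cats0 word_moment2E ?all_nseq_x // big_nil mulr1.
rewrite /M_term /= expr0 mulr1 prod_nseq letter2_x -E_LR.
have XR : (L b * X) * R c = R c * (L b * X).
  by rewrite -mulrA hX mulrA LR_comm mulrA.
have comm : (L b * X) ^+ n * R c = R c * (L b * X) ^+ n.
  elim: n => [|n IH]; first by rewrite mul1r mulr1.
  by rewrite exprS -mulrA IH mulrA XR -mulrA.
by rewrite E_LR comm E_R.
Qed.

Lemma M_termSE n m :
  M_term E eps X Y b c d (n, m.+1) = phi2 (nseq n x ++ yc :: nseq m y).
Proof.
rewrite word_moment2E ?all_nseq_x //; last by rewrite /= all_nseq_y.
rewrite rev_cons -cats1 big_cat rev_nseq !prod_nseq big_seq1 /=.
rewrite letter2_x letter2_y /M_term /= exprSr /letter2 /=.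
by rewrite !mulrA.
Qed.

End Letters.

(** * Growth of cumulants *)

Section Catalan.
Variable R : realFieldType.

(* [catalan n] is the n-th Catalan number divided by 4^n. *)
Fixpoint catalan_seq (n : nat) : seq R :=
  if n is n'.+1 then
    rcons (catalan_seq n')
      (4^-1 * \sum_(j < n) (catalan_seq n')`_j * (catalan_seq n')`_(n' - j))
  else [:: 1].

Definition catalan (n : nat) : R := (catalan_seq n)`_n.

Lemma size_catalan_seq n : size (catalan_seq n) = n.+1.
Proof. by elim: n => //= n IH; rewrite size_rcons IH. Qed.

Lemma nth_catalan_seq n k : (k <= n)%N -> (catalan_seq n)`_k = catalan k.
Proof.
elim: n => [|n IH]; first by rewrite leqn0 => /eqP ->.
rewrite leq_eqVlt => /orP[/eqP -> //|kn].
by rewrite /= nth_rcons size_catalan_seq kn IH.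
Qed.

Lemma catalanS n : catalan n.+1 = 4^-1 * \sum_(j < n.+1) catalan j * catalan (n - j).
Proof.
rewrite /catalan /= nth_rcons size_catalan_seq ltnn eqxx; congr (_ * _).
by apply: eq_bigr => j _; rewrite !nth_catalan_seq ?leq_subr // -ltnS.
Qed.

Lemma catalan_ge0 n : 0 <= catalan n.
Proof.
have [m] := ubnP n; elim: m n => // m IH [|n] nm; first by rewrite /catalan /= ler01.
rewrite catalanS mulr_ge0 ?invr_ge0 ?ler0n // sumr_ge0 // => j _.
rewrite mulr_ge0 ?IH //; first by apply: leq_trans (ltn_ord j) _.
by apply: leq_ltn_trans (leq_subr _ _) _.
Qed.

Lemma sum_triangle (a : nat -> R) M :
  \sum_(n < M) \sum_(j < n.+1) a j * a (n - j)%N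
  = \sum_(j < M) a j * \sum_(i < M - j) a i.
Proof.
elim: M => [|M IH]; first by rewrite !big_ord0.
rewrite big_ord_recr /= IH [RHS]big_ord_recr /= big_ord_recr /= addrA.
rewrite subnn subSnn big_ord1; congr (_ + _).
rewrite -big_split /=; apply: eq_bigr => j _.
by rewrite subSn ?(ltnW (ltn_ord j)) // big_ord_recr /= mulrDr.
Qed.

(** The Catalan generating function at 1/4 solves [S = 1 + S^2 / 4], whose only root is 2. Partial
    sums stay below the root because a triangle of products is bounded by the full square. *)
Lemma sum_catalan_le2 M : \sum_(n < M) catalan n <= 2.
Proof.
elim: M => [|M IH]; first by rewrite big_ord0.
rewrite big_ord_recl.
under eq_bigr do rewrite lift0 catalanS.
rewrite -big_distrr /= sum_triangle.
set S := \sum_(n < M) catalan n in IH.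
have S0 : 0 <= S by apply: sumr_ge0 => i _; apply: catalan_ge0.
suff : \sum_(j < M) catalan j * \sum_(i < M - j) catalan i <= S * S.
  move=> le; have -> : catalan (ord0 : 'I_M.+1) = 1 by [].
  by have : S * S <= 2 * 2; [apply: ler_pM | lra].
rewrite /S mulr_suml; apply: ler_sum => j _; apply: ler_wpM2l; first exact: catalan_ge0.
rewrite (big_ord_widen M catalan (leq_subr j M)) [leRHS](bigID (fun i : 'I_M => (i < M - j)%N)) /=.
by rewrite lerDl sumr_ge0 // => i _; apply: catalan_ge0.
Qed.

Lemma catalan_le2 n : catalan n <= 2.
Proof.
apply: le_trans (sum_catalan_le2 n.+1); rewrite big_ord_recr /= lerDr.
by rewrite sumr_ge0 // => i _; apply: catalan_ge0.
Qed.

End Catalan.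

Section Bounds.
Variables (R : realFieldType) (B : nzRingType) (nB : B -> R).
Hypotheses (nB0 : nB 0 = 0) (nB_ge0 : forall x, 0 <= nB x).
Hypothesis nB_add : forall x y, nB (x + y) <= nB x + nB y.
Hypotheses (nB_mul : forall x y, nB (x * y) <= nB x * nB y) (nB_opp : forall x, nB (- x) = nB x).

Section Words.
Variables (T : Type) (act : T -> B -> T) (nT : T -> R).
Hypotheses (act1 : forall t, act t 1 = t).
Hypotheses (nT_ge0 : forall t, 0 <= nT t).
Hypothesis nT_act : forall t b, nT (act t b) <= nT t * nB b.

Definition wnorm (w : seq T) : R := \prod_(t <- w) nT t.

(** The empty word is left out because the norm of 1 may exceed 1. *)
Definition growth (f : seq T -> B) (h : R) : Prop :=
  forall w, w <> [::] -> nB (f w) <= h ^+ size w * wnorm w.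

Lemma wnorm_ge0 w : 0 <= wnorm w.
Proof. by apply: prodr_ge0. Qed.

Lemma wnorm_nil : wnorm [::] = 1. Proof. exact: big_nil. Qed.

Lemma wnorm_rcons w t : wnorm (rcons w t) = wnorm w * nT t.
Proof. by rewrite /wnorm -cats1 big_cat big_seq1. Qed.

Lemma wnorm_cons w t : wnorm (t :: w) = nT t * wnorm w.
Proof. by rewrite /wnorm big_cons. Qed.

Lemma growth_le f h h' : 0 <= h -> h <= h' -> growth f h -> growth f h'.
Proof.
move=> h0 hh fb w w0; apply: le_trans (fb w w0) _.
by rewrite ler_wpM2r ?wnorm_ge0 // lerXn2r ?nnegrE // (le_trans h0).
Qed.

Lemma rinv_acc_bound f h u v : 0 <= h -> growth f h -> u <> [::] ->
  nB (rinv_acc f u v) <= h ^+ size u * (2 * h) ^+ size v * (wnorm u * wnorm v).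
Proof.
move=> h0 fb; elim: v u => [|q v IH] u u0 /=.
  by rewrite nB_opp expr0 mulr1 wnorm_nil mulr1; apply: fb.
apply: le_trans (nB_add _ _) _.
have b1 : nB (- f u * rinv_acc f [:: q] v) <=
    (h ^+ size u * wnorm u) * (h * (2 * h) ^+ size v * (nT q * wnorm v)).
  apply: le_trans (nB_mul _ _) _; rewrite nB_opp; apply: ler_pM => //; first exact: fb.
  by have := IH [:: q]; rewrite /= expr1 wnorm_cons wnorm_nil mulr1; apply.
have b2 : nB (rinv_acc f (rcons u q) v) <=
    h ^+ size (rcons u q) * (2 * h) ^+ size v * (wnorm (rcons u q) * wnorm v).
  by apply: IH; case: (u).
rewrite size_rcons wnorm_rcons in b2.
apply: le_trans (lerD b1 b2) _; rewrite wnorm_cons !exprS.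
by rewrite le_eqVlt; apply/orP; left; apply/eqP; ring.
Qed.

Lemma rinv_growth f h : 0 <= h -> growth f h -> growth (rinv f) (2 * h).
Proof.
move=> h0 fb [//|t r] _; apply: le_trans (rinv_acc_bound r h0 fb _) _ => //.
rewrite !wnorm_cons wnorm_nil mulr1 /= expr1 exprS.
rewrite ler_wpM2r ?mulr_ge0 ?wnorm_ge0 // ler_wpM2r ?exprn_ge0 ?mulr_ge0 //.
by rewrite ler_peMl // ler1n.
Qed.

(** An empty gap must cost exactly 1 and not the norm of 1. Hence the bounds concern products with
    [g G] and letters acted on by it, not [g G] alone. *)
Definition gap_bound (g : seq T -> B) (p : nat -> R) : Prop :=
  (forall z G, nB (z * g G) <= nB z * (p (size G) * wnorm G)) /\
  (forall t G, nT (act t (g G)) <= nT t * (p (size G) * wnorm G)).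

(** The total cost of reading [n] more letters when the current gap has length [i]: a gap of length
    [j] costs [p j], a new letter of the block costs [h]. *)
Fixpoint psi_weight (h : R) (p : nat -> R) (i n : nat) : R :=
  if n is n'.+1 then psi_weight h p i.+1 n' + p i * h * psi_weight h p 0 n'
  else p i.

Lemma psi_bound f g h p w t G r : 0 <= h -> growth f h -> gap_bound g p ->
    (forall i, 0 <= p i) ->
  nB (psi act f g w t G r) <= h ^+ (size w).+1 * (wnorm w * nT t * wnorm G * wnorm r)
    * psi_weight h p (size G) (size r).
Proof.
move=> h0 fb [gb1 gb2] p0; have pw0 i n : 0 <= psi_weight h p i n.
  by elim: n i => //= n IH i; rewrite addr_ge0 ?mulr_ge0.
elim: r w t G => [|q r IH] w t G; rewrite /psi /=.
  apply: le_trans (gb1 _ _) _; rewrite wnorm_nil mulr1.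
  have := fb (rcons w t); rewrite size_rcons wnorm_rcons => fbw.
  apply: le_trans (ler_wpM2r _ (fbw _)) _; rewrite ?mulr_ge0 ?wnorm_ge0 //.
    by case: (w).
  by rewrite le_eqVlt; apply/orP; left; apply/eqP; ring.
rewrite -!/(psi act f g _ _ _ _); apply: le_trans (nB_add _ _) _.
have b1 := IH w t (rcons G q); rewrite size_rcons wnorm_rcons in b1.
have b2 := IH (rcons w (act t (g G))) q [::].
rewrite size_rcons wnorm_rcons wnorm_nil mulr1 /= in b2.
have {}b2 : nB (psi act f g (rcons w (act t (g G))) q [::] r) <=
    h ^+ (size w).+2 * (wnorm w * (nT t * (p (size G) * wnorm G)) * nT q * wnorm r)
      * psi_weight h p 0 (size r).
  apply: le_trans b2 _; rewrite ler_wpM2r // ler_wpM2l ?exprn_ge0 //.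
  by do 2!rewrite ler_wpM2r ?wnorm_ge0 //; rewrite ler_wpM2l ?wnorm_ge0.
apply: le_trans (lerD b1 b2) _; rewrite wnorm_cons !exprS.
by rewrite le_eqVlt; apply/orP; left; apply/eqP; ring.
Qed.

Lemma gap_boundI g p : g [::] = 1 -> p 0%N = 1 ->
    (forall w, w <> [::] -> nB (g w) <= p (size w) * wnorm w) ->
  gap_bound g p.
Proof.
move=> g1 p1 gb; split=> [z|t] [|q G].
- by rewrite g1 p1 wnorm_nil !mulr1.
- by apply: le_trans (nB_mul _ _) _; apply: ler_wpM2l => //; apply: gb.
- by rewrite g1 act1 p1 wnorm_nil !mulr1.
- by apply: le_trans (nT_act _ _) _; apply: ler_wpM2l => //; apply: gb.
Qed.

Lemma growth_gap_bound g h : g [::] = 1 -> growth g h -> gap_bound g (GRing.exp h).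
Proof. by move=> g1 gb; apply: gap_boundI. Qed.

Lemma psi_weight_exp h i n : psi_weight h (GRing.exp h) i n = h ^+ i * (2 * h) ^+ n.
Proof.
elim: n i => [|n IH] i /=; first by rewrite mulr1.
by rewrite !IH !exprS expr0; ring.
Qed.

Lemma psi_growth f g h w t G r : 0 <= h -> g [::] = 1 -> growth f h -> growth g h ->
  nB (psi act f g w t G r) <= h ^+ (size w).+1 * (wnorm w * nT t * wnorm G * wnorm r)
    * (h ^+ size G * (2 * h) ^+ size r).
Proof.
move=> h0 g1 fb gb; rewrite -psi_weight_exp; apply: psi_bound => //.
  exact: growth_gap_bound.
by move=> i; rewrite exprn_ge0.
Qed.

Lemma subst_growth f g h : 0 <= h -> g [::] = 1 -> growth f h -> growth g h ->
  growth (subst act f g) (2 * h).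
Proof.
move=> h0 g1 fb gb [//|t r] _; apply: le_trans (psi_growth _ _ _ _ h0 g1 fb gb) _.
rewrite wnorm_cons !wnorm_nil /= expr1 expr0 !mul1r !mulr1.
rewrite mulrAC ler_wpM2r ?mulr_ge0 ?wnorm_ge0 // exprS ler_wpM2r //.
  by rewrite exprn_ge0 ?mulr_ge0.
by rewrite ler_peMl // ler1n.
Qed.

(** As [catalan] is scaled by powers of 4, this is [h ^+ n] times the Catalan number, which counts
    the non-crossing partitions of [n] points. *)
Let weight (h : R) (n : nat) : R := (4 * h) ^+ n * catalan R n.

Let weightS h n : weight h n.+1 = h * \sum_(j < n.+1) weight h (n - j) * weight h j.
Proof.
transitivity (h * ((4 * h) ^+ n * \sum_(j < n.+1) catalan R j * catalan R (n - j))).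
  by rewrite /weight catalanS exprS; field.
congr (_ * _); rewrite big_distrr /=; apply: eq_bigr => j _; rewrite /weight.
rewrite -[X in (4 * h) ^+ X](@subnK j n) ?exprD; last by rewrite -ltnS.
by ring.
Qed.

Lemma psi_weight_catalan h i n :
  psi_weight h (weight h) i n = \sum_(j < n.+1) weight h (i + n - j) * weight h j.
Proof.
elim: n i => [|n IH] i /=; first by rewrite big_ord1 addn0 subn0 /weight mul1r /catalan /= mulr1.
rewrite !IH [RHS]big_ord_recr /= -mulrA addnK weightS add0n.
congr (_ + _); apply: eq_bigr => j _; by rewrite addSnnS.
Qed.

Lemma subst_fix_bound f h w : 0 <= h -> growth f h -> w <> [::] ->
  nB (subst_fix act f w) <= weight h (size w) * wnorm w.
Proof.
move=> h0 fb; set P := subst_fix act f.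
have w0 n : 0 <= weight h n by rewrite mulr_ge0 ?catalan_ge0 ?exprn_ge0 ?mulr_ge0.
have w1 : weight h 0 = 1 by rewrite /weight mul1r.
have [n] := ubnP (size w); elim: n w => // n IH [//|t r] wn _.
rewrite /P subst_fixE.
(* [gap_bound] speaks of gaps of every length, whereas the induction covers the short ones; [P']
   vanishes on the long ones, which do not occur here. *)
pose P' v := if (size v < n)%N then P v else (if v is [::] then 1 else 0).
have -> : subst act f P (t :: r) = subst act f P' (t :: r).
  by apply: eq_subst_size => v vr; rewrite /P' ifT //; apply: leq_trans vr _.
have P'b : gap_bound P' (weight h).
  apply: gap_boundI => [|//|v v0]; first by rewrite /P'; case: ifP.
  rewrite /P'; case: ifP => vn; first exact: IH.
  by case: (v) v0 => // x u _; rewrite nB0 mulr_ge0 ?wnorm_ge0.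
apply: le_trans (psi_bound _ _ _ _ h0 fb P'b w0) _.
rewrite wnorm_cons !wnorm_nil /= expr1 !mul1r !mulr1.
rewrite psi_weight_catalan weightS add0n.
by rewrite le_eqVlt; apply/orP; left; apply/eqP; ring.
Qed.

(** The constant is [2 * 4 * 2 * 2]: the convolution inverse, the Catalan growth of the fixed point,
    the bound 2 on [catalan] absorbed into a power, and the outer substitution. *)
Lemma cumul_growth f h : 0 <= h -> f [::] = 1 -> growth f h -> growth (cumul act f) (32 * h).
Proof.
move=> h0 f1 fb; have h20 : 0 <= 2 * h by rewrite mulr_ge0.
have h160 : 0 <= 16 * h by rewrite mulr_ge0.
have P1 : subst_fix act (rinv f) [::] = 1 by [].
rewrite (_ : 32 * h = 2 * (16 * h)); last by ring.
apply: subst_growth => //.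
  by apply: growth_le fb => //; lra.
move=> w w0; apply: le_trans (subst_fix_bound h20 (rinv_growth h0 fb) w0) _.
rewrite ler_wpM2r ?wnorm_ge0 // /weight.
rewrite (_ : 4 * (2 * h) = 8 * h); last by ring.
rewrite (_ : (16 * h) ^+ size w = 2 ^+ size w * (8 * h) ^+ size w); last first.
  by rewrite -exprMn; congr (_ ^+ _); ring.
rewrite mulrC.
rewrite ler_wpM2r ?exprn_ge0 ?mulr_ge0 //; apply: le_trans (catalan_le2 _ _) _.
case: w w0 => // t r _ /=; rewrite exprS ler_peMr //.
by rewrite exprn_ege1 // ler1n.
Qed.

End Words.

Section Twist.
Variables (T : Type) (act : T -> B -> T) (nT : T -> R).
Hypotheses (act1 : forall t, act t 1 = t) (nT_ge0 : forall t, 0 <= nT t).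
Hypothesis nT_act : forall t b, nT (act t b) <= nT t * nB b.

Definition norm2 (x : B * T) : R := nB x.1 * nT x.2.

Lemma norm2_ge0 x : 0 <= norm2 x.
Proof. exact: mulr_ge0. Qed.

Lemma norm2_act x b : norm2 (act2 act x b) <= norm2 x * nB b.
Proof. by rewrite /norm2 /= -mulrA ler_wpM2l. Qed.

Lemma wnorm_shift w : w <> [::] ->
  nB (head_coef w 1) * wnorm nT (shift_coef act w 1) <= wnorm norm2 w.
Proof.
elim: w => // x [|y w] IH _.
  by rewrite /= !wnorm_cons !wnorm_nil act1 !mulr1.
change (nB x.1 * wnorm nT (act x.2 y.1 :: shift_coef act (y :: w) 1)
  <= wnorm norm2 (x :: y :: w)).
rewrite wnorm_cons [leRHS]wnorm_cons.
have IHy : nB y.1 * wnorm nT (shift_coef act (y :: w) 1) <= wnorm norm2 (y :: w).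
  exact: IH.
set S := wnorm nT _ in IHy *; have S0 : 0 <= S by apply: wnorm_ge0.
rewrite /norm2 -mulrA ler_wpM2l //.
apply: le_trans (ler_wpM2r S0 (nT_act x.2 y.1)) _.
by rewrite -mulrA ler_wpM2l.
Qed.

Lemma size_shift w c : size (shift_coef act w c) = size w.
Proof. by elim: w => //= x w ->. Qed.

Lemma twist_growth f h : 0 <= h -> growth nT f h -> growth norm2 (twist act f) h.
Proof.
move=> h0 fb w w0; apply: le_trans (nB_mul _ _) _.
have sw0 : shift_coef act w 1 <> [::] by case: (w) w0.
apply: le_trans (ler_wpM2l (nB_ge0 _) (fb _ sw0)) _; rewrite size_shift mulrCA.
by rewrite ler_wpM2l ?exprn_ge0 // wnorm_shift.
Qed.

End Twist.
End Bounds.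

(** * Growth of moments *)

Section MomentBound.
Variables (R : realFieldType) (F : comNzRingType) (A B : algType F).
Variables (E : A -> B) (eps : B -> B -> A) (X Y : A).
Variables (nA : A -> R) (nB : B -> R).
Hypotheses (nA_ge0 : forall x, 0 <= nA x) (nA_mul : forall x y, nA (x * y) <= nA x * nA y).
Hypotheses (nB0 : nB 0 = 0) (nB_ge0 : forall x, 0 <= nB x).
Variables (mE mL mR : R).
Hypotheses (mE0 : 0 <= mE) (mL0 : 0 <= mL) (mR0 : 0 <= mR).
Hypotheses (E_le : forall z, nB (E z) <= mE * nA z).
Hypotheses (L_le : forall b, nA (eps b 1) <= mL * nB b).
Hypotheses (R_le : forall b, nA (eps 1 b) <= mR * nB b).

Let c0 := nA X * mL + mR * nA Y.
Let nl (t : side * B) : R := c0 * nB t.2.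

Let c0_ge0 : 0 <= c0.
Proof. by rewrite addr_ge0 ?mulr_ge0. Qed.

Lemma letter_le t : nA (letter eps X Y t) <= nl t.
Proof.
rewrite /letter /nl /c0; case: ifP => _; apply: le_trans (nA_mul _ _) _.
  apply: le_trans (ler_wpM2l (nA_ge0 X) (L_le t.2)) _.
  by rewrite mulrA ler_wpM2r // lerDl mulr_ge0.
apply: le_trans (ler_wpM2r (nA_ge0 Y) (R_le t.2)) _.
by rewrite mulrAC ler_wpM2r // lerDr mulr_ge0.
Qed.

Lemma prod_letter_le (P : pred (side * B)) w :
  nA (\prod_(t <- w | P t) letter eps X Y t) <= nA 1 * \prod_(t <- w | P t) nl t.
Proof.
elim/big_rec2: _ => [|t p q _ pq]; first by rewrite mulr1.
apply: le_trans (nA_mul _ _) _; rewrite mulrCA; apply: ler_pM => //.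
exact: letter_le.
Qed.

Lemma prod_rev_split (T : Type) (P : pred T) (a : T -> R) w :
  \prod_(t <- w | P t) a t * \prod_(t <- rev w | ~~ P t) a t = \prod_(t <- w) a t.
Proof.
elim: w => [|t w IH]; first by rewrite !big_nil mul1r.
rewrite rev_cons -cats1 big_cat !big_cons big_nil -IH /=.
by case: (P t); rewrite /= ?mulr1; ring.
Qed.

Lemma word_moment_growth : exists2 h, 0 <= h &
  growth nB (fun t => nB t.2) (word_moment E eps X Y) h.
Proof.
(* [k] pays for the bound of [E] and for the norm of 1, which starts each of the two products. Being
   at least 1, it is absorbed into [k ^+ size w] for a non-empty word. *)
pose k := 1 + mE * (nA 1 * nA 1).
have k1 : 1 <= k by rewrite lerDl !mulr_ge0.
have k0 : 0 <= k by apply: le_trans k1.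
exists (k * c0); first by rewrite mulr_ge0.
move=> w w0; have rhs0 : 0 <= (k * c0) ^+ size w * wnorm (fun t => nB t.2) w.
  by rewrite mulr_ge0 ?exprn_ge0 ?mulr_ge0 // wnorm_ge0.
rewrite /word_moment; case: ifP => _; last by rewrite nB0.
have nlE : \prod_(t <- w) nl t = c0 ^+ size w * wnorm (fun t => nB t.2) w.
  rewrite /nl /wnorm; elim: w {w0 rhs0} => [|t w IH]; first by rewrite !big_nil mulr1.
  by rewrite !big_cons IH exprS; ring.
have faceb : nA (face_prod eps X Y w) <= (nA 1 * nA 1) * \prod_(t <- w) nl t.
  apply: le_trans (nA_mul _ _) _.
  apply: le_trans (ler_pM (nA_ge0 _) (nA_ge0 _) (prod_letter_le _ _) (prod_letter_le _ _)) _.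
  by rewrite -(prod_rev_split (fun t => Defs.is_left t.1)) mulrACA.
apply: le_trans (E_le _) _; apply: le_trans (ler_wpM2l mE0 faceb) _.
rewrite nlE exprMn !mulrA -[leLHS]mulrA -[leRHS]mulrA ler_wpM2r //.
  by rewrite mulr_ge0 ?exprn_ge0 // wnorm_ge0.
apply: (@le_trans _ _ k); first by rewrite -mulrA lerDr.
case: w w0 {rhs0 nlE faceb} => // t w _; rewrite /= exprS ler_peMr //.
exact: exprn_ege1.
Qed.

End MomentBound.

From mathcomp Require Import finmap.
From mathcomp Require Import complex.
From mathcomp Require Import all_classical all_reals all_analysis.
From mathcomp Require Import summability.
Import numFieldNormedType.Exports.
Local Open Scope ring_scope.

(** * Summable families *)

Section Nrm.
Variables (R : realType) (V : normedModType R[i]).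

(** Norms lie in [R[i]], which is only partially ordered; the estimates are carried out in [R]. *)
Definition nrm (v : V) : R := complex.Re `|v|.

Lemma nrmE v : `|v| = ((nrm v)%:C)%C.
Proof.
by rewrite /nrm; have := normr_ge0 v; case: `|v| => a b; rewrite lecE /= => /andP[/eqP -> _].
Qed.

Lemma nrm_ge0 v : 0 <= nrm v.
Proof. by rewrite -lecR -nrmE normr_ge0. Qed.

Lemma nrm0 : nrm 0 = 0.
Proof. by rewrite /nrm normr0. Qed.

Lemma nrmN v : nrm (- v) = nrm v.
Proof. by rewrite /nrm normrN. Qed.

Lemma nrmD u v : nrm (u + v) <= nrm u + nrm v.
Proof. by have := ler_normD u v; rewrite !nrmE -rmorphD lecR. Qed.

Lemma nrm_eq0 v : nrm v = 0 -> v = 0.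
Proof. by move=> v0; apply/eqP; rewrite -normr_eq0 nrmE v0. Qed.

Lemma nrm_sum (I : Type) (l : seq I) (x : I -> V) :
  nrm (\sum_(i <- l) x i) <= \sum_(i <- l) nrm (x i).
Proof.
elim: l => [|i l IH]; first by rewrite !big_nil nrm0.
by rewrite !big_cons; apply: le_trans (nrmD _ _) _; rewrite lerD2l.
Qed.

End Nrm.

#[local] Existing Instance totally_filter.

Lemma sum_fset_split (I : choiceType) (W : zmodType) (f : I -> W) (J0 J : {fset I}) :
  (J0 `<=` J)%fset ->
  \sum_(i <- J) f i = \sum_(i <- J0) f i + \sum_(i <- [seq i <- J | i \notin J0]) f i.
Proof.
move=> J0J; rewrite big_filter (bigID (mem J0)) /=; congr (_ + _).
rewrite -big_filter; apply: perm_big; apply: uniq_perm => //.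
  by rewrite filter_uniq.
by move=> i; rewrite mem_filter; case: (boolP (i \in J0)) => // /(fsubsetP J0J).
Qed.

Section Sums.
Variables (R : realType) (V : completeNormedModType R[i]).

Definition has_sum (I : choiceType) (x : I -> V) (s : V) : Prop :=
  forall e : R, 0 < e -> exists J0 : {fset I}, forall J : {fset I},
    (J0 `<=` J)%fset -> nrm (s - \sum_(i <- J) x i) < e.

Definition summ (I : choiceType) (x : I -> V) (M : R) : Prop :=
  forall J : {fset I}, \sum_(i <- J) nrm (x i) <= M.

Lemma partial_sumE (I : choiceType) (W : zmodType) (x : I -> W) (J : {fset I}) :
  partial_sum x J = \sum_(i <- J) x i.
Proof. by rewrite /partial_sum (big_seq_fsetE _ _ predT). Qed.

Lemma summ_abs (I : choiceType) (x : I -> V) M : summ x M -> abs_summable x.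
Proof.
move=> sx; exists (M%:C)%C => J; rewrite partial_sumE.
by under eq_bigr do rewrite nrmE; rewrite -rmorph_sum lecR.
Qed.

Lemma has_sum_sum (I : choiceType) (x : I -> V) s : has_sum x s -> sum x = s.
Proof.
move=> hs; apply: cvg_lim => //.
apply/cvgrPdist_lt => e e0.
have eE : e = ((complex.Re e)%:C)%C.
  by move: e0; case: (e) => a b; rewrite ltcE /= => /andP[/eqP -> _].
have re0 : 0 < complex.Re e by rewrite -ltcR -eE.
have [J0 HJ0] := hs _ re0; exists J0 => // J /= J0J.
by rewrite partial_sumE nrmE eE ltcR; apply: HJ0.
Qed.

Lemma summ_has_sum (I : choiceType) (x : I -> V) M : summ x M -> has_sum x (sum x).
Proof.
move=> sx.
pose T := [set t | exists J : {fset I}, t = \sum_(i <- J) nrm (x i)]%classic.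
have Tsup : has_sup T.
  split; first by exists (\sum_(i <- fset0) nrm (x i)), fset0.
  by exists M => t [J ->].
(* A finite set that nearly attains the supremum of the sums of norms leaves little for the
   remaining indices, so the partial sums form a Cauchy net. *)
have tail e : 0 < e -> exists J0 : {fset I}, forall J : {fset I}, (J0 `<=` J)%fset ->
    nrm (\sum_(i <- J0) x i - \sum_(i <- J) x i) < e.
  move=> e0; have [_ [J0 ->] lt] := sup_adherent e0 Tsup; exists J0 => J J0J.
  have le : \sum_(i <- J) nrm (x i) <= sup T by apply: sup_upper_bound => //; exists J.
  have split_sum (W : zmodType) (f : I -> W) := sum_fset_split f J0J.
  rewrite split_sum opprD addNKr nrmN; apply: le_lt_trans (nrm_sum _ _) _.
  by move: le; rewrite split_sum; lra.
have cv : cvg (partial_sum x @ totally)%classic.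
  apply: cauchy_cvg; apply: cauchy_exP => e e0.
  have eE : e = ((complex.Re e)%:C)%C.
    by move: e0; case: (e) => a b; rewrite ltcE /= => /andP[/eqP -> _].
  have re0 : 0 < complex.Re e by rewrite -ltcR -eE.
  have [J0 HJ0] := tail _ re0; exists (\sum_(i <- J0) x i); exists J0 => // J /= J0J.
  by rewrite -ball_normE /= partial_sumE nrmE eE ltcR; apply: HJ0.
move=> e e0; have e20 : 0 < ((e / 2)%:C)%C :> R[i] by rewrite ltcR; lra.
have [J _ HJ] := proj1 (cvgrPdist_lt _ _) cv _ e20.
exists J => J' JJ'; have := HJ J' JJ'.
rewrite /= partial_sumE nrmE ltcR => /lt_trans; apply.
by lra.
Qed.


Lemma summ_le (I : choiceType) (x : I -> V) (a : I -> R) M :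
  (forall i, nrm (x i) <= a i) -> (forall J : {fset I}, \sum_(i <- J) a i <= M) ->
  summ x M.
Proof. by move=> xa aM J; apply: le_trans (aM J); apply: ler_sum. Qed.

Lemma has_sum_unique (I : choiceType) (x : I -> V) s s' :
  has_sum x s -> has_sum x s' -> s = s'.
Proof. by move=> /has_sum_sum <- /has_sum_sum. Qed.

Lemma small_eq (u v : V) : (forall e : R, 0 < e -> nrm (u - v) < e) -> u = v.
Proof.
move=> small; apply/eqP; rewrite -subr_eq0; apply/eqP/nrm_eq0/eqP.
rewrite eq_le nrm_ge0 andbT leNgt; apply/negP => lt.
by have := small _ lt; rewrite ltxx.
Qed.

Lemma has_sum_nrm (I : choiceType) (x : I -> V) s M :
  has_sum x s -> summ x M -> nrm s <= M.
Proof.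
move=> hs sx; rewrite leNgt; apply/negP => lt.
have [J0 HJ0] := hs (nrm s - M) ltac:(lra).
have := HJ0 J0 (fsubset_refl _); have := le_trans (nrm_sum _ _) (sx J0).
have := nrmD (s - \sum_(i <- J0) x i) (\sum_(i <- J0) x i); rewrite subrK.
by lra.
Qed.

Lemma has_sum_eq (I : choiceType) (x y : I -> V) s : x =1 y -> has_sum x s -> has_sum y s.
Proof.
by move=> xy hs e e0; have [J0 HJ0] := hs e e0; exists J0 => J /HJ0;
  under eq_bigr do rewrite xy.
Qed.

Lemma has_sumD (I : choiceType) (x y : I -> V) s t :
  has_sum x s -> has_sum y t -> has_sum (fun i => x i + y i) (s + t).
Proof.
move=> hs ht e e0; have [J1 HJ1] := hs (e / 2) ltac:(lra).
have [J2 HJ2] := ht (e / 2) ltac:(lra).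
exists (J1 `|` J2)%fset => J; rewrite fsubUset => /andP[/HJ1 s1 /HJ2 t2].
rewrite big_split /= opprD addrACA; apply: le_lt_trans (nrmD _ _) _.
by lra.
Qed.

Lemma has_sum_map (I : choiceType) (x : I -> V) (h : V -> V) c s :
    {morph h : u v / u + v} -> 0 <= c ->
  (forall v, nrm (h v) <= c * nrm v) ->
  has_sum x s -> has_sum (fun i => h (x i)) (h s).
Proof.
move=> hD c0 hc hs e e0.
have c1 : 0 < c + 1 by lra.
have [J0 HJ0] := hs (e / (c + 1)) ltac:(exact: divr_gt0); exists J0 => J /HJ0.
have h0 : h 0 = 0.
  have := hD 0 0; rewrite addr0 => /eqP.
  by rewrite -subr_eq0 opprD addNKr oppr_eq0 => /eqP.
rewrite -(big_morph h hD h0) => lt.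
have -> : h s - h (\sum_(i <- J) x i) = h (s - \sum_(i <- J) x i).
  by apply/eqP; rewrite subr_eq -hD subrK.
apply: le_lt_trans (hc _) _; move: lt; rewrite ltr_pdivlMr // => lt.
by have := nrm_ge0 (s - \sum_(i <- J) x i); nra.
Qed.

Lemma fset_bound (J : {fset nat}) : exists N, forall i, i \in J -> (i < N)%N.
Proof.
exists (\max_(i <- J) i).+1 => i iJ; rewrite ltnS.
by rewrite (big_rem i) //= leq_maxl.
Qed.

Definition iota_fset N : {fset nat} := [fset i in iota 0 N]%fset.

Lemma sum_iota_fset (W : zmodType) (f : nat -> W) N :
  \sum_(i <- iota_fset N) f i = \sum_(i < N) f i.
Proof.
rewrite -(big_mkord xpredT) /index_iota subn0; apply: perm_big; apply: uniq_perm.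
- exact: fset_uniq.
- exact: iota_uniq.
- by move=> i; rewrite in_fset.
Qed.

Lemma sub_iota_fset (J : {fset nat}) N : (forall i, i \in J -> (i < N)%N) ->
  (J `<=` iota_fset N)%fset.
Proof. by move=> JN; apply/fsubsetP => i /JN; rewrite in_fset mem_iota. Qed.

Lemma has_sum_series (x : nat -> V) s : has_sum x s -> forall e : R, 0 < e ->
  exists N, forall n, (N <= n)%N -> nrm (s - \sum_(i < n) x i) < e.
Proof.
move=> hs e e0; have [J0 HJ0] := hs e e0; have [N HN] := fset_bound J0.
exists N => n Nn; rewrite -sum_iota_fset; apply/HJ0/sub_iota_fset => i /HN iN.
exact: leq_trans iN Nn.
Qed.

Lemma series_has_sum (x : nat -> V) s M : summ x M ->
    (forall e : R, 0 < e -> exists N, forall n, (N <= n)%N ->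
       nrm (s - \sum_(i < n) x i) < e) ->
  has_sum x s.
Proof.
move=> sx hs; have hsum := summ_has_sum sx; suff -> : s = sum x by [].
apply: small_eq => e e0; have [N1 HN1] := hs (e / 2) ltac:(lra).
have [N2 HN2] := has_sum_series hsum (e := e / 2) ltac:(lra).
have := HN1 _ (leq_maxl N1 N2); have := HN2 _ (leq_maxr N1 N2).
set S := \sum_(i < _) x i => l2 l1.
have -> : s - sum x = (s - S) - (sum x - S) by rewrite opprB addrA subrK.
by apply: le_lt_trans (nrmD _ _) _; rewrite nrmN; lra.
Qed.

Lemma has_sum_shift (x : nat -> V) s M : summ x M ->
  has_sum (fun n => x n.+1) s -> has_sum x (x 0%N + s).
Proof.
move=> sx hs; apply: series_has_sum sx _ => e e0.
have [N HN] := has_sum_series hs e0; exists N.+1 => [[//|n]]; rewrite ltnS => /HN.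
by rewrite big_ord_recl opprD addrACA subrr add0r.
Qed.

(** The tool for summing over the length of a gap and over the letters of a block: [S i] is what is
    left after [i] steps. *)
Lemma telescope_sum (S a : nat -> V) s : (forall i, S i = a i + S i.+1) ->
    (forall e : R, 0 < e -> exists N, forall n, (N <= n)%N -> nrm (S n) < e) ->
  has_sum a s -> S 0%N = s.
Proof.
move=> SE Slim hs.
have Spart N : S 0%N = \sum_(i < N) a i + S N.
  by elim: N => [|N IH]; rewrite ?big_ord0 ?add0r // big_ord_recr /= -addrA -SE.
apply/esym/small_eq => e e0; have [J0 HJ0] := hs (e / 2) ltac:(lra).
have [N1 HN1] := fset_bound J0; have [N2 HN2] := Slim (e / 2) ltac:(lra).
pose N := maxn N1 N2.
have sub : (J0 `<=` iota_fset N)%fset.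
  by apply: sub_iota_fset => i /HN1 iN; apply: leq_trans iN (leq_maxl _ _).
have := HJ0 _ sub; have := HN2 N (leq_maxr _ _); rewrite sum_iota_fset (Spart N) opprD addrA.
by move=> l1 l2; apply: le_lt_trans (nrmD _ _) _; rewrite nrmN; lra.
Qed.

Lemma sum_fset_pair (I J : choiceType) (W : zmodType) (f : I * J -> W)
    (F : {fset I}) (G : {fset J}) :
  \sum_(p <- [fset p in [seq (i, j) | i <- F, j <- G]]%fset) f p
  = \sum_(i <- F) \sum_(j <- G) f (i, j).
Proof.
transitivity (\sum_(p <- [seq (i, j) | i <- F, j <- G]) f p); last exact: big_allpairs.
apply: perm_big; apply: uniq_perm.
- exact: fset_uniq.
- by apply: allpairs_uniq; rewrite ?fset_uniq // => -[i j] [i' j'] _ _ [-> ->].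
- by move=> p; rewrite in_fset.
Qed.

(** Finitely many rows are approximated by one common finite set of columns, which is then enlarged
    by the columns that occur in [P0]. *)
Lemma has_sum_fubini (I J : choiceType) (x : I * J -> V) (y : I -> V) s :
  has_sum x s -> (forall i, has_sum (fun j => x (i, j)) (y i)) -> has_sum y s.
Proof.
move=> hs hy e e0; have [P0 HP0] := hs (e / 2) ltac:(lra).
exists [fset p.1 | p in P0]%fset => F HF.
have rows (l : seq I) (d : R) : 0 < d -> exists G0 : {fset J}, forall G : {fset J},
    (G0 `<=` G)%fset -> nrm (\sum_(i <- l) (\sum_(j <- G) x (i, j) - y i)) < d.
  elim: l d => [|i l IH] d d0; first by exists fset0 => G _; rewrite big_nil nrm0.
  have [G1 HG1] := IH (d / 2) ltac:(lra); have [G2 HG2] := hy i (d / 2) ltac:(lra).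
  exists (G1 `|` G2)%fset => G; rewrite fsubUset => /andP[/HG1 l1 /HG2 l2].
  rewrite big_cons; apply: le_lt_trans (nrmD _ _) _; rewrite -nrmN opprB.
  by lra.
have [G0 HG0] := rows F (e / 2) ltac:(lra).
pose G := (G0 `|` [fset p.2 | p in P0])%fset.
have := HG0 G (fsubsetUl _ _); rewrite sumrB -sum_fset_pair.
set P := [fset p in _]%fset => l1.
have P0P : (P0 `<=` P)%fset.
  apply/fsubsetP => -[i j] ij; rewrite in_fset; apply/allpairsP; exists (i, j); split=> //=.
    by apply: (fsubsetP HF); apply/imfsetP; exists (i, j).
  by rewrite in_fsetU; apply/orP; right; apply/imfsetP; exists (i, j).
have := HP0 P P0P => l2.
have -> : s - \sum_(i <- F) y i
    = (s - \sum_(p <- P) x p) + (\sum_(p <- P) x p - \sum_(i <- F) y i).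
  by rewrite addrA subrK.
by apply: le_lt_trans (nrmD _ _) _; lra.
Qed.

End Sums.

Section Geometric.
Variables (R : realType) (V : completeNormedModType R[i]).

Lemma sum_fset_le (I : choiceType) (a : I -> R) (J J' : {fset I}) :
  (forall i, 0 <= a i) -> (J `<=` J')%fset -> \sum_(i <- J) a i <= \sum_(i <- J') a i.
Proof. by move=> a0 /(sum_fset_split a) ->; rewrite lerDl sumr_ge0. Qed.

Lemma sum_geo (q : R) (J : {fset nat}) : 0 <= q -> q <= 2^-1 ->
  \sum_(i <- J) q ^+ i <= 2.
Proof.
move=> q0 q2; have [N HN] := fset_bound J.
apply: le_trans (sum_fset_le _ (sub_iota_fset HN)) _.
  by move=> i; rewrite exprn_ge0.
(* The extra term dominates the remaining tail for a ratio of at most 1/2 and makes the bound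
   inductive. *)
rewrite sum_iota_fset; suff : \sum_(i < N) q ^+ i + 2 * q ^+ N <= 2.
  by have := exprn_ge0 N q0; lra.
elim: N {HN} => [|N IH]; first by rewrite big_ord0 expr0; lra.
rewrite big_ord_recr /= exprS; have := exprn_ge0 N q0; nra.
Qed.

Lemma summ_geo (x : nat -> V) C q : 0 <= C -> 0 <= q -> q <= 2^-1 ->
  (forall n, nrm (x n) <= C * q ^+ n) -> summ x (C * 2).
Proof.
move=> C0 q0 q2 xC; apply: summ_le xC _ => J.
by rewrite -mulr_sumr ler_wpM2l // sum_geo.
Qed.

Lemma summ_geo2 (x : nat * nat -> V) C q : 0 <= C -> 0 <= q -> q <= 2^-1 ->
  (forall n m, nrm (x (n, m)) <= C * (q ^+ n * q ^+ m)) -> summ x (C * 4).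
Proof.
move=> C0 q0 q2 xC; apply: (@summ_le _ _ _ _ (fun p => C * (q ^+ p.1 * q ^+ p.2))).
  by case.
move=> J; rewrite -mulr_sumr ler_wpM2l //.
pose F := [fset p.1 | p in J]%fset; pose G := [fset p.2 | p in J]%fset.
have sub : (J `<=` [fset p in [seq (i, j) | i <- F, j <- G]])%fset.
  apply/fsubsetP => -[i j] ij; rewrite in_fset; apply/allpairsP; exists (i, j).
  by split=> //=; apply/imfsetP; exists (i, j).
apply: le_trans (sum_fset_le _ sub) _.
  by move=> p; rewrite mulr_ge0 ?exprn_ge0.
rewrite sum_fset_pair /=; under eq_bigr do rewrite -mulr_sumr.
rewrite -mulr_suml (_ : 4 = 2 * 2); last by lra.
by apply: ler_pM; rewrite ?sum_geo // sumr_ge0 // => i _; rewrite exprn_ge0.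
Qed.

Lemma geo_small (C q e : R) : 0 <= C -> 0 <= q -> q <= 2^-1 -> 0 < e ->
  exists N, forall n, (N <= n)%N -> C * q ^+ n < e.
Proof.
move=> C0 q0 q2 e0.
(* It gives [C * q ^+ n <= C / n.+1], so it is enough to go past [C / e]. *)
have pow n : q ^+ n * n.+1%:R <= 1.
  elim: n => [|n IH]; first by rewrite expr0 mulr1.
  rewrite exprS; have qn := exprn_ge0 n q0.
  have n0 : (0 : R) <= n%:R by rewrite ler0n.
  have := IH; rewrite -[n.+2%:R]natr1 -[n.+1%:R]natr1 => IH'.
  by nra.
pose N := Num.truncn (C / e); exists N => n Nn.
have lt : C / e < n.+1%:R.
  apply: lt_le_trans (truncnS_gt _) _; by rewrite ler_nat ltnS.
rewrite ltr_pdivrMr // in lt; have n1 : (0 : R) < n.+1%:R by rewrite ltr0n.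
have qn := exprn_ge0 n q0; have := pow n => pn.
rewrite -(ltr_pM2r n1); apply: le_lt_trans (_ : C * q ^+ n * n.+1%:R <= C) _.
  by rewrite -mulrA ler_piMr.
by rewrite mulrC.
Qed.

End Geometric.

(** * Summation of the recursion *)

Section BanachNorm.
Variables (R : realType) (B : banachAlgType R[i]).

Lemma nrmM (u v : B) : nrm (u * v) <= nrm u * nrm v.
Proof. by have := ba_normM u v; rewrite !nrmE -rmorphM lecR. Qed.

Lemma nrm1_ge1 : 1 <= nrm (1 : B).
Proof.
have := nrmM 1 1; rewrite mulr1 => le.
have n0 : nrm (1 : B) != 0.
  by apply/eqP => /nrm_eq0 /eqP; rewrite oner_eq0.
have := nrm_ge0 (1 : B); rewrite le_eqVlt eq_sym (negPf n0) /= => gt0.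
by rewrite -(ler_pM2l gt0) mulr1.
Qed.

Lemma has_sum_mull (I : choiceType) (x : I -> B) s u :
  has_sum x s -> has_sum (fun i => u * x i) (u * s).
Proof.
apply: (@has_sum_map _ _ _ _ (fun v : B => u * v) (nrm u)).
- by move=> v v'; rewrite mulrDr.
- exact: nrm_ge0.
- by move=> v; apply: nrmM.
Qed.

Lemma summ_mul (I : choiceType) (x : I -> B) M u v :
  summ x M -> summ (fun i => u * x i * v) (nrm u * M * nrm v).
Proof.
move=> xM; apply: (summ_le (a := fun i => nrm u * nrm (x i) * nrm v)).
  move=> i; apply: le_trans (nrmM _ _) _.
  by rewrite ler_wpM2r ?nrm_ge0 ?nrmM.
by move=> J; rewrite -mulr_suml -mulr_sumr ler_wpM2r ?nrm_ge0 // ler_wpM2l ?nrm_ge0.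
Qed.

Lemma has_sum_mulr (I : choiceType) (x : I -> B) s u :
  has_sum x s -> has_sum (fun i => x i * u) (s * u).
Proof.
apply: (@has_sum_map _ _ _ _ (fun v : B => v * u) (nrm u)).
- by move=> v v'; rewrite mulrDl.
- exact: nrm_ge0.
- by move=> v; rewrite mulrC; apply: nrmM.
Qed.

End BanachNorm.

Section Weight.
Variables (R : realFieldType) (U : Type) (nU : U -> R).
Hypothesis nU_ge0 : forall t, 0 <= nU t.

Definition weight (h : R) (w : seq U) : R := h ^+ size w * wnorm nU w.

Lemma weight_nil h : weight h [::] = 1.
Proof. by rewrite /weight wnorm_nil mulr1. Qed.

Lemma weight_cons h t w : weight h (t :: w) = h * nU t * weight h w.
Proof. by rewrite /weight wnorm_cons exprS; ring. Qed.

Lemma weight_cat h u v : weight h (u ++ v) = weight h u * weight h v.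
Proof.
elim: u => [|t u IH]; first by rewrite weight_nil mul1r.
by rewrite cat_cons !weight_cons IH mulrA.
Qed.

Lemma weight_rcons h w t : weight h (rcons w t) = weight h w * (h * nU t).
Proof. by rewrite -cats1 weight_cat weight_cons weight_nil mulr1. Qed.

Lemma weight_nseq h n t : weight h (nseq n t) = (h * nU t) ^+ n.
Proof. by elim: n => [|n IH]; rewrite ?weight_nil // weight_cons IH exprS. Qed.

Lemma weight_ge0 h w : 0 <= h -> 0 <= weight h w.
Proof. by move=> h0; rewrite mulr_ge0 ?exprn_ge0 ?wnorm_ge0. Qed.

End Weight.

Section Series.
Variables (R : realType) (B : banachAlgType R[i]).
Variables (U : Type) (act : U -> B -> U) (nU : U -> R).
Hypotheses (act1 : forall t, act t 1 = t) (nU_ge0 : forall t, 0 <= nU t).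
Hypothesis nU_act : forall t b, nU (act t b) <= nU t * nrm b.
Variables (K phi : seq U -> B) (KA : admissible act K) (phiA : admissible act phi).
Hypothesis phiE : forall w, subst act K phi w = phi w.
Variables (G : R) (G0 : 0 <= G).
Hypotheses (KG : growth (@nrm R B) nU K G) (phiG : growth (@nrm R B) nU phi G).

Local Notation wt := (weight nU).
Local Notation Psi := (psi act K phi).
Local Notation o := (nrm (1 : B)).

Let wt0 h w : 0 <= h -> 0 <= wt h w. Proof. exact: weight_ge0. Qed.

Lemma psi_nrm w t g r : nrm (Psi w t g r) <= wt G (rcons w t) * (wt G g * wt (2 * G) r).
Proof.
have := @psi_growth R B (@nrm R B) (@nrm_ge0 _ _) (@nrmD _ _) (@nrmM R B) U act nU
  act1 nU_ge0 nU_act K phi G w t g r G0 (adm_nil phiA) KG phiG.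
move=> /le_trans; apply; rewrite /weight size_rcons wnorm_rcons.
by rewrite le_eqVlt; apply/orP; left; apply/eqP; ring.
Qed.

Lemma wt_act w t b z : wt G (rcons (rcons w (act t b)) z)
  <= wt G (rcons w t) * (G * nU z) * nrm b.
Proof.
rewrite !weight_rcons (_ : _ * nrm b = wt G w * (G * (nU t * nrm b)) * (G * nU z)); last by ring.
by rewrite ler_wpM2r ?mulr_ge0 // ler_wpM2l ?wt0 // ler_wpM2l.
Qed.

(** * Powers of one letter *)

Section OneVariable.
Variable z : U.
Let q := 2 * G * nU z.
Hypothesis small : 2 * o * q <= 2^-1.

Let o1 : 1 <= o. Proof. exact: nrm1_ge1. Qed.
Let q0 : 0 <= q. Proof. by rewrite !mulr_ge0. Qed.
Let q2 : q <= 2^-1. Proof. by have := o1; have := q0; move: small; nra. Qed.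

Definition moment_sum g : B := sum (fun n => phi (g ++ nseq n z)).

Lemma phi_cat_le g n : nrm (phi (g ++ nseq n z)) <= o * wt G g * q ^+ n.
Proof.
have wg := wt0 g G0; have zq : 0 <= G * nU z by rewrite mulr_ge0.
have le : wt G (g ++ nseq n z) <= wt G g * q ^+ n.
  rewrite weight_cat weight_nseq ler_wpM2l // lerXn2r ?nnegrE //.
  by rewrite /q -mulrA ler_peMl // ler1n.
case E : (g ++ nseq n z) => [|t w].
  case: g n E {le wg} => // -[|//] _.
  by rewrite (adm_nil phiA) weight_nil !mulr1.
have le2 := phiG (w := t :: w) ltac:(by []); rewrite E in le.
apply: le_trans le2 _; apply: le_trans le _; rewrite -mulrA ler_peMl //.
by rewrite mulr_ge0 ?exprn_ge0.
Qed.

Lemma moment_summ g : summ (fun n => phi (g ++ nseq n z)) (o * wt G g * 2).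
Proof. by apply: summ_geo q0 q2 (phi_cat_le g); rewrite mulr_ge0 ?wt0 ?nrm_ge0. Qed.

Lemma moment_has_sum g : has_sum (fun n => phi (g ++ nseq n z)) (moment_sum g).
Proof. exact: summ_has_sum (moment_summ g). Qed.

Lemma moment_nrm g : nrm (moment_sum g) <= o * wt G g * 2.
Proof. exact: has_sum_nrm (moment_has_sum g) (moment_summ g). Qed.

Lemma momentS_summ : summ (fun n => phi (nseq n.+1 z)) (o * q * 2).
Proof.
apply: summ_geo q0 q2 _; first by rewrite mulr_ge0 ?nrm_ge0.
by move=> n; have := phi_cat_le [::] n.+1; rewrite weight_nil mulr1 exprS mulrA.
Qed.

Lemma momentS_has_sum : has_sum (fun n => phi (nseq n.+1 z)) (moment_sum [::] - 1).
Proof.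
have h := summ_has_sum momentS_summ.
suff -> : moment_sum [::] - 1 = sum (fun n => phi (nseq n.+1 z)) by [].
apply/eqP; rewrite subr_eq addrC -(adm_nil phiA); apply/eqP.
exact: has_sum_unique (moment_has_sum _) (has_sum_shift (moment_summ [::]) h).
Qed.

Definition tail_sum w t g : B := sum (fun n => Psi w t g (nseq n z)).

Lemma tail_summ w t g : summ (fun n => Psi w t g (nseq n z))
  (wt G (rcons w t) * wt G g * 2).
Proof.
apply: summ_geo q0 q2 _; first by rewrite mulr_ge0 ?wt0.
by move=> n; apply: le_trans (psi_nrm _ _ _ _) _; rewrite weight_nseq -/q mulrA.
Qed.

Lemma tail_has_sum w t g :
  has_sum (fun n => Psi w t g (nseq n z)) (tail_sum w t g).
Proof. exact: summ_has_sum (tail_summ w t g). Qed.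

Lemma tail_nrm w t g : nrm (tail_sum w t g) <= wt G (rcons w t) * wt G g * 2.
Proof. exact: has_sum_nrm (tail_has_sum w t g) (tail_summ w t g). Qed.

Lemma tail_step w t g : tail_sum w t g = K (rcons w t) * phi g
  + tail_sum (rcons w (act t (phi g))) z [::] + tail_sum w t (rcons g z).
Proof.
apply: has_sum_unique (tail_has_sum w t g) _.
rewrite -addrA; apply: has_sum_shift (tail_summ w t g) _.
apply: has_sum_eq (has_sumD (tail_has_sum _ _ _) (tail_has_sum _ _ _)) => n /=.
by rewrite addrC.
Qed.

Lemma tail_act_add w t s b b' : tail_sum (rcons w (act t (b + b'))) s [::]
  = tail_sum (rcons w (act t b)) s [::] + tail_sum (rcons w (act t b')) s [::].
Proof.
apply: has_sum_unique (tail_has_sum _ _ _) _.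
apply: has_sum_eq (has_sumD (tail_has_sum _ _ _) (tail_has_sum _ _ _)) => n /=.
by rewrite -!cats1 (psi_add_block _ KA).
Qed.

Lemma tail_act_nrm w t s b : nrm (tail_sum (rcons w (act t b)) s [::])
  <= wt G (rcons w t) * (G * nU s) * 2 * nrm b.
Proof.
apply: le_trans (tail_nrm _ _ _) _; rewrite weight_nil mulr1 [leRHS]mulrAC.
by rewrite ler_wpM2r ?wt_act.
Qed.

Lemma tail_act_has_sum (I : choiceType) (f : I -> B) b w t s : has_sum f b ->
  has_sum (fun i => tail_sum (rcons w (act t (f i))) s [::])
          (tail_sum (rcons w (act t b)) s [::]).
Proof.
apply: (@has_sum_map _ _ _ _ (fun b => tail_sum (rcons w (act t b)) s [::])
     (wt G (rcons w t) * (G * nU s) * 2)).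
- by move=> u v; apply: tail_act_add.
- by rewrite mulr_ge0 // mulr_ge0 ?wt0 ?mulr_ge0.
- by move=> v; apply: tail_act_nrm.
Qed.

(* The value of each gap is a moment of a power of [z]; summing over the length of
   the first gap replaces it by [moment_sum]. *)
Lemma tail_full w t g : tail_sum w t g = K (rcons w t) * moment_sum g
  + tail_sum (rcons w (act t (moment_sum g))) z [::].
Proof.
pose a i := K (rcons w t) * phi (g ++ nseq i z)
  + tail_sum (rcons w (act t (phi (g ++ nseq i z)))) z [::].
rewrite -{1}[g]cats0.
apply: (@telescope_sum _ _ (fun i => tail_sum w t (g ++ nseq i z)) a).
- move=> i; rewrite [LHS]tail_step; congr (_ + tail_sum w t _).
  by rewrite rcons_cat; congr (_ ++ _); elim: i => //= i ->.
- move=> e e0; have w0 : 0 <= wt G (rcons w t) * wt G g * 2 by rewrite mulr_ge0 // mulr_ge0 ?wt0.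
  have [N HN] := geo_small w0 q0 q2 e0; exists N => n /HN lt.
  apply: le_lt_trans lt; apply: le_trans (tail_nrm _ _ _) _.
  rewrite weight_cat weight_nseq mulrA [leRHS]mulrAC ler_wpM2r //.
  rewrite ler_wpM2l ?(mulr_ge0 (wt0 _ _)) ?wt0 // lerXn2r ?nnegrE ?mulr_ge0 //.
  by rewrite /q -mulrA ler_peMl ?mulr_ge0 // ler1n.
- apply: has_sumD.
    exact: has_sum_mull (moment_has_sum g).
  exact: tail_act_has_sum (moment_has_sum g).
Qed.

Local Notation m := (moment_sum [::]).

Definition block_term w j : B := K (rcons (w ++ nseq j (act z m)) z).
Definition block_sum w : B := sum (block_term w).

(** The norm of [m] is at most [2 * o], and [small] leaves room for this factor: the letter
    [act z m] still has weight at most 1/2, whence geometric decay in [j]. *)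
Let wt_pow w j : wt G (rcons (w ++ nseq j (act z m)) z)
  <= wt G w * (G * nU z) * (2^-1) ^+ j.
Proof.
rewrite weight_rcons weight_cat weight_nseq mulrAC.
rewrite ler_wpM2l ?(mulr_ge0 (wt0 _ _)) ?mulr_ge0 //.
rewrite lerXn2r ?nnegrE ?mulr_ge0 ?invr_ge0 //.
apply: le_trans small; apply: le_trans (ler_wpM2l G0 (nU_act _ _)) _.
apply: le_trans (ler_wpM2l G0 (ler_wpM2l (nU_ge0 z) (moment_nrm _))) _.
by rewrite weight_nil /q; have := mulr_ge0 G0 (nU_ge0 z); have := o1; nra.
Qed.

Let wtG w : 0 <= wt G w * (G * nU z).
Proof. exact: mulr_ge0 (wt0 w G0) (mulr_ge0 G0 (nU_ge0 z)). Qed.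

Let half0 : (0 : R) <= 2^-1. Proof. lra. Qed.
Let half2 : (2^-1 : R) <= 2^-1. Proof. lra. Qed.

Lemma block_term_nrm w j : nrm (block_term w j) <= wt G w * (G * nU z) * (2^-1) ^+ j.
Proof. by apply: le_trans (wt_pow w j); apply: KG; case: (w ++ _). Qed.

Lemma block_summ w : summ (block_term w) (wt G w * (G * nU z) * 2).
Proof.
exact: summ_geo (wtG w) half0 half2 (block_term_nrm w).
Qed.

Lemma block_has_sum w : has_sum (block_term w) (block_sum w).
Proof. exact: summ_has_sum (block_summ w). Qed.

(** [tail_full] settles the gap behind one letter of the block and starts again at the next one. In
    the limit every inner gap has become [m], and the last gap gives the factor [m] on the right. *)
Lemma tail_iter w : tail_sum w z [::] = block_sum w * m.
Proof.
pose S j := tail_sum (w ++ nseq j (act z m)) z [::].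
have -> : tail_sum w z [::] = S 0%N by rewrite /S cats0.
apply: (@telescope_sum _ _ S (fun j => block_term w j * m)).
- move=> j; rewrite /S (_ : w ++ nseq j.+1 _ = rcons (w ++ nseq j (act z m)) (act z m)).
    exact: tail_full.
  by rewrite rcons_cat; congr (_ ++ _); elim: j => //= j ->.
- move=> e e0; have w0 : 0 <= wt G w * (G * nU z) * 2 by rewrite mulr_ge0 ?wtG.
  have [N HN] := geo_small w0 half0 half2 e0; exists N => n /HN lt.
  apply: le_lt_trans lt; rewrite /S; apply: le_trans (tail_nrm _ _ _) _.
  rewrite weight_nil mulr1 [leRHS]mulrAC. by rewrite ler_wpM2r.
- exact: has_sum_mulr (block_has_sum w).
Qed.

Lemma momentE : m = 1 + block_sum [::] * m.
Proof.
rewrite -tail_iter; apply/eqP; rewrite addrC -subr_eq; apply/eqP.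
apply: has_sum_unique momentS_has_sum _.
by apply: has_sum_eq (tail_has_sum [::] z [::]) => n; rewrite -phiE.
Qed.

Lemma block_sum_nrm : nrm (block_sum [::]) < 1.
Proof.
apply: (@le_lt_trans _ _ q); last by have := q2; lra.
apply: le_trans (has_sum_nrm (block_has_sum _) (block_summ _)) _.
by rewrite weight_nil mul1r mulrC mulrA.
Qed.

(** [momentE] has the cumulants on the left of [m] and makes [m] a right inverse of [1 - k]. For
    [nrm k < 1] multiplication by [1 - k] is injective, so [m] is a left inverse too. *)
Lemma moment_block : m * block_sum [::] = m - 1.
Proof.
set k := block_sum [::]; have mE := momentE; rewrite -/k in mE.
have inj v : (1 - k) * v = 0 -> v = 0.
  rewrite mulrBl mul1r => /eqP; rewrite subr_eq0 => /eqP vk; apply: nrm_eq0.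
  have := nrmM k v; rewrite -vk => le; have := block_sum_nrm; have := nrm_ge0 v.
  by rewrite -/k; nra.
have km : (1 - k) * m = 1 by rewrite mulrBl mul1r {1}mE addrK.
have : m * (1 - k) - 1 = 0.
  by apply: inj; rewrite mulrBr mulrA km mul1r mulr1 subrr.
by move/eqP; rewrite subr_eq0 mulrBr mulr1 => /eqP <-; rewrite opprB addrC subrK.
Qed.

End OneVariable.

(** * Words with letters of both faces *)

Section Mixed.
Variables x y yc : U.
Let p := 2 * G * nU x.
Let q := 2 * G * nU y.
Let v := 2 * G * nU yc.
Hypotheses (xsmall : 2 * o * p <= 2^-1) (ysmall : 2 * o * q <= 2^-1).
Variable c : B.
(* A right coefficient of the first right letter acts on the letter before it. *)
Hypothesis balance : forall w t b r,
  Psi (rcons w (act t b)) yc [::] r = Psi (rcons w (act t (b * c))) y [::] r.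
Hypothesis phi_yc : forall r, phi (yc :: r) = c * phi (y :: r).

Let o1 : 1 <= o. Proof. exact: nrm1_ge1. Qed.
Let p0 : 0 <= p. Proof. by rewrite !mulr_ge0. Qed.
Let q0 : 0 <= q. Proof. by rewrite !mulr_ge0. Qed.
Let v0 : 0 <= v. Proof. by rewrite !mulr_ge0. Qed.
Let p2 : p <= 2^-1. Proof. by have := o1; have := p0; move: xsmall; nra. Qed.
Let q2 : q <= 2^-1. Proof. by have := o1; have := q0; move: ysmall; nra. Qed.
Let half0 : (0 : R) <= 2^-1. Proof. lra. Qed.
Let half2 : (2^-1 : R) <= 2^-1. Proof. lra. Qed.

Local Notation ml := (moment_sum x [::]).
Local Notation mr := (moment_sum y [::]).

Definition row_sum w t g n : B :=
  sum (fun j => Psi w t g (nseq n x ++ yc :: nseq j y)).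

Lemma row_term_le w t g n j : nrm (Psi w t g (nseq n x ++ yc :: nseq j y))
  <= wt G (rcons w t) * wt G g * v * (p ^+ n * q ^+ j).
Proof.
apply: le_trans (psi_nrm _ _ _ _) _.
rewrite weight_cat weight_cons !weight_nseq -/p -/q -/v.
by rewrite le_eqVlt; apply/orP; left; apply/eqP; ring.
Qed.

Let wt2 w t g : 0 <= wt G (rcons w t) * wt G g * v.
Proof. by rewrite mulr_ge0 // mulr_ge0 ?wt0. Qed.

Lemma row_summ w t g n :
  summ (fun j => Psi w t g (nseq n x ++ yc :: nseq j y))
    (wt G (rcons w t) * wt G g * v * p ^+ n * 2).
Proof.
apply: summ_geo q0 q2 _; first by rewrite mulr_ge0 ?exprn_ge0 ?wt2.
by move=> j; rewrite -[leRHS]mulrA; apply: row_term_le.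
Qed.

Lemma row_has_sum w t g n :
  has_sum (fun j => Psi w t g (nseq n x ++ yc :: nseq j y)) (row_sum w t g n).
Proof. exact: summ_has_sum (row_summ w t g n). Qed.

Lemma row_nrm w t g n :
  nrm (row_sum w t g n) <= wt G (rcons w t) * wt G g * v * 2 * p ^+ n.
Proof.
rewrite [leRHS]mulrAC; exact: has_sum_nrm (row_has_sum w t g n) (row_summ w t g n).
Qed.

Lemma row_sum0 w t g : row_sum w t g 0 = tail_sum y w t (rcons g yc)
  + tail_sum y (rcons w (act t (phi g))) yc [::].
Proof.
apply: has_sum_unique (row_has_sum w t g 0) _.
apply: has_sum_eq (has_sumD (tail_has_sum ysmall _ _ _) (tail_has_sum ysmall _ _ _)).
by [].
Qed.

Lemma row_sumS w t g n : row_sum w t g n.+1 = row_sum w t (rcons g x) n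
  + row_sum (rcons w (act t (phi g))) x [::] n.
Proof.
apply: has_sum_unique (row_has_sum w t g n.+1) _.
by apply: has_sum_eq (has_sumD (row_has_sum _ _ _ _) (row_has_sum _ _ _ _)).
Qed.

Definition mixed_sum w t g : B := sum (row_sum w t g).

Lemma mixed_summ w t g : summ (row_sum w t g) (wt G (rcons w t) * wt G g * v * 2 * 2).
Proof. by apply: summ_geo p0 p2 (row_nrm w t g); rewrite mulr_ge0 ?wt2. Qed.

Lemma mixed_has_sum w t g : has_sum (row_sum w t g) (mixed_sum w t g).
Proof. exact: summ_has_sum (mixed_summ w t g). Qed.

Lemma mixed_nrm w t g :
  nrm (mixed_sum w t g) <= wt G (rcons w t) * wt G g * v * 2 * 2.
Proof. exact: has_sum_nrm (mixed_has_sum w t g) (mixed_summ w t g). Qed.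

Lemma mixed_step w t g : mixed_sum w t g = tail_sum y w t (rcons g yc)
  + tail_sum y (rcons w (act t (phi g))) yc [::]
  + mixed_sum (rcons w (act t (phi g))) x [::] + mixed_sum w t (rcons g x).
Proof.
apply: has_sum_unique (mixed_has_sum w t g) _.
rewrite -row_sum0 -addrA; apply: has_sum_shift (mixed_summ w t g) _.
apply: has_sum_eq (has_sumD (mixed_has_sum _ _ _) (mixed_has_sum _ _ _)) => n /=.
by rewrite addrC -row_sumS.
Qed.

Lemma mixed_act_has_sum (I : choiceType) (f : I -> B) b w t s : has_sum f b ->
  has_sum (fun i => mixed_sum (rcons w (act t (f i))) s [::])
          (mixed_sum (rcons w (act t b)) s [::]).
Proof.
apply: (@has_sum_map _ _ _ _ (fun b => mixed_sum (rcons w (act t b)) s [::])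
     (wt G (rcons w t) * (G * nU s) * v * 2 * 2)).
- move=> u u'; apply: has_sum_unique (mixed_has_sum _ _ _) _.
  apply: has_sum_eq (has_sumD (mixed_has_sum _ _ _) (mixed_has_sum _ _ _)) => n /=.
  symmetry; apply: has_sum_unique (row_has_sum _ _ _ _) _.
  apply: has_sum_eq (has_sumD (row_has_sum _ _ _ _) (row_has_sum _ _ _ _)) => j /=.
  by rewrite -!cats1 (psi_add_block _ KA).
- by rewrite mulr_ge0 // mulr_ge0 // mulr_ge0 // mulr_ge0 ?wt0 ?mulr_ge0.
- move=> u; apply: le_trans (mixed_nrm _ _ _) _; rewrite weight_nil mulr1.
  rewrite [leRHS]mulrAC ler_wpM2r // [leRHS]mulrAC ler_wpM2r //.
  by rewrite [leRHS]mulrAC ler_wpM2r ?wt_act.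
Qed.

Definition row_moment n : B := moment_sum y (rcons (nseq n x) yc).
(** Only words with a right letter are counted; the others contribute [ml * c], so the full series
    is [N + ml * c]. *)
Definition mixed_moment : B := sum row_moment.
Local Notation N := mixed_moment.

Lemma row_moment_nrm n : nrm (row_moment n) <= o * v * p ^+ n.
Proof.
apply: le_trans (moment_nrm ysmall _) _.
rewrite weight_rcons weight_nseq (_ : _ * 2 = o * v * (G * nU x) ^+ n); last first.
  by rewrite /v; ring.
rewrite ler_wpM2l ?mulr_ge0 ?nrm_ge0 // lerXn2r ?nnegrE ?mulr_ge0 //.
by rewrite /p -mulrA ler_peMl ?mulr_ge0 // ler1n.
Qed.

Lemma row_moment_summ : summ row_moment (o * v * 2).
Proof. by apply: summ_geo p0 p2 row_moment_nrm; rewrite mulr_ge0 ?nrm_ge0. Qed.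

Lemma row_moment_has_sum : has_sum row_moment N.
Proof. exact: summ_has_sum row_moment_summ. Qed.

Lemma row_moment0 : row_moment 0 = c * (mr - 1).
Proof.
apply: has_sum_unique (moment_has_sum ysmall _) _.
by apply: has_sum_eq (has_sum_mull c (momentS_has_sum ysmall)) => n; rewrite /= phi_yc.
Qed.

Lemma row_momentS n : row_moment n.+1 = row_sum [::] x [::] n.
Proof.
apply: has_sum_unique (moment_has_sum ysmall _) _.
apply: has_sum_eq (row_has_sum [::] x [::] n) => j.
by rewrite cat_rcons -phiE.
Qed.

Lemma mixed_moment_rows : N = c * (mr - 1) + mixed_sum [::] x [::].
Proof.
apply: has_sum_unique row_moment_has_sum _; rewrite -row_moment0.
apply: has_sum_shift row_moment_summ _.
by apply: has_sum_eq (mixed_has_sum _ _ _) => n; rewrite row_momentS.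
Qed.

Local Notation mxy := (N + ml * c).

(** The gap behind [t] takes the whole rest of the word, ends before a right letter, or ends before
    a left letter. In the second case a gap with right letters contributes to [N], while a gap of
    left letters only is followed by [yc], whose coefficient turns [ml] into [ml * c]. *)
Lemma mixed_full w t : mixed_sum w t [::] = K (rcons w t) * N
  + tail_sum y (rcons w (act t mxy)) y [::] + mixed_sum (rcons w (act t ml)) x [::].
Proof.
pose a i := K (rcons w t) * row_moment i
  + tail_sum y (rcons w (act t (row_moment i))) y [::]
  + tail_sum y (rcons w (act t (phi (nseq i x)))) yc [::]
  + mixed_sum (rcons w (act t (phi (nseq i x)))) x [::].
apply: (@telescope_sum _ _ (fun i => mixed_sum w t (nseq i x)) a).
- move=> i; rewrite mixed_step (tail_full ysmall) -/(row_moment i).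
  by congr (_ + mixed_sum w t _); elim: i => //= i ->.
- move=> e e0; have two : 0 <= (2 : R) by [].
  have [M HM] := geo_small (mulr_ge0 (mulr_ge0 (wt2 w t [::]) two) two) p0 p2 e0.
  exists M => n /HM lt; apply: le_lt_trans lt; apply: le_trans (mixed_nrm _ _ _) _.
  rewrite weight_nil weight_nseq mulr1 [leRHS]mulrAC ler_wpM2r //.
  rewrite [leRHS]mulrAC ler_wpM2r // [leRHS]mulrAC ler_wpM2r // ler_wpM2l ?wt0 //.
  rewrite lerXn2r ?nnegrE ?mulr_ge0 //.
  by rewrite /p -mulrA ler_peMl ?mulr_ge0 // ler1n.
- rewrite (tail_act_add ysmall) addrA.
  apply: has_sumD; last exact: mixed_act_has_sum (moment_has_sum xsmall [::]).
  apply: has_sumD.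
    apply: has_sumD; first exact: has_sum_mull row_moment_has_sum.
    exact: tail_act_has_sum row_moment_has_sum.
  suff -> : tail_sum y (rcons w (act t (ml * c))) y [::]
      = tail_sum y (rcons w (act t ml)) yc [::].
    exact: tail_act_has_sum (moment_has_sum xsmall [::]).
  apply: has_sum_unique (tail_has_sum ysmall _ _ _) _.
  by apply: has_sum_eq (tail_has_sum ysmall _ _ _) => n; rewrite balance.
Qed.

Local Notation wx j := (nseq j (act x ml)).
(* The cumulants whose block has both left and right letters. *)
Definition cross_term j : B := block_sum y (rcons (wx j) (act x mxy)).
Definition cross_sum : B := sum cross_term.

Let wx_le j : wt G (wx j) <= (2^-1) ^+ j.
Proof.
rewrite weight_nseq lerXn2r ?nnegrE ?mulr_ge0 ?invr_ge0 //.
apply: le_trans xsmall; apply: le_trans (ler_wpM2l G0 (nU_act _ _)) _.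
apply: le_trans (ler_wpM2l G0 (ler_wpM2l (nU_ge0 x) (moment_nrm xsmall _))) _.
by rewrite weight_nil /p; have := mulr_ge0 G0 (nU_ge0 x); have := o1; nra.
Qed.

Lemma cross_term_nrm j : nrm (cross_term j)
  <= G * nU (act x mxy) * (G * nU y) * 2 * (2^-1) ^+ j.
Proof.
apply: le_trans (has_sum_nrm (block_has_sum ysmall _) (block_summ ysmall _)) _.
rewrite weight_rcons [leRHS]mulrAC ler_wpM2r // [leRHS]mulrAC ler_wpM2r ?mulr_ge0 //.
by rewrite mulrC ler_wpM2l ?mulr_ge0.
Qed.

Lemma cross_summ : summ cross_term (G * nU (act x mxy) * (G * nU y) * 2 * 2).
Proof. by apply: summ_geo half0 half2 cross_term_nrm; rewrite !mulr_ge0. Qed.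

Lemma cross_has_sum : has_sum cross_term cross_sum.
Proof. exact: summ_has_sum cross_summ. Qed.

Lemma mixed_iter : mixed_sum [::] x [::] = block_sum x [::] * N + cross_sum * mr.
Proof.
pose a j := block_term x [::] j * N + cross_term j * mr.
apply: (@telescope_sum _ _ (fun j => mixed_sum (wx j) x [::]) a).
- move=> j; rewrite [LHS]mixed_full /a (tail_iter ysmall).
  rewrite (_ : wx j.+1 = rcons (wx j) (act x ml)) //.
  by elim: (j) => //= k ->.
- move=> e e0.
  have b0 : 0 <= G * nU x * v * 2 * 2 by rewrite !mulr_ge0.
  have [M HM] := geo_small b0 half0 half2 e0.
  exists M => n /HM lt; apply: le_lt_trans lt; apply: le_trans (mixed_nrm _ _ _) _.
  rewrite weight_nil mulr1 weight_rcons.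
  rewrite [leRHS]mulrAC ler_wpM2r // [leRHS]mulrAC ler_wpM2r // [leRHS]mulrAC ler_wpM2r //.
  by rewrite mulrC ler_wpM2l ?mulr_ge0.
- apply: has_sumD; first exact: has_sum_mulr (block_has_sum xsmall [::]).
  exact: has_sum_mulr cross_has_sum.
Qed.

(** In the equation for [N] given by the rows, left multiplication by [ml] turns the cumulants of
    powers of [x] into [ml - 1], and [ml * N] cancels. *)
Lemma mixed_momentE : mxy = ml * c * mr + ml * cross_sum * mr.
Proof.
have NE := mixed_moment_rows; rewrite mixed_iter in NE.
have : ml * N = ml * (c * (mr - 1)) + (ml - 1) * N + ml * cross_sum * mr.
  by rewrite {1}NE !mulrDr !mulrA moment_block // addrA.
rewrite mulrBl mul1r mulrBr mulr1 mulrBr mulrA => h.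
suff -> : N = ml * c * mr - ml * c + ml * cross_sum * mr by rewrite addrAC subrK.
by apply: (addrI (ml * N - N)); rewrite subrK {1}h [_ + (ml * N - N)]addrC -!addrA.
Qed.

Definition moment_term (nm : nat * nat) : B :=
  if nm.2 is m.+1 then phi (nseq nm.1 x ++ yc :: nseq m y) else phi (nseq nm.1 x) * c.

Lemma moment_term_summ : summ moment_term ((o * nrm c + v) * 4).
Proof.
apply: summ_geo2 half0 half2 _; first by rewrite addr_ge0 ?mulr_ge0 ?nrm_ge0.
move=> n m; rewrite mulrDl /moment_term /=.
have pn : (p ^+ n) <= 2^-1 ^+ n by rewrite lerXn2r ?nnegrE.
have h0 k : 0 <= (2^-1 : R) ^+ k by rewrite exprn_ge0.
have oc0 : 0 <= o * nrm c by rewrite mulr_ge0 ?nrm_ge0.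
case: m => [|m].
  rewrite expr0 mulr1 ler_wpDr ?mulr_ge0 //; apply: le_trans (nrmM _ _) _.
  rewrite [leRHS]mulrAC ler_wpM2r ?nrm_ge0 //.
  have := phi_cat_le x [::] n; rewrite weight_nil mulr1 => /le_trans.
  by apply; rewrite ler_wpM2l ?nrm_ge0.
rewrite ler_wpDl ?(mulr_ge0 oc0) ?mulr_ge0 //.
have w0 : nseq n x ++ yc :: nseq m y <> [::] by case: (n).
apply: le_trans (phiG w0) _.
rewrite -/(weight nU G _) weight_cat weight_cons !weight_nseq exprS.
have xn : (G * nU x) ^+ n <= 2^-1 ^+ n.
  apply: le_trans pn; rewrite lerXn2r ?nnegrE ?mulr_ge0 //.
  by rewrite /p -mulrA ler_peMl ?mulr_ge0 // ler1n.
have ym : (G * nU y) ^+ m <= 2^-1 ^+ m.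
  rewrite lerXn2r ?nnegrE ?mulr_ge0 //; apply: le_trans q2.
  by rewrite /q -mulrA ler_peMl ?mulr_ge0 // ler1n.
rewrite (_ : v * _ = 2^-1 ^+ n * (G * nU yc * 2^-1 ^+ m)); last by rewrite /v; field.
by rewrite ler_pM ?exprn_ge0 ?mulr_ge0 ?exprn_ge0 ?mulr_ge0 // ler_wpM2l ?mulr_ge0.
Qed.

Lemma moment_term_has_sum : has_sum moment_term mxy.
Proof.
have hs := summ_has_sum moment_term_summ; suff -> : mxy = sum moment_term by [].
rewrite addrC.
apply: has_sum_unique (has_sumD (has_sum_mulr c (moment_has_sum xsmall [::])) row_moment_has_sum) _.
apply: has_sum_fubini hs _ => n /=.
have sn : summ (fun m => moment_term (n, m)) ((o * nrm c + v) * 4).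
  move=> J; apply: le_trans (moment_term_summ [fset (n, m) | m in J]%fset).
  by rewrite big_imfset //= => i j _ _ [].
apply: has_sum_shift sn _.
by apply: has_sum_eq (moment_has_sum ysmall _) => m; rewrite /moment_term /= cat_rcons.
Qed.

(** With a left letter in the block, [mxy] acts on the last one and [ml] comes out in front; without
    one, [mxy] itself stays in front. *)
Definition cumul_term (nm : nat * nat) : B :=
  if nm.1 is n.+1 then ml * block_term y (rcons (wx n) (act x mxy)) nm.2 * mr
  else mxy * block_term y [::] nm.2 * mr.

(** The factor 2 pays for the shift from [n] to [n.+1] in the power of 1/2. *)
Let cb := nrm mxy * (G * nU y) * nrm mr
  + 2 * (nrm ml * (G * nU (act x mxy) * (G * nU y)) * nrm mr).

Lemma cumul_term_summ : summ cumul_term (cb * 4).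
Proof.
have c1 : 0 <= nrm mxy * (G * nU y) * nrm mr by rewrite !mulr_ge0 ?nrm_ge0.
have c2 : 0 <= nrm ml * (G * nU (act x mxy) * (G * nU y)) * nrm mr.
  by rewrite !mulr_ge0 ?nrm_ge0.
have h0 k : 0 <= (2^-1 : R) ^+ k by rewrite exprn_ge0.
apply: summ_geo2 half0 half2 _; first by rewrite addr_ge0 // mulr_ge0.
have nrm3 u w z : nrm (u * w * z : B) <= nrm u * nrm w * nrm z.
  by apply: le_trans (nrmM _ _) _; rewrite ler_wpM2r ?nrm_ge0 ?nrmM.
move=> n m; rewrite mulrDl /cumul_term /=; case: n => [|n].
  rewrite expr0 mul1r ler_wpDr ?(mulr_ge0 (mulr_ge0 _ c2)) //.
  apply: le_trans (nrm3 _ _ _) _.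
  rewrite [leRHS]mulrAC ler_wpM2r ?nrm_ge0 // -[leRHS]mulrA ler_wpM2l ?nrm_ge0 //.
  by apply: le_trans (block_term_nrm ysmall _ _) _; rewrite weight_nil mul1r.
rewrite ler_wpDl ?(mulr_ge0 c1) ?mulr_ge0 //; apply: le_trans (nrm3 _ _ _) _.
rewrite (_ : 2 * _ * _ = nrm ml * (2^-1 ^+ n * (G * nU (act x mxy)) * (G * nU y)
  * 2^-1 ^+ m) * nrm mr); last first.
  by rewrite exprS; field.
rewrite ler_wpM2r ?nrm_ge0 // ler_wpM2l ?nrm_ge0 //.
apply: le_trans (block_term_nrm ysmall _ _) _; rewrite ler_wpM2r //.
by rewrite ler_wpM2r ?mulr_ge0 // weight_rcons ler_wpM2r ?mulr_ge0.
Qed.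

Lemma cumul_term_sum :
  sum cumul_term = mxy * (mr - 1) + ml * cross_sum * mr.
Proof.
have hs := summ_has_sum cumul_term_summ.
pose a n := if n is n.+1 then ml * cross_term n * mr else mxy * block_sum y [::] * mr.
have ha : has_sum a (sum cumul_term).
  apply: has_sum_fubini hs _ => -[|n] /=; apply: has_sum_mulr; apply: has_sum_mull;
  exact: block_has_sum.
pose c1 := nrm (mxy * block_sum y [::] * mr).
pose c2 := G * nU (act x mxy) * (G * nU y) * 2.
have c20 : 0 <= c2 by rewrite !mulr_ge0.
have sa : summ a ((c1 + 2 * (nrm ml * c2 * nrm mr)) * 2).
  apply: summ_geo half0 half2 _.
    by rewrite addr_ge0 ?nrm_ge0 // !mulr_ge0 ?nrm_ge0.
  case=> [|n] /=; first by rewrite expr0 mulr1 ler_wpDr // !mulr_ge0 ?nrm_ge0.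
  rewrite mulrDl ler_wpDl ?mulr_ge0 ?exprn_ge0 ?nrm_ge0 //.
  rewrite (_ : 2 * _ * _ = nrm ml * (c2 * 2^-1 ^+ n) * nrm mr); last first.
    by rewrite exprS; field.
  apply: le_trans (nrmM _ _) _; rewrite ler_wpM2r ?nrm_ge0 //.
  apply: le_trans (nrmM _ _) _; rewrite ler_wpM2l ?nrm_ge0 //.
  exact: cross_term_nrm.
apply: has_sum_unique ha _.
have <- : mxy * block_sum y [::] * mr = mxy * (mr - 1).
  rewrite -mulrA; congr (_ * _); apply/eqP.
  by rewrite eq_sym subr_eq addrC -momentE.
apply: has_sum_shift sa _.
by apply: has_sum_mulr; apply: has_sum_mull; apply: cross_has_sum.
Qed.

Lemma cumul_left_sum : has_sum (fun n => ml * block_term x [::] n * mxy) ((ml - 1) * mxy).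
Proof.
rewrite -moment_block //; apply: has_sum_mulr; apply: has_sum_mull.
exact: block_has_sum.
Qed.

Lemma moment_cumulant_identity : ml * mxy + mxy * mr
  = ml * c * mr + (mxy + (ml - 1) * mxy + (mxy * (mr - 1) + ml * cross_sum * mr)).
Proof.
rewrite mulrBl mul1r [mxy + _]addrC subrK mulrBr mulr1.
by rewrite [RHS]addrCA [X in _ = _ + X]addrCA -mixed_momentE subrK.
Qed.

End Mixed.

End Series.

(** * The identity *)

Section ShiftNseq.
Variables (B : nzRingType) (T : Type) (act : T -> B -> T).

Lemma head_coef_nseq n (x : B * T) : head_coef (nseq n x) x.1 = x.1.
Proof. by case: n. Qed.

Lemma shift_coef_nseq n (x : B * T) :
  shift_coef act (nseq n x) x.1 = nseq n (act x.2 x.1).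
Proof. by elim: n => //= n ->; rewrite head_coef_nseq. Qed.

Hypotheses (actM : forall t b b', act (act t b) b' = act t (b * b')).
Hypotheses (act1 : forall t, act t 1 = t).
Variables (f : seq T -> B) (fA : admissible act f).

Lemma nseq_rcons (S : Type) (t : S) n : rcons (nseq n t) t = nseq n.+1 t.
Proof. by elim: n => //= n ->. Qed.

(** Each coefficient [u] acts on the letter before it; the first one is left over in front, and [v]
    comes out behind by right linearity. *)
Lemma twist_left b t u v n :
  twist act f (rcons (nseq n (u * b, t)) (u * b, act t v))
  = u * twist act f (rcons (nseq n (act2 act (b, t) u)) (b, t)) * v.
Proof.
have shift := (@shift_coef_nseq n (_, _)); have head := (@head_coef_nseq n (_, _)).
rewrite /twist -!cats1 !head_coef_cat !shift_coef_cat /= !head !shift /=.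
by rewrite !act1 !actM !cats1 (adm_rcons fA) !mulrA.
Qed.

Lemma twist_right t u v m :
  twist act f ((u, act t v) :: nseq m (1, act t v))
  = u * twist act f (rcons (nseq m (act2 act (1, t) v)) (1, t)) * v.
Proof.
have shift := (@shift_coef_nseq m (_, _)); have head := (@head_coef_nseq m (_, _)).
rewrite /twist -!cats1 /= !head_coef_cat !shift_coef_cat /= !head !shift /=.
rewrite !act1 cats1 mul1r -mulrA -(adm_rcons fA).
by rewrite (nseq_rcons (act t v) m).
Qed.

Lemma twist_cross b s t u v w n m :
  twist act f (nseq n.+1 (u * b, s) ++ (w, act t v) :: nseq m (1, act t v))
  = u * twist act f (rcons (rcons (nseq n (act2 act (b, s) u)) (act2 act (b, s) w)
      ++ nseq m (act2 act (1, t) v)) (1, t)) * v.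
Proof.
have shift k := (@shift_coef_nseq k (_, _)); have head k := (@head_coef_nseq k (_, _)).
rewrite -nseq_rcons.
rewrite /twist -!cats1 -!catA !head_coef_cat !shift_coef_cat /= !head !shift /=.
rewrite !head_coef_cat /= !head /= !act1 !actM.
rewrite (_ : _ :: nseq m _ = nseq m (act t v) ++ [:: act t v]); last first.
  by rewrite cats1 nseq_rcons.
by rewrite -!cat_cons !catA !cats1 (adm_rcons fA) !mulrA.
Qed.

End ShiftNseq.

Section Identity.
Variables (R : realType) (A B : banachAlgType R[i]) (E : A -> B) (eps : B -> B -> A).
Hypothesis hE : bb_ncps E eps.
Variables (X Y : A) (hX : left_face eps X) (hY : right_face eps Y).

Local Notation act := (@act_letter R[i] B).
Local Notation phi := (twist act (word_moment E eps X Y)).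
Local Notation K := (twist act (cumul act (word_moment E eps X Y))).
Local Notation nU := (norm2 (@nrm R B) (fun t : side * B => nrm t.2)).
Local Notation o := (nrm (1 : B)).

Variables (G : R) (G0 : 0 <= G).
Hypotheses (KG : growth (@nrm R B) nU K G) (phiG : growth (@nrm R B) nU phi G).

Let nU_ge0 t : 0 <= nU t.
Proof. by apply: norm2_ge0 => ?; apply: nrm_ge0. Qed.

Let nU_act t b : nU (act2 act t b) <= nU t * nrm b.
Proof. by apply: norm2_act => [|s u]; [exact: nrm_ge0 | exact: nrmM]. Qed.

Let aM := @act_letterM R[i] B.
Let a1 := @act_letter1 R[i] B.
Let act1 t : act2 act t 1 = t. Proof. exact: act21 a1 t. Qed.
Let phA : admissible act (word_moment E eps X Y).
Proof. exact: word_moment_adm. Qed.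
Let cA : admissible act (cumul act (word_moment E eps X Y)).
Proof. exact: cumul_adm. Qed.
Let KA : admissible (act2 act) K. Proof. exact: K2_adm. Qed.
Let phiA : admissible (act2 act) phi. Proof. exact: phi2_adm. Qed.
Let phiE w : subst (act2 act) K phi w = phi w. Proof. exact: subst_K2. Qed.

Variables b c d : B.
Let x : B * (side * B) := (b, (lft, 1)).
Let y : B * (side * B) := (1, (rgt, d)).
Let yc : B * (side * B) := (c, (rgt, d)).
Hypotheses (xsmall : 2 * o * (2 * G * nU x) <= 2^-1).
Hypotheses (ysmall : 2 * o * (2 * G * nU y) <= 2^-1).

Lemma shift_balance w t u r :
  psi (act2 act) K phi (rcons w (act2 act t u)) yc [::] r
  = psi (act2 act) K phi (rcons w (act2 act t (u * c))) y [::] r.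
Proof.
rewrite !psi_twist //.
rewrite -!cats1 !head_coef_cat !shift_coef_cat /= !act_letterM mulr1.
by [].
Qed.

Lemma twist_cons_coef u (w : seq (B * (side * B))) :
  phi ((u, (rgt, d)) :: w) = u * phi (y :: w).
Proof. by rewrite /twist /= mul1r. Qed.

Let ml := moment_sum phi x [::].
Let mr := moment_sum phi y [::].
Let mxy := mixed_moment phi x y yc + ml * c.

Lemma MlE : abs_summable (Ml_term E eps X b) /\ Ml E eps X b = ml.
Proof.
have eqM : (fun n => phi (nseq n.+1 x)) =1 Ml_term E eps X b.
  by move=> n; rewrite (Ml_termE hE X hY).
rewrite -(funext eqM); split.
  by have := summ_abs (momentS_summ nU_ge0 phiA G0 phiG xsmall).
rewrite /Ml -(funext eqM).
by rewrite (has_sum_sum (momentS_has_sum nU_ge0 phiA G0 phiG xsmall)) addrC subrK.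
Qed.

Lemma MrE : abs_summable (Mr_term E eps Y d) /\ Mr E eps Y d = mr.
Proof.
have eqM : (fun n => phi (nseq n.+1 y)) =1 Mr_term E eps Y d.
  by move=> n; rewrite (Mr_termE hE X hY).
rewrite -(funext eqM); split.
  by have := summ_abs (momentS_summ nU_ge0 phiA G0 phiG ysmall).
rewrite /Mr -(funext eqM).
by rewrite (has_sum_sum (momentS_has_sum nU_ge0 phiA G0 phiG ysmall)) addrC subrK.
Qed.

Lemma MxyE : abs_summable (M_term E eps X Y b c d) /\ Mxy E eps X Y b c d = mxy.
Proof.
have eqM : moment_term phi x y yc c =1 M_term E eps X Y b c d.
  by case=> n [|m]; rewrite ?(M_termSE hE X hY) ?(M_term0E hE hX).
rewrite /Mxy -(funext eqM); split.
  by have := summ_abs (moment_term_summ nU_ge0 phiA G0 phiG yc xsmall ysmall c).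
exact: has_sum_sum (moment_term_has_sum nU_ge0 phiA G0 phiG yc xsmall ysmall c).
Qed.

Lemma cumul_leftE n : Cl_term E eps X Y (ml * b) mxy (d * mr) n
  = ml * block_term (act2 act) K phi x [::] n * mxy.
Proof.
rewrite (Cl_termE hE hX hY) /block_term /= -/ml -(twist_left aM a1 cA).
by rewrite /act_letter /= mul1r.
Qed.

Lemma cumul_crossE nm : Clr_term E eps X Y (ml * b) mxy (d * mr) nm
  = cumul_term (act2 act) K phi x y yc c nm.
Proof.
case: nm => n m; rewrite (Clr_termE hE hX hY) /cumul_term /block_term.
rewrite -/ml -/mr -/mxy.
case: n => [|n] /=; first by rewrite -(twist_right a1 cA).
by rewrite -(twist_cross aM a1 cA).
Qed.

Lemma moment_cumulant_series :
  [/\ abs_summable (Cl_term E eps X Y (ml * b) mxy (d * mr)),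
     abs_summable (Clr_term E eps X Y (ml * b) mxy (d * mr))
   & ml * mxy + mxy * mr = ml * c * mr + Cxy E eps X Y (ml * b) mxy (d * mr)].
Proof.
rewrite /Cxy (funext cumul_leftE) (funext cumul_crossE); split.
- by have := summ_abs (summ_mul ml mxy (block_summ nU_ge0 nU_act phiA G0 KG phiG xsmall [::])).
- by have := summ_abs (cumul_term_summ nU_ge0 nU_act phiA G0 KG phiG yc xsmall ysmall c).
rewrite (has_sum_sum (cumul_left_sum act1 nU_ge0 nU_act KA phiA phiE G0 KG phiG y yc xsmall c)).
rewrite (cumul_term_sum act1 nU_ge0 nU_act KA phiA phiE G0 KG phiG yc xsmall ysmall c).
by have := moment_cumulant_identity act1 nU_ge0 nU_act KA phiA phiE G0 KG phiG xsmall ysmall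
  shift_balance (twist_cons_coef c).
Qed.

End Identity.

Lemma bounded_map_nrm (R : realType) (V W : normedModType R[i]) (f : V -> W) :
  bounded_map f -> exists2 M : R, 0 <= M & forall v, nrm (f v) <= M * nrm v.
Proof.
(* [M] is a scalar of [R[i]]; [M] times the norm of [v] dominates a norm, so it is nonnegative and
   equals its own absolute value. *)
case=> M fM; exists (nrm (M : R[i]^o)); first exact: nrm_ge0.
move=> v; have := fM v; have p : 0 <= M * `|v| by apply: le_trans (fM v).
rewrite -(ger0_norm p) normrM normr_id (nrmE (M : R[i]^o)) !nrmE -rmorphM lecR.
by [].
Qed.

Theorem theorem5p6 (R : realType) (A B : banachAlgType R[i])
    (E : A -> B) (eps : B -> B -> A) (hE : banach_bb_ncps E eps)
    (X Y : A) (hX : left_face eps X) (hY : right_face eps Y) :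
  forall rho : R, 0 < rho -> exists2 delta : R, 0 < delta &
  forall b c d : B,
    `|c| <= (rho%:C)%C -> `|b| < (delta%:C)%C -> `|d| < (delta%:C)%C ->
    let ml := Ml E eps X b in
    let mr := Mr E eps Y d in
    let mxy := Mxy E eps X Y b c d in
    [/\ abs_summable (Ml_term E eps X b),
        abs_summable (Mr_term E eps Y d),
        abs_summable (M_term E eps X Y b c d),
        abs_summable (Cl_term E eps X Y (ml * b) mxy (d * mr)) /\
        abs_summable (Clr_term E eps X Y (ml * b) mxy (d * mr))
      & ml * mxy + mxy * mr = ml * c * mr + Cxy E eps X Y (ml * b) mxy (d * mr)].
Proof.
move=> rho _; have [hA Eb Lb Rb] := hE.
have [mE mE0 E_le] := bounded_map_nrm Eb; have [mL mL0 L_le] := bounded_map_nrm Lb.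
have [mR mR0 R_le] := bounded_map_nrm Rb.
have [h h0 wg] := word_moment_growth X Y (@nrm_ge0 R A) (@nrmM R A) (@nrm0 R B)
  (@nrm_ge0 R B) mE0 mL0 mR0 E_le L_le R_le.
pose nT (t : side * B) := nrm t.2.
have nT_ge0 t : 0 <= nT t by apply: nrm_ge0.
have nT_act t (u : B) : nT (act_letter t u) <= nT t * nrm u by apply: nrmM.
have a1 := @act_letter1 R[i] B.
have G0 : 0 <= 32 * h by rewrite mulr_ge0.
have wm := word_moment_adm hA Y hX.
have cg := cumul_growth (@nrm0 R B) (@nrm_ge0 R B) (@nrmD R B) (@nrmM R B) (@nrmN R B)
  a1 nT_ge0 nT_act h0 (adm_nil wm) wg.
have KG := twist_growth (@nrm_ge0 R B) (@nrmM R B) a1 nT_ge0 nT_act G0 cg.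
have wg' : growth (@nrm R B) nT (word_moment E eps X Y) (32 * h).
  by apply: growth_le wg => //; lra.
have phiG := twist_growth (@nrm_ge0 R B) (@nrmM R B) a1 nT_ge0 nT_act G0 wg'.
set o := nrm (1 : B); have o1 : 1 <= o by apply: nrm1_ge1.
(* The letters have weight [nrm b * o] and [nrm d * o], so both smallness conditions need
   [8 * o * o * (32 * h)] times the norm to be at most 1; the added 1 keeps [D] positive when
   [h = 0]. *)
set D := 8 * o * o * (32 * h + 1).
have D0 : 0 < D by rewrite mulr_gt0 ?mulr_gt0 //; lra.
exists D^-1; first by rewrite invr_gt0.
move=> b c d _; rewrite !nrmE !ltcR => bd dd.
have small u : nrm u < D^-1 -> 2 * o * (2 * (32 * h) * (nrm u * o)) <= 2^-1.
  move=> lt; have {}lt : nrm u * D < 1 by rewrite -ltr_pdivlMr // div1r.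
  have u0 : 0 <= nrm u * o * o by rewrite !mulr_ge0 ?nrm_ge0.
  by move: lt; rewrite /D; lra.
have xsmall : 2 * o * (2 * (32 * h) * norm2 (@nrm R B) nT (b, (lft, 1))) <= 2^-1.
  exact: small bd.
have ysmall : 2 * o * (2 * (32 * h) * norm2 (@nrm R B) nT (1, (rgt, d))) <= 2^-1.
  by rewrite (_ : norm2 _ _ _ = nrm d * o) ?small // /norm2 mulrC.
have [sl ->] := MlE hA hX hY G0 phiG xsmall.
have [sr ->] := MrE hA hX hY G0 phiG ysmall.
have [sm ->] := MxyE hA hX hY G0 phiG c xsmall ysmall.
have [scl sclr e] := moment_cumulant_series hA hX hY G0 KG phiG c xsmall ysmall.
by split.
Qed.
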